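(* Let $f:\mathbb R^n\times\mathbb R^{d\times n}\to[0,+\infty)$ be a Borel function, $1$-periodic in the first variable, for which there exist constants $\alpha,\beta>0$ such that $\alpha|Z|\le f(x,Z)\le\beta(|Z|+1)$ for every $x\in\mathbb R^n$ and $Z\in\mathbb R^{d\times n}$. Assume that $f(x,\cdot)$ is level convex for every $x\in\mathbb R^n$. Then the function $$\widetilde f_{\rm hom}(Z):=\inf_{j\in\mathbb N}\inf\Big\{\operatorname*{ess\,sup}_{x\in jY}f_\infty(x,Z+Du(x)):u\in W^{1,\infty}_\#(jY;\mathbb R^d)\Big\}$$ satisfies, for all $Z\in\mathbb R^{d\times n}$, $$\widetilde f_{\rm hom}(Z)=\inf\Big\{\operatorname*{ess\,sup}_{x\in Y}f_\infty(x,Z+Du(x)):u\in W^{1,\infty}_\#(Y;\mathbb R^d)\Big\}.$$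
   Context: $Y=(0,1)^n$; $1$-periodic in the first variable means $f(x+e_i,Z)=f(x,Z)$ for each vector $e_i$ of the canonical basis of $\mathbb R^n$. $|Z|=\sum_{i=1}^d|Z_i|$, where $Z_i$ are the rows of $Z$ and $|Z_i|$ is the Euclidean norm. $W^{1,\infty}_\#(jY;\mathbb R^d)$ is the space of functions in $W^{1,\infty}_{\rm loc}(\mathbb R^n;\mathbb R^d)$ that are $j$-periodic in each coordinate direction. A function $h:\mathbb R^{d\times n}\to\mathbb R$ is level convex if $h(tZ_1+(1-t)Z_2)\le\max\{h(Z_1),h(Z_2)\}$ for all $t\in(0,1)$, $Z_1,Z_2\in\mathbb R^{d\times n}$. For $k\in\mathbb N$, $k\ge1$, $\widetilde{f^k}$ denotes the relaxed energy density of $f^k$: the Carathéodory function, quasiconvex in the second variable, such that for every bounded open set $A$ the functional $u\mapsto\int_A\widetilde{f^k}(x,Du)\,dx$ is the sequentially weakly lower semicontinuous envelope on $W^{1,k}(A;\mathbb R^d)$ of $u\mapsto\int_Af^k(x,Du)\,dx$. (It need not coincide with the quasiconvex envelope of $f^k(x,\cdot)$.) Set $f_\infty(x,Z):=\sup_{k\ge1}(\widetilde{f^k})^{1/k}(x,Z)$. *)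

(* Defs.v *)
From HB Require Import structures.
From mathcomp Require Import all_boot all_order all_algebra.
From mathcomp Require Import all_classical all_reals all_analysis.
From mathcomp Require Import measurable_realfun.

Set Implicit Arguments.
Unset Strict Implicit.
Unset Printing Implicit Defensive.

Import Order.TTheory GRing.Theory Num.Theory.
Import numFieldNormedType.Exports.

Local Open Scope classical_set_scope.
Local Open Scope ring_scope.

(* The spaces of matrices, in particular R^n = 'rV[R]_n, carry their Borel
   sigma-algebra. *)
Section borel_mx.
Variables (R : realType) (m n : nat).

Definition open_mx : set (set 'M[R]_(m, n)) := @open 'M[R]_(m, n).

Let borel_mx0 : <<s open_mx >> set0.
Proof. exact: sigma_algebra0. Qed.

Let borel_mxC A : <<s open_mx >> A -> <<s open_mx >> (~` A).
Proof. exact: sigma_algebraC. Qed.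

Let borel_mx_bigcup (F : (set 'M[R]_(m, n))^nat) :
  (forall i, <<s open_mx >> (F i)) -> <<s open_mx >> (\bigcup_i F i).
Proof. exact: sigma_algebra_bigcup. Qed.

HB.instance Definition _ := @isMeasurable.Build (sigma_display open_mx)
  'M[R]_(m, n) <<s open_mx >> borel_mx0 borel_mxC borel_mx_bigcup.

Lemma measurable_open_mx (U : set 'M[R]_(m, n)) : open U -> measurable U.
Proof. by move=> oU; apply: sub_sigma_algebra. Qed.

End borel_mx.

(* Lebesgue measure on R^n is built by induction on n, as the image of the
   product of the Lebesgue measures on R and R^n under the identification
   R * R^n = R^(n+1); on R^0 it is the Dirac mass. *)
Definition rV_cons (R : realType) n (p : R * 'rV[R]_n) : 'rV[R]_n.+1 :=
  \row_j (if unlift ord0 j is Some k then p.2 0 k else p.1).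

Definition rV_uncons (R : realType) n (v : 'rV[R]_n.+1) : R * 'rV[R]_n :=
  (v 0 0, \row_k v 0 (lift ord0 k)).

Lemma rV_consK (R : realType) n : cancel (@rV_cons R n) (@rV_uncons R n).
Proof.
move=> [t v]; rewrite /rV_uncons /rV_cons mxE unlift_none; congr pair.
by apply/rowP => k; rewrite !mxE liftK.
Qed.

Lemma measurable_rV_uncons (R : realType) n :
  measurable_fun [set: 'rV[R]_n.+1] (@rV_uncons R n).
Proof.
apply: measurable_fun_pair.
  apply: (measurability _ (RGenOpens.measurableE R)) => _ [_ [a [b ->]] <-].
  rewrite setTI; apply: measurable_open_mx.
  apply: (@open_comp _ _ (fun v : 'rV[R]_n.+1 => v 0 0)).
    by move=> v _; exact: coord_continuous.
  exact: interval_open.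
apply: (measurability (@open_mx R 1 n)) => // _ [U oU <-].
rewrite setTI; apply: measurable_open_mx.
apply: open_comp oU => v _ A [B Bv BA] /=.
exists (fun i j => if unlift ord0 j is Some k then B i k else setT) => [i j|w Bw].
  case: unliftP => [k ->|_]; last exact: filterT.
  by have := Bv i k; rewrite mxE ord1.
apply: BA => i k; have := Bw i (lift ord0 k).
by rewrite liftK mxE ord1.
Qed.

(* An open set is a countable union of balls with rational centre and
   radius, and the preimage of such a ball is a product. *)
Lemma measurable_rV_cons (R : realType) n :
  measurable_fun [set: R * 'rV[R]_n] (@rV_cons R n).
Proof.
pose B (cr : 'rV[rat]_n.+1 * rat) : set 'rV[R]_n.+1 :=
  ball (\row_j ratr (cr.1 0 j) : 'rV[R]_n.+1) (ratr cr.2).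
apply: (measurability (@open_mx R 1 n.+1)) => // _ [U oU <-]; rewrite setTI.
have -> : U = \bigcup_(cr in [set cr | B cr `<=` U]) B cr.
  apply/seteqP; split => [x Ux|x [cr]]; last exact.
  have /nbhs_ballP[e /= e0 xeU] : nbhs x U by exact: open_nbhs_nbhs.
  have [r] := rat_in_itvoo (divr_gt0 e0 (ltr0n _ 2)).
  rewrite in_itv /= => /andP[r0 re].
  have /choice[c xc] j : exists q : rat, `|ratr q - x 0 j| < ratr r :> R.
    have /rat_in_itvoo[q] : x 0 j - ratr r < x 0 j + ratr r.
      by rewrite ltrD2l gtrN.
    by exists q; rewrite ltr_distl.
  have Bx : B (\row_j c j, r) x.
    by split => // i j; rewrite !mxE ord1 /ball /= /ball_ xc.
  exists (\row_j c j, r) => //= y By; apply: xeU.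
  by rewrite [e]splitr; apply: ball_triangle (le_ball (ltW re) By);
    apply/ball_sym/(le_ball (ltW re)).
rewrite bigcup_mkcond preimage_bigcup.
apply: countable_bigcupT_measurable => // -[c r]; case: ifP => _; last first.
  by rewrite preimage_set0.
case: (ltrP 0 (ratr r : R)) => [r0|r0]; last first.
  rewrite (_ : _ @^-1` _ = set0)//; apply/seteqP; split => // p [+ _].
  by rewrite /= ltNge r0.
rewrite (_ : _ @^-1` _ = ball (ratr (c 0 ord0) : R) (ratr r) `*`
  ball (\row_k ratr (c 0 (lift ord0 k)) : 'rV[R]_n) (ratr r)).
  apply: measurableX; first exact: measurable_ball.
  by apply: measurable_open_mx; exact: ball_open.
apply/seteqP; split => [[t v] [_ /= tv]|[t v] [/= tc [_ vc]]].
  split => /=; first by have := tv 0 ord0; rewrite !mxE unlift_none.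
  split => // i k; have := tv 0 (lift ord0 k).
  by rewrite !mxE liftK ord1.
split => // i j; rewrite ord1 !mxE; case: unliftP => [k ->|-> //].
by have := vc 0 k; rewrite !mxE.
Qed.

Section lebesgue_rV.
Variable R : realType.
Local Open Scope ereal_scope.

Section step.
Variables (n : nat) (m : {sigma_finite_measure set 'rV[R]_n -> \bar R}).

Definition lebesgue_rV_step : set 'rV[R]_n.+1 -> \bar R :=
  pushforward ((@lebesgue_measure R) \x m) (@rV_cons R n).

Let step0 : lebesgue_rV_step set0 = 0.
Proof. by rewrite /lebesgue_rV_step /pushforward preimage_set0 measure0. Qed.

Let step_ge0 A : 0 <= lebesgue_rV_step A.
Proof. by rewrite /lebesgue_rV_step /pushforward; exact: measure_ge0. Qed.

Let step_sigma_additive : semi_sigma_additive lebesgue_rV_step.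
Proof.
move=> F mF tF mUF; rewrite /lebesgue_rV_step /pushforward preimage_bigcup.
have mcons A : measurable A -> measurable (@rV_cons R n @^-1` A).
  by move=> mA; rewrite -[X in measurable X]setTI; exact: measurable_rV_cons.
apply: measure_semi_sigma_additive => [i||]; first exact: mcons.
  apply/trivIsetP => i j _ _ ij; rewrite -preimage_setI.
  by move/trivIsetP : tF => /(_ _ _ _ _ ij) ->//; rewrite preimage_set0.
by rewrite -preimage_bigcup; exact: mcons.
Qed.

HB.instance Definition _ := isMeasure.Build _ _ _ lebesgue_rV_step
  step0 step_ge0 step_sigma_additive.

Let step_sigma_finite : sigma_finite setT lebesgue_rV_step.
Proof.
have /sigma_finiteP[F [FT ndF Foo]] := sigma_finiteT (@lebesgue_measure R).
have /sigma_finiteP[G [GT ndG Goo]] := sigma_finiteT m.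
exists (fun k => @rV_uncons R n @^-1` (F k `*` G k)).
  apply/seteqP; split => // v _.
  have [i _ Fi] : (\bigcup_i F i) (rV_uncons v).1 by rewrite -FT.
  have [j _ Gj] : (\bigcup_j G j) (rV_uncons v).2 by rewrite -GT.
  exists (maxn i j) => //; split.
    by move: Fi; exact/subsetPset/ndF/leq_maxl.
  by move: Gj; exact/subsetPset/ndG/leq_maxr.
move=> k; have [mF Fk] := Foo k; have [mG Gk] := Goo k; split.
  rewrite -[X in measurable X]setTI; apply: measurable_rV_uncons => //.
  exact: measurableX.
rewrite /lebesgue_rV_step /pushforward -comp_preimage.
rewrite (_ : _ \o _ = id); last by apply/funext => p; exact: rV_consK.
by rewrite preimage_id product_measure1E// lte_mul_pinfty// ge0_fin_numE.
Qed.

HB.instance Definition _ := Measure_isSigmaFinite.Build _ _ _ lebesgue_rV_step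
  step_sigma_finite.

End step.

Fixpoint lebesgue_rV n : {sigma_finite_measure set 'rV[R]_n -> \bar R} :=
  match n with
  | 0 => dirac (0%R : 'rV[R]_0)
  | k.+1 => lebesgue_rV_step (lebesgue_rV k)
  end.

End lebesgue_rV.

Definition borel_fun (T : topologicalType) (R : realType) (h : T -> R) :=
  forall B : set R, measurable B -> <<s @open T >> (h @^-1` B).

Section relaxation.
Variables (R : realType) (n d : nat).

Local Notation Rn := 'rV[R]_n.
Local Notation Rd := 'rV[R]_d.
Local Notation Mat := 'M[R]_(d, n).
Local Notation mu := (lebesgue_rV R n).
Local Notation e_ j := (delta_mx 0 j : Rn).

Definition rows_norm (Z : Mat) : R :=
  \sum_(i < d) Num.sqrt (\sum_(j < n) Z i j ^+ 2).

Definition cube (r : R) : set Rn := [set x | forall i, 0 < x 0 i < r].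

Definition level_convex (h : Mat -> R) := forall t Z1 Z2, 0 < t < 1 ->
  h (t *: Z1 + (1 - t) *: Z2) <= Num.max (h Z1) (h Z2).

Definition ess_sup_on (A : set Rn) (h : Rn -> \bar R) : \bar R :=
  ereal_inf [set y | {ae mu, forall x, A x -> (h x <= y)%E}].

Fixpoint Ck (k : nat) (phi : Rn -> R) : Prop :=
  continuous phi /\
  if k is k'.+1 then
    forall j, (forall x, derivable phi x (e_ j)) /\
              Ck k' (fun x => 'D_(e_ j) phi x)
  else True.

Definition support_of (phi : Rn -> R) := closure [set x | phi x != 0].

Definition test_fun (A : set Rn) (phi : Rn -> R) :=
  [/\ forall k, Ck k phi, compact (support_of phi) & support_of phi `<=` A].

Definition loc_integrable (A : set Rn) (h : Rn -> R) := forall K : set Rn,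
  compact K -> K `<=` A -> mu.-integrable K (EFin \o h).

Definition is_weak_gradient (A : set Rn) (u : Rn -> Rd) (G : Rn -> Mat) :=
  forall i j,
  [/\ loc_integrable A (fun x => u x 0 i), loc_integrable A (fun x => G x i j) &
      forall phi, test_fun A phi ->
        \int[mu]_(x in A) (u x 0 i * 'D_(e_ j) phi x) =
        - \int[mu]_(x in A) (G x i j * phi x)].

(* Weak gradients are unique up to null sets; the value is irrelevant when
   there is none. *)
Definition weak_gradient (A : set Rn) (u : Rn -> Rd) : Rn -> Mat :=
  xget (fun=> 0) [set G | is_weak_gradient A u G].

Definition weakly_differentiable (A : set Rn) (u : Rn -> Rd) :=
  exists G, is_weak_gradient A u G.

(* The library norm of a matrix is the sup norm of its entries, so that
   sobolev_norm is equivalent to the usual norm of W^{1,k}; the space, its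
   dual and its weak convergence are the usual ones. *)
Definition sobolev_energy (k : nat) (A : set Rn) (u : Rn -> Rd) : \bar R :=
  (\int[mu]_(x in A) (`|u x| ^+ k)%:E +
   \int[mu]_(x in A) (`|weak_gradient A u x| ^+ k)%:E)%E.

(* W^{1,k}(A; R^d), for 1 <= k; its elements are represented by functions,
   not by classes modulo equality almost everywhere on A. *)
Definition sobolev (k : nat) (A : set Rn) : set (Rn -> Rd) :=
  [set u | [/\ measurable_fun A u, measurable_fun A (weak_gradient A u),
             weakly_differentiable A u & (sobolev_energy k A u < +oo)%E]].

Definition sobolev_norm (k : nat) (A : set Rn) (u : Rn -> Rd) : \bar R :=
  (sobolev_energy k A u `^ k%:R^-1)%E.

Definition sobolev_dual (k : nat) (A : set Rn) : set ((Rn -> Rd) -> R) :=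
  [set l | [/\ forall u v, sobolev k A u -> sobolev k A v ->
                 l (fun x => u x + v x) = l u + l v,
              forall (c : R) u, sobolev k A u ->
                 l (fun x => c *: u x) = c * l u &
              exists C : R, forall u, sobolev k A u ->
                 (`|l u|%:E <= C%:E * sobolev_norm k A u)%E]].

Definition sobolev_weak_cvg (k : nat) (A : set Rn)
    (v : nat -> Rn -> Rd) (u : Rn -> Rd) :=
  forall l, sobolev_dual k A l -> l (v m) @[m --> \oo] --> l u.

Definition seq_weakly_lsc (k : nat) (A : set Rn)
    (H : (Rn -> Rd) -> \bar R) :=
  forall (v : nat -> Rn -> Rd) u, (forall m, sobolev k A (v m)) ->
  sobolev k A u -> sobolev_weak_cvg k A v u ->
  (H u <= limn_einf (fun m => H (v m)))%E.

(* The largest sequentially weakly lower semicontinuous functional on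
   W^{1,k}(A; R^d) below F. *)
Definition seq_weak_lsc_envelope (k : nat) (A : set Rn)
    (F : (Rn -> Rd) -> \bar R) (u : Rn -> Rd) : \bar R :=
  ereal_sup [set H u | H in [set H | seq_weakly_lsc k A H /\
    forall v, sobolev k A v -> (H v <= F v)%E]].

Definition integral_functional (h : Rn -> Mat -> R) (A : set Rn)
    (u : Rn -> Rd) : \bar R :=
  (\int[mu]_(x in A) (h x (weak_gradient A u x))%:E)%E.

(* Measurability in x is with respect to the Lebesgue sigma-algebra: a
   function is Lebesgue measurable when it agrees almost everywhere with a
   Borel one. *)
Definition caratheodory (h : Rn -> Mat -> R) :=
  (forall Z, exists2 h' : Rn -> R, measurable_fun setT h' &
     {ae mu, forall x, h x Z = h' x}) /\
  {ae mu, forall x, continuous (h x)}.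

Definition gradient (phi : 'I_d -> Rn -> R) (x : Rn) : Mat :=
  \matrix_(i, j) 'D_(e_ j) (phi i) x.

(* Quasiconvexity in the sense of Morrey. For continuous h, testing with
   smooth fields is equivalent to testing with W_0^{1,oo}(A; R^d). *)
Definition quasiconvex (h : Mat -> R) :=
  forall (A : set Rn) (phi : 'I_d -> Rn -> R) (Z : Mat),
  open A -> bounded_set A -> (forall i, test_fun A (phi i)) ->
  ((h Z)%:E * mu A <= \int[mu]_(x in A) (h (Z + gradient phi x))%:E)%E.

(* g is a version of the relaxed energy density of h on W^{1,k}, which is
   determined up to a null set of points x. *)
Definition relaxed_density (k : nat) (h g : Rn -> Mat -> R) :=
  [/\ forall x Z, 0 <= g x Z,
      caratheodory g,
      {ae mu, forall x, quasiconvex (g x)} &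
      forall (A : set Rn) u, open A -> bounded_set A -> sobolev k A u ->
        integral_functional g A u =
        seq_weak_lsc_envelope k A (integral_functional h A) u].

(* sup_(k >= 1) (g k)^(1/k) *)
Definition sup_root (g : nat -> Rn -> Mat -> R) (x : Rn) (Z : Mat) : \bar R :=
  ereal_sup [set ((g k x Z) `^ k%:R^-1)%:E | k in [set k | (0 < k)%N]].

Definition loc_ess_bounded (V : normedModType R) (h : Rn -> V) :=
  forall K : set Rn, compact K ->
  exists M : R, {ae mu, forall x, K x -> `|h x| <= M}.

(* W^{1,oo}_#(jY; R^d) *)
Definition sobolev_per (j : nat) : set (Rn -> Rd) :=
  [set u | [/\ weakly_differentiable setT u, loc_ess_bounded u,
              loc_ess_bounded (weak_gradient setT u) &
              forall i, {ae mu, forall x, u (x + j%:R *: e_ i) = u x}]].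

Definition cell_inf (h : Rn -> Mat -> \bar R) (j : nat) (Z : Mat) : \bar R :=
  ereal_inf [set ess_sup_on (cube j%:R)
    (fun x => h x (Z + weak_gradient setT u x)) | u in sobolev_per j].

Definition hom_density (h : Rn -> Mat -> \bar R) (Z : Mat) : \bar R :=
  ereal_inf [set cell_inf h j Z | j in [set j | (0 < j)%N]].

End relaxation.

(* Main.v *)
Require Import Defs.
From HB Require Import structures.
From mathcomp Require Import all_boot all_order all_algebra.
From mathcomp Require Import all_classical all_reals all_analysis.
From mathcomp Require Import measurable_realfun.
From mathcomp Require Import ring lra.

Set Implicit Arguments.
Unset Strict Implicit.
Unset Printing Implicit Defensive.

Import Order.TTheory GRing.Theory Num.Theory.
Import numFieldNormedType.Exports.

Local Open Scope classical_set_scope.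
Local Open Scope ring_scope.

(** The inequality [<=] is the case [j = 1] of the infimum.  For the converse, a
    competitor [u] on the cube of side [j] is replaced by the mean [v] of its
    [j ^ n] translates [x |-> u (x + k)], where [k] runs through the vectors
    with coordinates in [{0, .., j - 1}].  The mean is 1-periodic, because a unit
    step permutes the translates modulo the periods of [u], and
    [Z + Dv x] is the mean of the matrices [Z + Du (x + k)].  Hence [v] is at
    least as good as [u] as soon as, for almost every [x], the function
    [f_oo = sup_root ftilde] has the two properties
    - [f_oo x Z <= f_oo (x + k) Z] for every integer vector [k] and every [Z];
    - the sublevel sets of [f_oo x] are closed under arithmetic means.
    They are [ae_sup_root_shiftv] and [ae_sup_root_level_convex] (with
    [rat_level_convex_mean]); [ess_sup_lattice_mean] draws the conclusion.

    The densities [ftilde k] are only known through lower semicontinuous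
    envelopes, and level convexity, being a statement about a maximum, does not
    pass to envelopes of integrals.  It is therefore traded for inequalities that
    are linear in the integrands, at the price of changing the exponent.  Since
    [y <= y ^ m / m + 1] for [y >= 0], level convexity of [f x] gives, with
    [Z = t Z1 + (1 - t) Z2] and any [M > 0],
      [f x Z ^ k <= b (f x Z1 ^ (k m) + f x Z2 ^ (k m)) + M ^ k],
      [b = M ^ k / (m M ^ (k m))].
    Integrated along two Sobolev functions [u], [v], the right-hand side
    separates into a functional of [u] and a functional of [v].  Such an inequality
    passes to the envelopes, one variable at a time ([envelope_pair_le]): for
    fixed [v] the map [u |-> t u + (1 - t) v] is weakly continuous from [W^{1,km}]
    to [W^{1,k}], so that its composition with a weakly lower semicontinuous
    functional is again lower semicontinuous, and competes in the definition of
    the envelope for the exponent [k m].  Evaluated at affine functions on all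
    bounded open sets, the inequality between envelopes becomes an inequality
    almost everywhere between the densities
    ([ae_relaxed_density_level_convex]).  If now [f_oo x Z1] and [f_oo x Z2] are
    at most [M], the right-hand side is at most [(2 / m + 1) M ^ k] for every [m],
    and letting [m] tend to infinity gives [ftilde k x Z <= M ^ k] for every [k].
    The behaviour under translations is obtained in the same way, from the weak
    continuity of [u |-> u (x + k)].

    Each of these inequalities holds outside a null set that depends on the
    matrices, on [t] and on [M].  Taking these parameters rational leaves
    countably many null sets, and the continuity of [ftilde k x] restores
    arbitrary matrices.

    The analytic background consists of the translation invariance of Lebesgue
    measure on [R^n], the comparison of two functions whose integrals over bounded
    open sets are comparable ([ae_le_integral_open], by outer regularity), the
    uniqueness of weak gradients ([fundamental_lemma], tested with products of
    [exp (- 1 / t)]), the weak gradients of affine functions, translates and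
    linear combinations, and the continuous inclusion of [W^{1,km}] in [W^{1,k}]
    on bounded open sets. *)

(** * Measurability in spaces of matrices *)

(** The balls with rational centre and radius form a countable base. *)
Definition rat_ball (R : realType) m n (cr : 'M[rat]_(m, n) * rat) :
  set 'M[R]_(m, n) := ball (map_mx ratr cr.1 : 'M[R]_(m, n)) (ratr cr.2).

Arguments rat_ball R {m n} cr.

(** With [r < e / 2] and a rational centre within [r] of [x], the ball of radius
    [r] contains [x] and stays within [2 r < e] of it. *)
Lemma nbhs_rat_ball (R : realType) m n (U : set 'M[R]_(m, n)) x : nbhs x U ->
  exists2 cr, rat_ball R cr x & rat_ball R cr `<=` U.
Proof.
move=> /nbhs_ballP[e /= e0 xeU].
have [r] := rat_in_itvoo (divr_gt0 e0 (ltr0n _ 2)).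
rewrite in_itv /= => /andP[r0 re].
have /choice[c xc] (ij : 'I_m * 'I_n) :
    exists q : rat, `|ratr q - x ij.1 ij.2| < ratr r :> R.
  have /rat_in_itvoo[q] : x ij.1 ij.2 - ratr r < x ij.1 ij.2 + ratr r.
    by rewrite ltrD2l gtrN.
  by exists q; rewrite ltr_distl.
have Bx : rat_ball R (\matrix_(i, j) c (i, j), r) x.
  by split => // i j; rewrite !mxE /ball /= /ball_; exact: (xc (i, j)).
exists (\matrix_(i, j) c (i, j), r) => // y By; apply: xeU.
by rewrite [e]splitr; apply: ball_triangle (le_ball (ltW re) By);
  apply/ball_sym/(le_ball (ltW re)).
Qed.

Lemma open_bigcup_rat_ball (R : realType) m n (U : set 'M[R]_(m, n)) :
  open U -> U = \bigcup_(cr in [set cr | rat_ball R cr `<=` U]) rat_ball R cr.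
Proof.
move=> oU; apply/seteqP; split => [x Ux|x [cr]]; last exact.
have [cr crx crU] := nbhs_rat_ball (open_nbhs_nbhs (conj oU Ux)).
by exists cr.
Qed.

Lemma open_rat_ball (R : realType) m n (cr : 'M[rat]_(m, n) * rat) :
  open (rat_ball R cr).
Proof. exact: ball_open. Qed.

Lemma measurable_rat_ball (R : realType) m n (cr : 'M[rat]_(m, n) * rat) :
  measurable (rat_ball R cr).
Proof. by apply: measurable_open_mx; exact: open_rat_ball. Qed.

(** The preimage of a ball for the sup norm is a finite intersection of
    preimages of intervals, and every open set is a countable union of rational
    balls. *)
Lemma measurable_fun_mx (R : realType) d (T : measurableType d) m n
    (D : set T) (G : T -> 'M[R]_(m, n)) : measurable D ->
  (forall i j, measurable_fun D (fun x => G x i j)) -> measurable_fun D G.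
Proof.
move=> mD mG; apply: (measurability (@open_mx R m n)) => // _ [U oU <-].
rewrite (open_bigcup_rat_ball oU) preimage_bigcup setI_bigcupr bigcup_mkcond.
apply: countable_bigcupT_measurable => // -[c r]; case: ifP => // _.
case: (ltrP 0 (ratr r : R)) => [r0|r0]; last first.
  rewrite (_ : _ `&` _ = set0)//; apply/seteqP; split => // p [_ [+ _]].
  by rewrite /= ltNge r0.
rewrite (_ : _ `&` _ = \bigcap_(ij : 'I_m * 'I_n) (D `&`
   (fun x => G x ij.1 ij.2) @^-1` ball (ratr (c ij.1 ij.2) : R) (ratr r)) `&` D).
  apply: measurableI => //; apply: fin_bigcap_measurable => [|ij _];
    first exact: finite_finset.
  exact: mG (measurable_ball _ _).
apply/seteqP; split => [x [Dx [_ /= xr]]|x [xr Dx]].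
  by split => // -[i j] _; split => //=; have := xr i j; rewrite mxE.
by split => //; split => // i j; have [_] := xr (i, j) I; rewrite /= mxE.
Qed.

(** The graph map pulls the open sets of the product back to measurable sets,
    since these are countable unions of products of rational balls; the class of
    sets that are pulled back to measurable sets is a sigma-algebra. *)
Lemma borel_fun_graph (R : realType) m n p q (h : 'M[R]_(m, n) * 'M[R]_(p, q) -> R)
    (D : set 'M[R]_(m, n)) (G : 'M[R]_(m, n) -> 'M[R]_(p, q)) :
  borel_fun h -> measurable D -> measurable_fun D G ->
  measurable_fun D (fun x => h (x, G x)).
Proof.
move=> hB mD mG _ B mB.
pose S := [set E : set ('M[R]_(m, n) * 'M[R]_(p, q)) |
   measurable (D `&` (fun x => (x, G x)) @^-1` E)].
suff: <<s open >> `<=` S by move=> /(_ _ (hB _ mB)).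
apply: smallest_sub; first split.
- by rewrite /S /= preimage_set0 setI0.
- move=> E SE; rewrite /S /= setTD preimage_setC -setDE.
  rewrite -[X in measurable X](_ : D `\` (D `&` ((fun x => (x, G x)) @^-1` E)) = _).
    exact: measurableD.
  by rewrite setDIr setDv set0U.
- move=> F SF; rewrite /S /= preimage_bigcup setI_bigcupr.
  by apply: bigcup_measurable => k _; exact: SF.
move=> U oU; rewrite /S /=.
have -> : U = \bigcup_(c in [set c : ('M[rat]_(m, n) * rat) * ('M[rat]_(p, q) * rat) |
     rat_ball R c.1 `*` rat_ball R c.2 `<=` U]) (rat_ball R c.1 `*` rat_ball R c.2).
  apply/seteqP; split => [[x y] Uxy|xy [c]]; last exact.
  have [[V W] [/= Vx Wy] VWU] := open_nbhs_nbhs (conj oU Uxy).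
  have [c1 c1x c1V] := nbhs_rat_ball Vx.
  have [c2 c2y c2W] := nbhs_rat_ball Wy.
  exists (c1, c2) => //= z [/= z1 z2]; apply: VWU; split; [exact: c1V|exact: c2W].
rewrite preimage_bigcup setI_bigcupr bigcup_mkcond.
apply: countable_bigcupT_measurable => // -[c1 c2]; case: ifP => // _.
rewrite (_ : _ `&` _ = (D `&` rat_ball R c1) `&` (D `&` G @^-1` rat_ball R c2)).
  apply: measurableI; first by apply: measurableI => //; exact: measurable_rat_ball.
  by apply: mG => //; exact: measurable_rat_ball.
by apply/seteqP; split => x /= => [[? []]|[[? ?] []]].
Qed.

Lemma measurable_coord (R : realType) m n (i : 'I_m) (j : 'I_n) (D : set 'M[R]_(m, n)) :
  measurable D -> measurable_fun D (fun x => x i j).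
Proof.
move=> mD; apply: (measurability _ (RGenOpens.measurableE R)) => // _ [_ [a [b ->]] <-].
apply: measurableI => //; apply: measurable_open_mx.
apply: (@open_comp _ _ (fun v : 'M[R]_(m, n) => v i j)).
  by move=> v _; exact: coord_continuous.
exact: interval_open.
Qed.

Lemma continuous_measurable_mx (R : realType) m n (D : set 'M[R]_(m, n)) (h :
  'M[R]_(m, n) -> R) :
  measurable D -> continuous h -> measurable_fun D h.
Proof.
move=> mD ch; apply: (measurability _ (RGenOpens.measurableE R)) => // _ [_ [a [b ->]] <-].
apply: measurableI => //; apply: measurable_open_mx.
apply: open_comp => [v _|]; [exact: ch|exact: interval_open].
Qed.

(** * Lower integrals, measure-preserving maps and translations *)

Section lower_integral.
Context d (T : measurableType d) (R : realType).
Variable m : {measure set T -> \bar R}.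
Local Open Scope ereal_scope.
Import HBNNSimple.

(** The integral of a nonnegative function, measurable or not, is the supremum
    of the integrals of the simple functions below it.  The relaxed densities
    agree only almost everywhere with Borel functions, so that the comparison
    principles of this part are stated for this lower integral. *)
Lemma ge0_integral_le_ub (D : set T) (f : T -> \bar R) c :
  (forall x, D x -> 0 <= f x) ->
  (forall h : {nnsfun T >-> R}, (forall x, (h x)%:E <= (f \_ D) x) ->
    \int[m]_x (h x)%:E <= c) ->
  \int[m]_(x in D) f x <= c.
Proof.
move=> f0 hc; rewrite ge0_integralE//; apply: ge_ereal_sup => _ [h /= hf <-].
by have := hc h hf; rewrite integral_nnsfun// patch_setT.
Qed.

Lemma nnsfun_le_ge0_integral (D : set T) (f : T -> \bar R)
    (h : {nnsfun T >-> R}) : (forall x, D x -> 0 <= f x) ->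
  (forall x, (h x)%:E <= (f \_ D) x) ->
  \int[m]_x (h x)%:E <= \int[m]_(x in D) f x.
Proof.
move=> f0 hf; rewrite [leRHS]ge0_integralE//; apply: ereal_sup_ubound.
by exists h => //; rewrite integral_nnsfun// patch_setT.
Qed.

(** A simple function below [f] becomes a simple function below [g], with the
    same integral, once it is set to [0] on the exceptional null set. *)
Lemma ae_ge0_le_lower_integral (D : set T) (f g : T -> \bar R) :
  (forall x, D x -> 0 <= f x) -> (forall x, D x -> 0 <= g x) ->
  {ae m, forall x, D x -> f x <= g x} ->
  \int[m]_(x in D) f x <= \int[m]_(x in D) g x.
Proof.
move=> f0 g0 [N [mN N0 fgN]]; apply: ge0_integral_le_ub => // h hf.
have mCN := measurableC mN.
rewrite (_ : \int[m]_x (h x)%:E = \int[m]_x (proj_nnsfun h mCN x)%:E).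
  apply: nnsfun_le_ge0_integral => // x; rewrite /= mindicE.
  case: (boolP (x \in ~` N)) => [|_]; last first.
    by rewrite mulr0 patchE; case: ifPn => // xD; apply: g0; rewrite inE in xD.
  rewrite inE mulr1 => Nx; apply: (le_trans (hf x)).
  rewrite !patchE; case: ifPn => // xD; rewrite inE in xD.
  by apply: contrapT => nfg; apply/Nx/fgN => /= /(_ xD).
apply: ge0_ae_eq_integral => //.
- by apply/measurable_EFinP; exact: measurable_funP.
- by apply/measurable_EFinP; exact: measurable_funP.
- by move=> x _; rewrite lee_fin.
- by move=> x _; rewrite lee_fin.
exists N; split => // x /= xN; apply: contrapT => Nx; apply: xN => _.
by rewrite mindicE mem_set// mulr1.
Qed.

Lemma ae_eq_lower_integral (D : set T) (f g : T -> \bar R) :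
  {ae m, forall x, D x -> f x = g x} ->
  \int[m]_(x in D) f x = \int[m]_(x in D) g x.
Proof.
move=> fg; rewrite [LHS]integralE [RHS]integralE.
have H (f1 f2 : T -> \bar R) : {ae m, forall x, D x -> f1 x = f2 x} ->
    (\int[m]_(x in D) f1^\+ x <= \int[m]_(x in D) f2^\+ x) /\
    (\int[m]_(x in D) f1^\- x <= \int[m]_(x in D) f2^\- x).
  move=> f12; split; apply: ae_ge0_le_lower_integral => //; move: f12;
    by apply: filterS => x + Dx; move=> /(_ Dx) fx; rewrite ?funeposE ?funenegE fx.
have [fgp fgn] := H _ _ fg.
have [gfp gfn] : (\int[m]_(x in D) g^\+ x <= \int[m]_(x in D) f^\+ x) /\
    (\int[m]_(x in D) g^\- x <= \int[m]_(x in D) f^\- x).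
  by apply: H; move: fg; apply: filterS => x + Dx; move=> /(_ Dx).
by congr (_ - _); apply/eqP; rewrite eq_le ?fgp ?fgn.
Qed.

Section measure_preserving.
Variables (phi psi : T -> T).
Hypotheses (mphi : measurable_fun setT phi) (mpsi : measurable_fun setT psi).
Hypotheses (phiK : cancel phi psi) (psiK : cancel psi phi).
Hypothesis m_phi : forall A, measurable A -> m (phi @^-1` A) = m A.

(** A simple function below [f] on [D] corresponds, by composition with the
    bijection [phi], to a simple function below [f \o phi] on [phi @^-1` D], and
    conversely, so that the change of variables holds for lower integrals. *)
Lemma ge0_integral_preserving (D : set T) (f : T -> \bar R) :
  (forall x, D x -> 0 <= f x) ->
  \int[m]_(x in phi @^-1` D) f (phi x) = \int[m]_(x in D) f x.
Proof.
have intE (h : T -> \bar R) : measurable_fun setT h -> (forall x, 0 <= h x) ->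
    \int[m]_x h (phi x) = \int[m]_x h x.
  move=> mh h0; rewrite -(preimage_setT phi) -(ge0_integral_pushforward mphi)//.
  by rewrite preimage_setT; apply: eq_measure_integral => A mA _; exact: m_phi.
move=> f0; apply/eqP; rewrite eq_le; apply/andP; split.
  apply: ge0_integral_le_ub => [x|h hf]; first exact: f0.
  rewrite (_ : (fun x => _) = (fun x => ((h \o psi) (phi x))%:E)); last first.
    by apply/funext => x /=; rewrite phiK.
  have -> := intE (EFin \o (h \o psi)).
  - rewrite (integral_mkcond D); apply: ae_ge0_le_lower_integral.
    + by move=> x _; rewrite lee_fin.
    + by move=> x _; exact: erestrict_ge0.
    + apply/aeW => x _ /=; have := hf (psi x); rewrite !patchE.
      by rewrite (_ : (psi x \in _) = (x \in D)) ?psiK//; apply/idP/idP;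
        rewrite !inE /preimage /= psiK.
  - by apply/measurable_EFinP/measurableT_comp => //; exact: measurable_funP.
  - by move=> x; rewrite lee_fin.
apply: ge0_integral_le_ub => // h hf.
rewrite -(intE (EFin \o h)).
- rewrite (integral_mkcond (phi @^-1` D)); apply: ae_ge0_le_lower_integral.
  + by move=> x _; rewrite lee_fin.
  + by move=> x _; apply: erestrict_ge0 => y; exact: f0.
  + by apply/aeW => x _ /=; have := hf (phi x); rewrite !patchE.
- by apply/measurable_EFinP; exact: measurable_funP.
- by move=> x; rewrite lee_fin.
Qed.

Lemma integral_preserving (D : set T) (f : T -> \bar R) :
  \int[m]_(x in phi @^-1` D) f (phi x) = \int[m]_(x in D) f x.
Proof.
rewrite [LHS]integralE [RHS]integralE; congr (_ - _).
  rewrite -(@ge0_integral_preserving D f^\+)//.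
  by apply: eq_integral => x _; rewrite !funeposE.
rewrite -(@ge0_integral_preserving D f^\-)//.
by apply: eq_integral => x _; rewrite !funenegE.
Qed.

Lemma ae_preserving (P : set T) :
  {ae m, forall x, P x} -> {ae m, forall x, P (phi x)}.
Proof.
move=> [N [mN N0 NP]]; exists (phi @^-1` N); split.
- by rewrite -[X in measurable X]setTI; exact: mphi.
- by rewrite m_phi.
- by move=> x /= nP; apply: NP.
Qed.

End measure_preserving.
End lower_integral.

(** The type ascription selects the measure structure of the pushforward by a
    measurable map. *)
Definition image_measure d d' (T1 : measurableType d) (T2 : measurableType d')
    (R : realFieldType) (m : {measure set T1 -> \bar R}) (f : T1 -> T2)
    (mf : measurable_fun setT f) : {measure set T2 -> \bar R} :=
  measure_function_pushforward__canonical__measure_function_Measure m mf.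

(** Both sides are measures that agree on the measurable rectangles. *)
Lemma product_measure_preserving d1 d2 (T1 : measurableType d1)
    (T2 : measurableType d2) (R : realType)
    (m1 : {sigma_finite_measure set T1 -> \bar R})
    (m2 : {sigma_finite_measure set T2 -> \bar R}) (t1 : T1 -> T1) (t2 : T2 -> T2) :
  measurable_fun setT t1 -> measurable_fun setT t2 ->
  (forall A, measurable A -> m1 (t1 @^-1` A) = m1 A) ->
  (forall A, measurable A -> m2 (t2 @^-1` A) = m2 A) ->
  forall X, measurable X ->
  (m1 \x m2)%E ((fun p => (t1 p.1, t2 p.2)) @^-1` X) = (m1 \x m2)%E X.
Proof.
move=> mt1 mt2 m1t m2t X mX.
have mt : measurable_fun setT (fun p : T1 * T2 => (t1 p.1, t2 p.2)).
  by apply: measurable_fun_pair => /=; exact: measurableT_comp.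
apply/esym; apply: (product_measure_unique (m' := image_measure (m1 \x m2)%E mt)) => //.
move=> A B mA mB; rewrite /image_measure /= /pushforward.
rewrite (_ : _ @^-1` _ = (t1 @^-1` A) `*` (t2 @^-1` B))//.
rewrite product_measure1E//.
- by congr (_ * _)%E; [exact: m1t|exact: m2t].
- by rewrite -[X in measurable X]setTI; exact: mt1.
- by rewrite -[X in measurable X]setTI; exact: mt2.
Qed.

Section translation.
Variable R : realType.
Local Open Scope ereal_scope.

Lemma lebesgue_measure_translate (a : R) (A : set R) : measurable A ->
  lebesgue_measure ((fun x => x + a)%R @^-1` A) = lebesgue_measure A.
Proof.
move=> mA; have ma : measurable_fun setT (fun x : R => (x + a)%R).
  by apply: measurable_funD.
apply/esym.
apply: (@lebesgue_measure_unique _ (@image_measure _ _ (measurableTypeR R) (measurableTypeR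
  R) R lebesgue_measure _ ma)) => //= X /ocitvP[->|[[x y] /= xy ->]];
    first by rewrite !measure0.
rewrite /pushforward /= (_ : _ @^-1` _ = `]x - a, y - a]%classic)%R; last first.
  by apply/seteqP; split => z /=; rewrite !in_itv /= lerBrDr ltrBlDr.
by rewrite !lebesgue_measure_itv /= !lte_fin ltrD2r; case: ifP => // _;
  rewrite -!EFinD; congr EFin; ring.
Qed.

Lemma measurable_translate n (v : 'rV[R]_n) :
  measurable_fun setT (fun x : 'rV[R]_n => (x + v)%R).
Proof.
apply: measurable_fun_mx => // i j.
under eq_fun do rewrite mxE.
apply: measurable_funD => //; exact: measurable_coord.
Qed.

(** By induction on the dimension: in the splitting [R * R^n] a translation is a
    product of translations. *)
Lemma lebesgue_rV_translate n (v : 'rV[R]_n) A : measurable A ->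
  lebesgue_rV R n ((fun x => x + v)%R @^-1` A) = lebesgue_rV R n A.
Proof.
elim: n v A => [|n IH] v A mA.
  by congr (lebesgue_rV R 0 _); apply/seteqP; split => x;
    rewrite /preimage /= (_ : (x + v)%R = x)//; apply/rowP => -[].
rewrite /= /lebesgue_rV_step /pushforward.
pose t (p : R * 'rV[R]_n) := ((p.1 + v 0 0)%R, (p.2 + (rV_uncons v).2)%R).
have -> : @rV_cons R n @^-1` ((fun x => x + v)%R @^-1` A) = t @^-1` (@rV_cons R n @^-1` A).
  apply/seteqP; suff E p : (rV_cons p + v)%R = rV_cons (t p).
    by split => p; rewrite /preimage /= E.
  apply/rowP => j; rewrite !mxE; case: unliftP => [k ->|->//].
  by rewrite !mxE.
have mc : measurable (@rV_cons R n @^-1` A).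
  by rewrite -[X in measurable X]setTI; exact: measurable_rV_cons.
apply: (@product_measure_preserving _ _ (measurableTypeR R) _ R lebesgue_measure
  (lebesgue_rV R n) (fun x : R => x + v 0 0)%R (fun x => x + (rV_uncons v).2)%R) => //.
- by apply: measurable_funD.
- exact: measurable_translate.
- by move=> B mB; exact: lebesgue_measure_translate.
- by move=> B mB; exact: IH.
Qed.

End translation.

(** * Smooth bumps supported in boxes *)

Section bump.
Variable R : realType.

(** Reduces a directional derivative to the derivative of a function of one
    variable. *)
Lemma is_derive_lineP (V : normedModType R) (F : V -> R) (x v : V) (l : R) :
  is_derive (0 : R) (1 : R) (fun h : R => F (h *: v + x)) l -> is_derive x v F l.
Proof.
move=> [dF <-]; apply: DeriveDef; first by apply/derivable1P.
rewrite /derive; set g1 := fun h => h^-1 *: _; set g2 := fun h => h^-1 *: _.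
suff -> : g1 = g2 by [].
by apply/funext => h; rewrite /g1 /g2 /= addr0 scale0r add0r [_%:A]mulr1.
Qed.

(** The functions [p (1 / t) exp (- 1 / t)], extended by [0] to [t <= 0].  They
    are closed under differentiation, which makes the smoothness of [exp (- 1 /
    t)] a plain induction. *)
Definition ray (p : {poly R}) (t : R) : R :=
  if 0 < t then p.[t^-1] * expR (- t^-1) else 0.

Definition ray_deriv (p : {poly R}) : {poly R} := 'X ^+ 2 * (p - p^`()).

Lemma ray_le0 p t : t <= 0 -> ray p t = 0.
Proof. by rewrite /ray ltNge => ->. Qed.

(** From the term [s ^ k / k!] of the exponential series. *)
Lemma exprn_expRN_le k (s : R) : 0 < s -> s ^+ k * expR (- s) <= k`!%:R.
Proof.
case: k => [|k] s0.
  by rewrite mul1r fact0 expR_le1 oppr_le0 ltW.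
rewrite expRN ler_pdivrMr ?expR_gt0//.
have /(le_trans _) := expR_ge1Dxn k (ltW s0); rewrite -ler_pdivrMl ?ltr0n ?fact_gt0//.
by apply; rewrite mulrC lerDr.
Qed.

(** A quadratic bound at the origin makes the difference quotient at [0] tend to
    [0]. *)
Lemma ray_quadratic p : exists2 C, 0 <= C & forall t, `|ray p t| <= C * t ^+ 2.
Proof.
exists (\sum_(i < size p) `|p`_i| * (i.+2)`!%:R).
  by apply: sumr_ge0 => i _; rewrite mulr_ge0.
move=> t; rewrite /ray; case: ifPn => t0; last first.
  by rewrite normr0 mulr_ge0 ?sqr_ge0//; apply: sumr_ge0 => i _; rewrite mulr_ge0.
rewrite -ler_pdivrMr ?exprn_gt0// -exprVn.
set s := t^-1; have s0 : 0 < s by rewrite invr_gt0.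
rewrite normrM (ger0_norm (expR_ge0 _)) horner_coef.
rewrite -mulrA [leLHS](_ : _ = `|\sum_(i < size p) p`_i * s ^+ i| * (s ^+ 2 * expR (- s)));
  last by rewrite [expR _ * _]mulrC.
apply: (@le_trans _ _ ((\sum_(i < size p) `|p`_i * s ^+ i|) * (s ^+ 2 * expR (- s)))).
  by rewrite ler_wpM2r ?ler_norm_sum// mulr_ge0 ?expR_ge0 ?exprn_ge0 ?ltW.
rewrite mulr_suml; apply: ler_sum => i _.
rewrite normrM (ger0_norm (exprn_ge0 _ (ltW s0))) -mulrA ler_wpM2l//.
by rewrite mulrA -exprD addn2; exact: exprn_expRN_le.
Qed.

Lemma is_derive_ray p (t : R) : is_derive t (1 : R) (ray p) (ray (ray_deriv p) t).
Proof.
case: (ltgtP t 0) => [t0|t0|->].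
- rewrite (ray_le0 _ (ltW t0)).
  apply: (@near_eq_is_derive _ _ _ (cst 0)).
  by near=> s; rewrite ray_le0//= ltW//; near: s; exact: lt_nbhsl.
- have tn0 : t != 0 by rewrite gt_eqF.
  have dV : is_derive t (1 : R) (fun y : R => y^-1) (- t ^- 2).
    by apply: is_derive_eq; [exact: (@is_deriveV _ id)|rewrite [_ *: _]mulr1].
  have dp := @is_derive1_comp _ (horner p) (fun y :
    R => y^-1) t _ _ (is_derive_poly p t^-1) dV.
  have de := @is_derive1_comp _ expR (fun y :
    R => - y^-1) t _ _ (is_derive_expR (- t^-1)) (is_deriveN dV).
  apply: (@near_eq_is_derive _ _ _ ((horner p \o (fun y => y^-1)) * (expR \o (fun y => -
    y^-1)))).
    by near=> s; rewrite /ray ifT//; near: s; exact: lt_nbhsr.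
  apply: is_derive_eq.
  rewrite /ray t0 /ray_deriv !hornerE /= /GRing.scale /= exprVn; ring.
- rewrite ray_le0//.
  have [C C0 rC] := ray_quadratic p.
  suff dr : h^-1 *: (ray p (h *: (1 : R) + 0) - ray p 0) @[h --> (0:R)^'] --> (0 : R).
    by apply: DeriveDef; [apply/cvg_ex; exists 0|exact: cvg_lim dr].
  have C1 : 0 < C + 1 by rewrite ltr_wpDl.
  apply/cvgr0Pnorm_le => e e0; near=> h.
  have h0 : h != 0 by near: h; exact: nbhs_dnbhs_neq.
  rewrite (ray_le0 _ (lexx 0)) subr0 addr0 normrM normfV [h%:A]mulr1.
  rewrite ler_pdivrMl ?normr_gt0//.
  apply: (le_trans (rC h)).
  rewrite -(real_normK (num_real h)) expr2 mulrCA ler_wpM2l//.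
  apply: (@le_trans _ _ ((C + 1) * `|h|)); first by rewrite ler_wpM2r// lerDl.
  rewrite mulrC -ler_pdivlMr//; near: h.
  exact: (dnbhs0_le (divr_gt0 e0 C1)).
Unshelve. all: by end_near. Qed.

Lemma continuous_ray p : continuous (ray p).
Proof.
move=> t; apply/differentiable_continuous/derivable1_diffP.
by have [] := is_derive_ray p t.
Qed.

Lemma ray_ge0 t : 0 <= ray 1 t.
Proof. by rewrite /ray; case: ifP => // _; rewrite hornerE mul1r expR_ge0. Qed.

Lemma ray_le1 t : ray 1 t <= 1.
Proof.
rewrite /ray; case: ifP => // t0; rewrite hornerE mul1r expR_le1.
by rewrite oppr_le0 invr_ge0 ltW.
Qed.

(** Dilating the argument turns [ray 1] into an approximation of the indicator
    function of the positive half-line. *)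
Lemma ray_cvg1 t : 0 < t -> ray 1 (m%:R * t) @[m --> \oo] --> (1 : R).
Proof.
move=> t0; apply: (@cvg_trans _ (expR (- (m%:R^-1 * t^-1)) @[m --> \oo])).
  apply: near_eq_cvg; near=> m.
  have m0 : (0 < m)%N by near: m; exists 1%N.
  by rewrite /ray mulr_gt0// ?ltr0n// hornerE mul1r invfM.
have c0 : (m%:R : R)^-1 @[m --> \oo] --> (0 : R).
  apply/gtr0_cvgV0; last exact: cvgr_idn.
  by exists 1%N => // m /=; rewrite ltr0n.
have : - ((m%:R : R)^-1 * t^-1) @[m --> \oo] --> - (0 * t^-1).
  by apply: cvgN; apply: cvgMr_tmp.
rewrite mul0r oppr0 => c1.
have := @cvg_comp _ _ _ (fun m : nat => - ((m%:R :
  R)^-1 * t^-1)) expR _ _ _ c1 (@continuous_expR R 0).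
by rewrite expR0.
Unshelve. all: by end_near. Qed.

Variable n : nat.

(** An algebra of functions on [R^n] that contains the bumps below and is closed
    under partial derivatives, hence consists of smooth functions. *)
Inductive ray_poly : ('rV[R]_n -> R) -> Prop :=
| RayCst c : ray_poly (fun=> c)
| Ray p c a j : ray_poly (fun x => ray p (c * x 0 j + a))
| RayD f g : ray_poly f -> ray_poly g -> ray_poly (fun x => f x + g x)
| RayM f g : ray_poly f -> ray_poly g -> ray_poly (fun x => f x * g x).

Lemma ray_poly_continuous f : ray_poly f -> continuous f.
Proof.
elim=> [c|p c a j|{}f g _ cf _ cg|{}f g _ cf _ cg] x.
- exact: cst_continuous.
- apply: (@continuous_comp _ _ _ (fun x : 'rV[R]_n => x 0 j) (fun y => ray p (c * y + a))).
    exact: coord_continuous.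
  apply: (@continuous_comp _ _ _ (fun y : R => c * y + a) (ray p)); last exact: continuous_ray.
  by apply: cvgD; [apply: cvgMl_tmp; exact: cvg_id|exact: cvg_cst].
- exact: (continuousD (cf x) (cg x)).
- exact: (continuousM (cf x) (cg x)).
Qed.

Lemma ray_poly_derive f j : ray_poly f ->
  exists2 g, ray_poly g & forall x, is_derive x (delta_mx 0 j : 'rV[R]_n) f (g x).
Proof.
elim=> [c|p c a i|{}f g _ [f' rf' df] _ [g' rg' dg]|{}f g rf [f' rf' df] rg [g' rg' dg]].
- by exists (fun=> 0) => [|x]; [exact: RayCst|exact: is_derive_cst].
- pose e : R := (delta_mx 0 j : 'rV[R]_n) 0 i.
  exists (fun x => (c * e) * ray (ray_deriv p) (c * x 0 i + a)).
    by apply: RayM; [exact: RayCst|exact: Ray].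
  move=> x; apply: is_derive_lineP.
  pose l (h : R) := (c * e) * h + (c * x 0 i + a).
  rewrite [F in is_derive _ _ F _](_ : _ = ray p \o l); last first.
    by apply/funext => h; rewrite /l /= !mxE /e !mxE; congr ray; ring.
  have dl : is_derive (0 : R) (1 : R) l (c * e).
    have -> : l = (c * e) *: (id : R -> R) + cst (c * x 0 i + a) by apply/funext.
    by apply: is_derive_eq; rewrite addr0 [_ *: _]mulr1.
  have l0 : l 0 = c * x 0 i + a by rewrite /l mulr0 add0r.
  have := @is_derive1_comp _ (ray p) l 0 _ _ (is_derive_ray p (l 0)) dl.
  by rewrite l0 mulrC.
- exists (fun x => f' x + g' x) => [|x]; first exact: RayD.
  exact: is_deriveD.
- exists (fun x => f x * g' x + g x * f' x) => [|x].
    by apply: RayD; exact: RayM.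
  exact: is_deriveM.
Qed.

Lemma ray_poly_Ck k f : ray_poly f -> Ck k f.
Proof.
elim: k f => [|k IH] f rf /=; first by split=> //; exact: ray_poly_continuous.
split; first exact: ray_poly_continuous.
move=> j; have [g rg dg] := ray_poly_derive j rf.
split => [x|]; first by case: (dg x).
suff -> : (fun x => 'D_(delta_mx 0 j) f x) = g by exact: IH.
by apply/funext => x; case: (dg x).
Qed.

Definition box (a b : 'rV[R]_n) : set 'rV[R]_n := [set x | forall i, a 0 i < x 0 i < b 0 i].

Definition cbox (a b : 'rV[R]_n) : set 'rV[R]_n := [set x | forall i, a 0 i <= x 0 i <= b 0 i].

(** A smooth function supported in the closed box; as [m] grows it increases to
    the indicator function of the open box. *)
Definition box_bump (a b : 'rV[R]_n) m (x : 'rV[R]_n) : R :=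
  \prod_(i < n) (ray 1 (m%:R * x 0 i + - (m%:R * a 0 i)) * ray 1 (- m%:R * x 0 i + m%:R * b
    0 i)).

Lemma compact_cbox a b : compact (cbox a b).
Proof.
have := @rV_compact R n (fun i => `[a 0 i, b 0 i]%classic) (fun i => @segment_compact _ _ _).
by congr compact; apply/seteqP; split => x /= xab i; have := xab i; rewrite in_itv.
Qed.

Lemma closed_cbox a b : closed (cbox a b).
Proof. by apply: compact_closed; [exact: norm_hausdorff|exact: compact_cbox]. Qed.

Lemma box_sub_cbox a b : box a b `<=` cbox a b.
Proof. by move=> x xab i; have /andP[/ltW -> /ltW ->] := xab i. Qed.

Lemma ray_poly_box_bump a b m : ray_poly (box_bump a b m).
Proof.
rewrite /box_bump; elim: (index_enum _) => [|i s IH].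
  rewrite (_ : (fun _ => _) = (fun=> 1)); first exact: RayCst.
  by apply/funext => x; rewrite big_nil.
rewrite (_ : (fun _ => _) = (fun x : 'rV[R]_n => (ray 1 (m%:R * x 0 i + - (m%:R * a 0 i)) *
  ray 1 (- m%:R * x 0 i + m%:R * b 0 i)) * \prod_(i <- s) (ray 1 (m%:R * x 0 i + - (m%:R *
    a 0 i)) * ray 1 (- m%:R * x 0 i + m%:R * b 0 i)))).
  by apply: RayM => //; apply: RayM; exact: Ray.
by apply/funext => x; rewrite big_cons.
Qed.

Lemma box_bump_ge0 a b m x : 0 <= box_bump a b m x.
Proof. by apply: prodr_ge0 => i _; rewrite mulr_ge0 ?ray_ge0. Qed.

Lemma box_bump_le1 a b m x : box_bump a b m x <= 1.
Proof.
by apply: prodr_ile1 => i _; rewrite mulr_ge0 ?ray_ge0//= mulr_ile1 ?ray_ge0 ?ray_le1.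
Qed.

Lemma box_bump_out a b m x : ~ box a b x -> box_bump a b m x = 0.
Proof.
move=> /existsNP[i /negP]; rewrite negb_and -!leNgt => xab.
rewrite /box_bump (bigD1 i)//= [X in X * _](_ : _ = 0) ?mul0r//.
have m0 : 0 <= m%:R :> R by [].
case/orP: xab => xab.
  by rewrite ray_le0 ?mul0r// -mulrBr mulr_ge0_le0// subr_le0.
by rewrite [X in _ * X]ray_le0 ?mulr0// mulNr addrC -mulrBr mulr_ge0_le0// subr_le0.
Qed.

(** On the open box every factor tends to [1]; elsewhere one factor vanishes. *)
Lemma box_bump_cvg a b x : box_bump a b m x @[m --> \oo] --> (\1_(box a b) x : R).
Proof.
rewrite indicE; case: (boolP (x \in box a b)); rewrite ?inE ?notin_setE => xab; last first.
  by under eq_fun do rewrite box_bump_out//; exact: cvg_cst.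
rewrite /box_bump; elim: (index_enum _) => [|i s IH].
  by under eq_fun do rewrite big_nil; exact: cvg_cst.
under eq_fun do rewrite big_cons.
have /andP[ax xb] := xab i.
have c1 : ray 1 (m%:R * x 0 i - m%:R * a 0 i) @[m --> \oo] --> (1 : R).
  by under eq_fun do rewrite -mulrBr; apply: ray_cvg1; rewrite subr_gt0.
have c2 : ray 1 (- m%:R * x 0 i + m%:R * b 0 i) @[m --> \oo] --> (1 : R).
  by under eq_fun do rewrite mulNr addrC -mulrBr; apply: ray_cvg1; rewrite subr_gt0.
by have := cvgM (cvgM c1 c2) IH; rewrite !mul1r; apply.
Qed.

Lemma test_fun_box_bump (A : set 'rV[R]_n) a b m : cbox a b `<=` A ->
  test_fun A (box_bump a b m).
Proof.
move=> abA.
have sup : support_of (box_bump a b m) `<=` cbox a b.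
  apply: (@subset_trans _ (closure (cbox a b))); last first.
    by rewrite -((closure_id _).1 (@closed_cbox a b)).
  apply: closure_subset => x /= x0; apply: box_sub_cbox.
  by apply: contrapT => /box_bump_out x0'; rewrite x0' eqxx in x0.
split => [k||]; first by apply: ray_poly_Ck; exact: ray_poly_box_bump.
- by apply: subclosed_compact sup; [exact: closed_closure|exact: compact_cbox].
- exact: subset_trans sup abA.
Qed.

End bump.

(** * Boxes, regularity of measures and comparison of integrals *)

Section boxes.
Variables (R : realType) (n : nat).
Implicit Types (a b x : 'rV[R]_n).

Lemma open_box a b : open (box a b).
Proof.
rewrite openE => x xab.
exists (fun _ j => `]a 0 j, b 0 j[%classic) => [i j|y yab j]; last first.
  by have := yab 0 j; rewrite /= in_itv.
rewrite ord1; apply: open_nbhs_nbhs; split; first exact: interval_open.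
by rewrite /= in_itv /=; exact: xab.
Qed.

Lemma measurable_box a b : measurable (box a b).
Proof. by apply: measurable_open_mx; exact: open_box. Qed.

Lemma closed_measurable (C : set 'rV[R]_n) : closed C -> measurable C.
Proof.
move=> cC; rewrite -[C]setCK; apply: measurableC; apply: measurable_open_mx.
exact: closed_openC.
Qed.

Lemma measurable_cbox a b : measurable (cbox a b).
Proof. by apply: closed_measurable; exact: closed_cbox. Qed.

Lemma setI_box a b a' b' : box a b `&` box a' b' =
  box (\row_j Num.max (a 0 j) (a' 0 j)) (\row_j Num.min (b 0 j) (b' 0 j)).
Proof.
apply/seteqP; split => [x [xab xab'] i|x xm].
  by rewrite !mxE gt_max lt_min; have /andP[-> ->] := xab i; have /andP[-> ->] := xab' i.
by split => i; have := xm i; rewrite !mxE gt_max lt_min => /andP[/andP[? ?] /andP[? ?]];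
  apply/andP.
Qed.

Definition rat_lo (cr : 'rV[rat]_n * rat) : 'rV[R]_n := \row_j (ratr (cr.1 0 j) - ratr cr.2).
Definition rat_hi (cr : 'rV[rat]_n * rat) : 'rV[R]_n := \row_j (ratr (cr.1 0 j) + ratr cr.2).

(** Closed boxes are compact, so this base of neighbourhoods gives local bounds
    as well as countability. *)
Lemma nbhs_rat_box x U : nbhs x U ->
  exists2 cr, box (rat_lo cr) (rat_hi cr) x & cbox (rat_lo cr) (rat_hi cr) `<=` U.
Proof.
move=> /nbhs_ballP[e /= e0 xeU].
have [r] := rat_in_itvoo (divr_gt0 e0 (ltr0n _ 2)).
rewrite in_itv /= => /andP[r0 re].
have /choice[c xc] (i : 'I_n) :
    exists q : rat, `|ratr q - x 0 i| < ratr r :> R.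
  have /rat_in_itvoo[q] : x 0 i - ratr r < x 0 i + ratr r.
    by rewrite ltrD2l gtrN.
  by exists q; rewrite ltr_distl.
exists (\row_j c j, r) => [i|y yc].
  by rewrite !mxE; have := xc i; rewrite ltr_distl => /andP[? ?]; apply/andP; split; lra.
apply: xeU; split => // i j; rewrite ord1 /ball /= ltr_distl.
have := xc j; have := yc j; rewrite !mxE ltr_distl => /andP[? ?] /andP[? ?].
by apply/andP; split; lra.
Qed.

Lemma open_bigcup_rat_box (U : set 'rV[R]_n) : open U ->
  U = \bigcup_(cr in [set cr | cbox (rat_lo cr) (rat_hi cr) `<=` U]) box (rat_lo cr)
    (rat_hi cr).
Proof.
move=> oU; apply/seteqP; split => [x Ux|x [cr /= crU xcr]]; last first.
  by apply: crU; exact: box_sub_cbox.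
have [cr crx crU] := nbhs_rat_box (open_nbhs_nbhs (conj oU Ux)).
by exists cr.
Qed.

Lemma ler_coord_norm p q (x : 'M[R]_(p, q)) i j : `|x i j| <= `|x|.
Proof.
rewrite [leRHS](mx_normrE x).
exact: (le_bigmax _ (fun ij : 'I_p * 'I_q => `|x ij.1 ij.2|) (i, j)).
Qed.

Definition boxes : set (set 'rV[R]_n) := [set box ab.1 ab.2 | ab in [set: 'rV[R]_n *
  'rV[R]_n]].

Lemma boxes_measurable : @measurable _ 'rV[R]_n = <<s boxes >>.
Proof.
apply/seteqP; split; last first.
  apply: smallest_sub; first exact: sigma_algebra_measurable.
  by move=> _ [ab _ <-]; exact: measurable_box.
apply: smallest_sub; first exact: smallest_sigma_algebra.
move=> U /open_bigcup_rat_box ->; rewrite bigcup_mkcond.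
apply: (@countable_bigcupT_measurable _ (g_sigma_algebraType boxes)) => // cr.
case: ifP => _; last exact: measurable0.
by apply: sub_sigma_algebra; exists (rat_lo cr, rat_hi cr).
Qed.

Lemma boxes_cover : \bigcup_k box (const_mx (- k%:R)) (const_mx k%:R) = [set: 'rV[R]_n].
Proof.
apply/seteqP; split => // x _; exists (Num.Def.archi_bound `|x|) => // i.
by rewrite !mxE -ltr_norml (le_lt_trans (ler_coord_norm _ _ _))// archi_boundP.
Qed.

(** The boxes are stable under intersection and generate the Borel sets. *)
Lemma measure_eq_boxes (m1 m2 : {measure set 'rV[R]_n -> \bar R}) :
  (forall a b, m1 (box a b) = m2 (box a b)) -> (forall a b, (m1 (box a b) < +oo)%E) ->
  forall A, measurable A -> m1 A = m2 A.
Proof.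
move=> m12 m1oo A mA.
apply: (measure_unique boxes (fun k => box (const_mx (- k%:R)) (const_mx k%:R))) => //.
- exact: boxes_measurable.
- move=> _ _ [[a b] _ <-] [[a' b'] _ <-] /=; rewrite setI_box.
  by eexists (_, _).
- by move=> k; exists (const_mx (- k%:R), const_mx k%:R).
- exact: boxes_cover.
- by move=> _ [[a b] _ <-] /=.
Qed.

End boxes.

Section finite_boxes.
Variable R : realType.

(** A box in dimension [n + 1] is the product of an interval and a box. *)
Lemma lebesgue_rV_box_lty n (a b : 'rV[R]_n) : (lebesgue_rV R n (box a b) < +oo)%E.
Proof.
elim: n a b => [|n IH] a b.
  by rewrite /= diracE; case: (_ \in _); rewrite ltry.
rewrite /= /lebesgue_rV_step /pushforward.
rewrite (_ : _ @^-1` _ = `]a 0 0, b 0 0[%classic `*` box (rV_uncons a).2 (rV_uncons b).2).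
  rewrite product_measure1E//; last exact: measurable_box.
  have fab : (lebesgue_measure `]a 0 0, b 0 0[%classic : \bar R) \is a fin_num.
    by rewrite lebesgue_measure_itv; case: ifP.
  by rewrite lte_mul_pinfty.
apply/seteqP; split => [[t v]|[t v] [/= tab vab] i].
  move=> tv; split => /=.
    by have := tv 0; rewrite !mxE unlift_none in_itv.
  by move=> k; have := tv (lift ord0 k); rewrite !mxE liftK.
rewrite mxE; case: unliftP => [k ->|->]; last by rewrite in_itv in tab.
by have := vab k; rewrite !mxE.
Qed.

Variable n : nat.
Local Notation mu := (lebesgue_rV R n).

Lemma bounded_sub_box (A : set 'rV[R]_n) : bounded_set A ->
  exists k : nat, A `<=` box (const_mx (- k%:R)) (const_mx k%:R).
Proof.
move=> /ex_strict_bound_gt0[M M0 AM]; exists (Num.Def.archi_bound M) => x /AM /= xM i.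
rewrite !mxE -ltr_norml (le_lt_trans (ler_coord_norm _ _ _))// (lt_trans xM)//.
by rewrite archi_boundP// ltW.
Qed.

Lemma bounded_lebesgue_lty (A : set 'rV[R]_n) : measurable A -> bounded_set A ->
  (mu A < +oo)%E.
Proof.
move=> mA /bounded_sub_box[k Ak]; apply: le_lt_trans (lebesgue_rV_box_lty _ _).
by apply: le_measure Ak; rewrite inE//; exact: measurable_box.
Qed.

Lemma compact_measurable_rV (K : set 'rV[R]_n) : compact K -> measurable K.
Proof.
by move=> cK; apply: closed_measurable; apply: compact_closed cK; exact: norm_hausdorff.
Qed.

Lemma compact_lebesgue_lty (K : set 'rV[R]_n) : compact K -> (mu K < +oo)%E.
Proof.
move=> cK; apply: bounded_lebesgue_lty; first exact: compact_measurable_rV.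
exact: compact_bounded.
Qed.

Lemma bounded_box (a b : 'rV[R]_n) : bounded_set (box a b).
Proof.
have [M [Mr HM]] := compact_bounded (@compact_cbox R n a b).
by exists M; split => // N MN x /box_sub_cbox; exact: HM.
Qed.

End finite_boxes.

Section density.
Context d (T : measurableType d) (R : realType) (mu : {measure set T -> \bar R}).
Variables (f : T -> \bar R) (mf : measurable_fun setT f) (f0 : forall x, (0 <= f x)%E).

(** The measure with density [f] with respect to [mu]. *)
Definition density (A : set T) : \bar R := (\int[mu]_(x in A) f x)%E.

Let density0 : density set0 = 0%E.
Proof. exact: integral_set0. Qed.

Let density_ge0 A : (0 <= density A)%E.
Proof. by apply: integral_ge0 => x _. Qed.

Let density_sigma_additive : semi_sigma_additive density.
Proof. exact: semi_sigma_additive_nng_induced. Qed.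

HB.instance Definition _ := isMeasure.Build _ _ _ density
  density0 density_ge0 density_sigma_additive.

Definition density_measure : {measure set T -> \bar R} := density.
End density.

Section regularity.
Variables (R : realType) (n : nat) (m : {measure set 'rV[R]_n -> \bar R}).
Hypothesis m_lty : (m setT < +oo)%E.

(** Sets that can be squeezed between a closed and an open set up to an
    arbitrarily small measure.  Unlike outer regularity alone, this property is
    stable under complements, so that the regular sets form a sigma-algebra. *)
Definition regular_set (E : set 'rV[R]_n) := forall e : R, 0 < e ->
  exists C U, [/\ closed C, open U, C `<=` E, E `<=` U & (m (U `\` C) < e%:E)%E].

(** The open sets are united with errors [e / 2 ^ (k + 2)].  A countable union
    of closed sets need not be closed; finitely many of them suffice, because
    the measure is finite and continuous from above. *)
Lemma regular_bigcup (F : (set 'rV[R]_n)^nat) :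
  (forall k, regular_set (F k)) -> regular_set (\bigcup_k F k).
Proof.
move=> rF e e0.
have e2 : 0 < e / 2 by rewrite divr_gt0.
have /choice[CU CUP] k : exists CU : set 'rV[R]_n * set 'rV[R]_n,
    [/\ closed CU.1, open CU.2, CU.1 `<=` F k, F k `<=` CU.2 &
     (m (CU.2 `\` CU.1) <= (e / 2 / (2 ^ k.+1)%:R)%:E)%E].
  have [|C [U [cC oU CF FU CUe]]] := rF k (e / 2 / (2 ^ k.+1)%:R).
    by rewrite divr_gt0// ltr0n expn_gt0.
  by exists (C, U); split => //; exact: ltW.
pose U := \bigcup_k (CU k).2.
have oU : open U by apply: bigcup_open => k _; have [] := CUP k.
have mU : measurable U by exact: measurable_open_mx.
have mC k : measurable (CU k).1 by apply: closed_measurable; have [] := CUP k.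
(* Finite unions of the closed sets, which exhaust their countable union. *)
pose D N := \bigcup_(k in `I_N) (CU k).1.
have cD N : closed (D N).
  by rewrite /D; apply: closed_bigcup => [|k _]; [exact: finite_II|have [] := CUP k].
have mD N : measurable (D N) by exact: closed_measurable.
have DD : \bigcap_N (U `\` D N) = U `\` \bigcup_k (CU k).1.
  apply/seteqP; split => [x UD|x [Ux nD] N _].
    split; first by have [] := UD 0%N I.
    by move=> [k _ Ck]; have [_] := UD k.+1 I; apply; exists k => //=.
  by split => // -[k _ Ck]; apply: nD; exists k.
have mDD : measurable (\bigcap_N (U `\` D N)).
  by apply: bigcapT_measurable => N; exact: measurableD.
have lim : (m \o (fun N => U `\` D N)) N @[N --> \oo] --> m (\bigcap_N (U `\` D N)).
  apply: nonincreasing_cvg_mu => //.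
  - by apply: le_lt_trans m_lty; apply: le_measure; rewrite ?inE//; exact: measurableD.
  - by move=> N; exact: measurableD.
  - move=> i j ij; apply/subsetPset => x [Ux nD]; split => // -[k /= ki Ck].
    by apply: nD; exists k => //=; exact: leq_trans ki ij.
have lte : (m (\bigcap_N (U `\` D N)) < e%:E)%E.
  apply: (@le_lt_trans _ _ (e / 2)%:E); last first.
    by rewrite lte_fin ltr_pdivrMr// ltr_pMr// ltr1n.
  apply: (@le_trans _ _ (m (\bigcup_k ((CU k).2 `\` (CU k).1)))).
    apply: le_measure; rewrite ?inE//.
      apply: bigcupT_measurable => k; apply: measurableD => //.
      by apply: measurable_open_mx; have [] := CUP k.
    rewrite DD => x [[k _ Uk] nC]; exists k => //; split => // Ck.
    by apply: nC; exists k.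
  apply: le_trans (measure_sigma_subadditive _ _ _ (@subset_refl _ _)) _.
  - move=> k; apply: measurableD => //.
    by apply: measurable_open_mx; have [] := CUP k.
  - apply: bigcupT_measurable => k; apply: measurableD => //.
    by apply: measurable_open_mx; have [] := CUP k.
  apply: (@le_trans _ _ (\sum_(0 <= k <oo) (e / 2 / (2 ^ k.+1)%:R)%:E)%E).
    by apply: lee_nneseries => // k _; have [] := CUP k.
  exact: epsilon_trick0 (ltW e2).
have /lim[N _ /(_ N (leqnn N)) /= UDN] :
    nbhs (m (\bigcap_N (U `\` D N))) [set y | (y < e%:E)%E].
  by apply: open_nbhs_nbhs; split => //; exact: open_ereal_lt_ereal.
exists (D N), U; split => //.
- by move=> x [k _ Ck]; exists k => //; have [_ _ + _ _] := CUP k; apply.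
- by move=> x [k _ Fk]; exists k => //; have [_ _ _ + _] := CUP k; apply.
Qed.

(** The open box is exhausted by the closed boxes that are smaller by [1 / (k +
    1)] on each side. *)
Lemma regular_box a b : regular_set (box a b).
Proof.
move=> e e0.
pose h (k : nat) : R := k.+1%:R^-1.
pose C k := cbox (\row_i (a 0 i + h k)) (\row_i (b 0 i - h k)).
have h0 k : 0 < h k by rewrite invr_gt0.
have Cab k : C k `<=` box a b.
  move=> x xC i; have /andP[] := xC i; rewrite !mxE; have := h0 k.
  by move=> *; apply/andP; split; lra.
have mUC k : measurable (box a b `\` C k).
  by apply: measurableD; [exact: measurable_box|exact: measurable_cbox].
have abC : \bigcap_k (box a b `\` C k) = set0.
  apply/seteqP; split => // x xC; have [xab _] := xC 0%N I.
  pose s (i : 'I_n) := Num.Def.archi_bound (Num.min (x 0 i - a 0 i) (b 0 i - x 0 i))^-1.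
  pose N := \max_(i < n) s i.
  have [_] := xC N I; apply => i; rewrite !mxE.
  have mi0 : 0 < Num.min (x 0 i - a 0 i) (b 0 i - x 0 i).
    by rewrite lt_min !subr_gt0; exact: xab.
  have : h N <= Num.min (x 0 i - a 0 i) (b 0 i - x 0 i).
    rewrite /h -[leRHS]invrK lef_pV2 ?posrE ?invr_gt0//.
    rewrite (le_trans (ltW (archi_boundP _)))//; first by rewrite invr_ge0 ltW.
    rewrite ler_nat; apply: leqW; rewrite /N.
    exact: (leq_bigmax i).
  by rewrite le_min => /andP[? ?]; apply/andP; split; lra.
have lim : (m \o (fun N => box a b `\` C N)) N @[N --> \oo] --> m (\bigcap_N (box a b `\` C
  N)).
  apply: nonincreasing_cvg_mu => //.
  - by apply: le_lt_trans m_lty; apply: le_measure; rewrite ?inE.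
  - by rewrite abC.
  - move=> i j ij; apply/subsetPset => x [xab nC]; split => // Ci.
    apply: nC => k; have /andP[] := Ci k; rewrite !mxE.
    have : h j <= h i by rewrite lef_pV2 ?posrE// ler_nat ltnS.
    by move=> *; apply/andP; split; lra.
rewrite abC measure0 in lim.
have /lim[N _ /(_ N (leqnn N)) /= UDN] : nbhs (0 : \bar R)%E [set y | (y < e%:E)%E].
  apply: open_nbhs_nbhs; split; first exact: open_ereal_lt_ereal.
  by rewrite /= lte_fin.
by exists (C N), (box a b); split => //; [exact: closed_cbox|exact: open_box].
Qed.

Lemma measurable_regular E : measurable E -> regular_set E.
Proof.
rewrite boxes_measurable; move: E; apply: smallest_sub; last first.
  by move=> _ [ab _ <-]; exact: regular_box.
split.
- move=> e e0; exists set0, set0; split => //; first exact: closed0.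
  by rewrite setDv measure0 lte_fin.
- move=> A rA e e0; have [C [U [cC oU CA AU UC]]] := rA e e0.
  rewrite setTD; exists (~` U), (~` C); split.
  + exact: open_closedC.
  + exact: closed_openC.
  + exact: subsetC.
  + exact: subsetC.
  + by rewrite setDE setCK setIC -setDE.
- exact: regular_bigcup.
Qed.

Lemma outer_regular (E : set 'rV[R]_n) (e : R) : measurable E -> 0 < e ->
  exists U, [/\ open U, E `<=` U & (m U <= m E + e%:E)%E].
Proof.
move=> mE e0; have [C [U [cC oU CE EU UC]]] := measurable_regular mE e0.
exists U; split => //; have mU := measurable_open_mx oU.
rewrite -[X in (m X <= _)%E](setDUK EU) measureU; first last.
- by rewrite setDIK.
- exact: measurableD.
- by [].
rewrite leeD2l// (le_trans _ (ltW UC))//; apply: le_measure; rewrite ?inE.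
- exact: measurableD.
- by apply: measurableD => //; exact: closed_measurable.
- exact: setDS.
Qed.

End regularity.

Section comparison.
Variables (R : realType) (n : nat).
Local Notation mu := (lebesgue_rV R n).

Lemma le_measure_open (m1 m2 : {measure set 'rV[R]_n -> \bar R}) :
  (m2 setT < +oo)%E -> (forall U, open U -> (m1 U <= m2 U)%E) ->
  forall A, measurable A -> (m1 A <= m2 A)%E.
Proof.
move=> m2oo m12 A mA; apply/lee_addgt0Pr => e e0.
have [U [oU AU mU]] := outer_regular m2oo mA e0.
apply: le_trans mU; apply: le_trans (m12 _ oU).
by apply: le_measure; rewrite ?inE//; exact: measurable_open_mx.
Qed.

Lemma ae_countable (I : countType) (P : I -> 'rV[R]_n -> Prop) :
  (forall i, {ae mu, forall x, P i x}) -> {ae mu, forall x, forall i, P i x}.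
Proof.
move=> aP.
have : {ae mu, forall x, forall k, if unpickle k is Some i then P i x else True}.
  by apply: ae_foralln => k; case: unpickle => [i|]; [exact: aP|exact: aeW].
by apply: filterS => x Px i; have := Px (pickle i); rewrite pickleK.
Qed.

(** The measures with densities [f] and [g], restricted to a large box, are
    comparable on open sets, hence on all Borel sets by outer regularity.  On
    the set where [g < f] the two integrals then coincide, which forces [f = g]
    almost everywhere there. *)
Lemma ae_le_integral_open (f g : 'rV[R]_n -> R) :
  measurable_fun setT f -> measurable_fun setT g ->
  (forall x, 0 <= f x) -> (forall x, 0 <= g x) ->
  (forall A, open A -> bounded_set A ->
    (\int[mu]_(x in A) (f x)%:E <= \int[mu]_(x in A) (g x)%:E)%E) ->
  (forall A, open A -> bounded_set A -> (\int[mu]_(x in A) (g x)%:E < +oo)%E) ->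
  {ae mu, forall x, f x <= g x}.
Proof.
move=> mf mg f0 g0 fg goo.
pose B k := box (const_mx (- k%:R)) (const_mx k%:R) : set 'rV[R]_n.
suff H k : {ae mu, forall x, B k x -> f x <= g x}.
  have := ae_countable H; apply: filterS => x Hx.
  by have [k _ /Hx] : (\bigcup_k B k) x by rewrite boxes_cover.
have mB : measurable (B k) by exact: measurable_box.
have mres (h : 'rV[R]_n -> R) : measurable_fun setT h ->
    measurable_fun setT ((EFin \o h) \_ (B k)).
  move=> mh; apply/(measurable_restrictT _ mB); apply: measurable_funTS.
  exact/measurable_EFinP.
have res0 (h : 'rV[R]_n -> R) : (forall x, 0 <= h x) ->
    forall x, (0 <= ((EFin \o h) \_ (B k)) x)%E.
  by move=> h0 x; apply: erestrict_ge0 => y _; rewrite lee_fin.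
pose m1 := density_measure mu (mres _ mf) (res0 _ f0).
pose m2 := density_measure mu (mres _ mg) (res0 _ g0).
have m1E A : m1 A = (\int[mu]_(x in A `&` B k) (f x)%:E)%E by rewrite integral_mkcondr.
have m2E A : m2 A = (\int[mu]_(x in A `&` B k) (g x)%:E)%E by rewrite integral_mkcondr.
have oUB U : open U -> open (U `&` B k) by move=> oU; apply: openI => //; exact: open_box.
have bUB U : bounded_set (U `&` B k).
  by have [M [Mr HM]] := bounded_box (const_mx (- k%:R) : 'rV[R]_n) (const_mx k%:R);
    exists M; split => // N MN x [_]; exact: HM.
have m12 A : measurable A -> (m1 A <= m2 A)%E.
  apply: le_measure_open => [|U oU].
    by rewrite m2E; apply: goo; [apply: oUB; exact: openT|exact: bUB].
  by rewrite m1E m2E; apply: fg; [exact: oUB|exact: bUB].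
pose E := B k `&` [set x | g x < f x].
have mE : measurable E.
  rewrite (_ : E = B k `&` [set x | ((EFin \o g) x < (EFin \o f) x)%E])//.
  by apply: measurable_lte => //; apply/measurable_EFinP; exact: measurable_funTS.
have mef D : measurable D -> measurable_fun D (EFin \o f).
  by move=> mD; apply: measurable_funTS; exact/measurable_EFinP.
have meg D : measurable D -> measurable_fun D (EFin \o g).
  by move=> mD; apply: measurable_funTS; exact/measurable_EFinP.
have fE F : F `<=` E -> measurable F ->
    (\int[mu]_(x in F) (f x)%:E = \int[mu]_(x in F) (g x)%:E)%E.
  move=> FE mF; apply/eqP; rewrite eq_le; apply/andP; split.
    have := m12 _ mF; rewrite m1E m2E (_ : F `&` B k = F)//.
    by apply/setIidPl => x /FE[].
  apply: ge0_le_integral => //.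
  - by move=> x _; rewrite lee_fin.
  - exact: meg.
  - exact: mef.
  - by move=> x /FE[_ /ltW]; rewrite lee_fin.
have : ae_eq mu E (EFin \o f) (EFin \o g).
  apply: integral_ae_eq => //; last exact: meg.
  apply/integrableP; split; first exact: mef.
  under eq_integral do rewrite /= ger0_norm//.
  apply: (@le_lt_trans _ _ (\int[mu]_(x in B k) (f x)%:E)%E).
    apply: ge0_subset_integral => //; first exact: mef.
      by move=> x _; rewrite lee_fin.
    by move=> x [].
  apply: le_lt_trans (fg _ _ _) (goo _ _ _).
  - exact: open_box.
  - exact: bounded_box.
  - exact: open_box.
  - exact: bounded_box.
apply: filterS => x Hx Bx; rewrite leNgt; apply/negP => gf.
by have := Hx (conj Bx gf) => -[fgx]; rewrite fgx ltxx in gf.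
Qed.

(** The measures with densities the positive and the negative part of [h] agree
    on boxes, hence everywhere. *)
Lemma ae_eq0_integral_boxes (a b : 'rV[R]_n) (h : 'rV[R]_n -> R) :
  mu.-integrable (box a b) (EFin \o h) ->
  (forall a' b', cbox a' b' `<=` cbox a b -> \int[mu]_(x in box a' b') (h x)%:E = 0)%E ->
  {ae mu, forall x, box a b x -> h x = 0}.
Proof.
move=> ih h0; have mB := measurable_box a b.
pose hB := (EFin \o h) \_ (box a b).
have ihB : mu.-integrable setT hB by rewrite -integrable_mkcond.
have mhB := measurable_int _ ihB.
pose m1 := density_measure mu (measurable_funepos mhB) (@funepos_ge0 _ _ hB).
pose m2 := density_measure mu (measurable_funeneg mhB) (@funeneg_ge0 _ _ hB).
have m1fin A : measurable A -> m1 A \is a fin_num.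
  move=> mA; apply: integrable_fin_num => //.
  by apply: integrable_funepos => //; exact: integrableS ihB.
have m2fin A : measurable A -> m2 A \is a fin_num.
  move=> mA; apply: integrable_fin_num => //.
  by apply: integrable_funeneg => //; exact: integrableS ihB.
have m12E A : measurable A -> (\int[mu]_(x in A `&` box a b) (h x)%:E = m1 A - m2 A)%E.
  by move=> mA; rewrite integral_mkcondr integralE.
have m12 A : measurable A -> m1 A = m2 A.
  apply: measure_eq_boxes => a' b'; last first.
    by have := m1fin _ (measurable_box a' b'); rewrite fin_numElt => /andP[].
  have := m12E _ (measurable_box a' b'); rewrite setI_box h0; last first.
    move=> x xab i; have := xab i; rewrite !mxE ge_max le_min.
    by move=> /andP[/andP[_ ->] /andP[_ ->]].
  move/esym/eqP; rewrite sube_eq ?add0e; first by move/eqP.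
    by rewrite m1fin//; exact: measurable_box.
  by rewrite fin_num_adde_defl// m2fin//; exact: measurable_box.
have : ae_eq mu (box a b) (EFin \o h) (cst 0%E).
  apply: integral_ae_eq => // E EB mE; rewrite integral0.
  have := m12E _ mE; rewrite (_ : E `&` box a b = E); last exact/setIidPl.
  by rewrite m12// subee// m2fin.
by apply: filterS => x Hx Bx; have [] := Hx Bx.
Qed.

(** The bumps converge boundedly to the indicator functions of the boxes, so
    that [h] has integral [0] over every box whose closure lies in [A];
    countably many of them cover [A]. *)
Lemma fundamental_lemma (A : set 'rV[R]_n) (h : 'rV[R]_n -> R) : open A ->
  loc_integrable A h ->
  (forall phi, test_fun A phi -> \int[mu]_(x in A) (h x * phi x) = 0) ->
  {ae mu, forall x, A x -> h x = 0}.
Proof.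
move=> oA ih h0.
have box0 a b : cbox a b `<=` A -> (\int[mu]_(x in box a b) (h x)%:E = 0)%E.
  move=> abA; have mK := measurable_cbox a b; have mB := measurable_box a b.
  have ihK := ih _ (@compact_cbox R n a b) abA.
  have mh : measurable_fun (cbox a b) h by apply/measurable_EFinP;
    exact: (measurable_int _ ihK).
  have mphi m : measurable_fun (cbox a b) (box_bump a b m).
    by apply: continuous_measurable_mx => //; apply: ray_poly_continuous;
      exact: ray_poly_box_bump.
  have mhphi m : measurable_fun (cbox a b) (fun x => (h x * box_bump a b m x)%:E).
    by apply/measurable_EFinP; apply: measurable_funM.
  have hphi m x : (`|(h x * box_bump a b m x)%:E| <= `|(h x)%:E|)%E.
    rewrite !abse_EFin lee_fin normrM (ger0_norm (box_bump_ge0 _ _ _ _)).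
    by rewrite ler_piMr// box_bump_le1.
  have intK m : (\int[mu]_(x in cbox a b) (h x * box_bump a b m x)%:E = 0)%E.
    have := h0 _ (test_fun_box_bump m abA).
    rewrite /Rintegral integral_mkcond.
    rewrite (_ : _ \_ A = (fun x => (h x * box_bump a b m x)%:E) \_ (cbox a b)).
      rewrite -integral_mkcond => H0; apply/eqP; rewrite -fine_eq0 ?H0//.
      apply: integrable_fin_num => //.
      apply: (le_integrable mK _ _ ihK) => // x _; exact: hphi.
    apply/funext => x; rewrite !patchE; case: ifPn => xA.
      case: ifPn => // xab; rewrite box_bump_out ?mulr0//.
      by rewrite notin_setE in xab => /box_sub_cbox/xab.
    case: ifPn => // xab; exfalso; rewrite inE in xab.
    by rewrite notin_setE in xA; apply/xA/abA.
  have [] := @dominated_convergence _ _ _ mu (cbox a b) mK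
    (fun m x => (h x * box_bump a b m x)%:E) (fun x => (h x * \1_(box a b) x)%:E)
    (fun x => `|(h x)%:E|%E) mhphi.
  - by apply/measurable_EFinP; apply: measurable_funM.
  - apply/aeW => x _; apply: cvg_EFin; first exact: nearW.
    by apply: cvgMl_tmp; exact: box_bump_cvg.
  - exact: integrable_abse.
  - by apply/aeW => x m _; exact: hphi.
  move=> _ _; rewrite (_ : [sequence _]_m = cst 0%E); last by apply/funext => m /=.
  move=> /(cvg_unique _ (cvg_cst _)) => /(_ _)/esym int0.
  rewrite -[RHS]int0// -[in LHS](setIidr (@box_sub_cbox R n a b)) integral_mkcondr.
  apply: eq_integral => x _; rewrite patchE indicE.
  by case: ifPn => _; rewrite ?mulr1 ?mulr0.
suff H (cr : 'rV[rat]_n * rat) : {ae mu, forall x, cbox (rat_lo R cr) (rat_hi R cr) `<=` A ->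
    box (rat_lo R cr) (rat_hi R cr) x -> h x = 0}.
  have := ae_countable H; apply: filterS => x Hx Ax.
  have [cr crx crA] := nbhs_rat_box (open_nbhs_nbhs (conj oA Ax)).
  exact: Hx crA crx.
have [crA|ncrA] := pselect (cbox (rat_lo R cr) (rat_hi R cr) `<=` A); last first.
  by apply: aeW => x /ncrA.
have : {ae mu, forall x, box (rat_lo R cr) (rat_hi R cr) x -> h x = 0}.
  apply: ae_eq0_integral_boxes.
    apply: integrableS (ih _ (@compact_cbox R n _ _) crA).
    - exact: measurable_cbox.
    - exact: measurable_box.
    - exact: box_sub_cbox.
  by move=> a' b' ab'; apply: box0; exact: subset_trans crA.
by apply: filterS => x Hx _.
Qed.

End comparison.

(** * Test functions and weak gradients *)

Section test_functions.
Variables (R : realType) (n : nat).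
Local Notation mu := (lebesgue_rV R n).
Local Notation e_ j := (delta_mx 0 j : 'rV[R]_n).
Implicit Types (A K : set 'rV[R]_n) (phi h : 'rV[R]_n -> R).

Lemma test_fun_continuous A phi : test_fun A phi -> continuous phi.
Proof. by move=> [/(_ 0%N)/= []]. Qed.

Lemma test_fun_derivable A phi j x : test_fun A phi -> derivable phi x (e_ j).
Proof. by move=> [/(_ 1%N)/= [_ /(_ j)[+ _]] _ _]. Qed.

Lemma test_fun_continuous_derive A phi j : test_fun A phi ->
  continuous (fun x => 'D_(e_ j) phi x).
Proof. by move=> [/(_ 1%N)/= [_ /(_ j)[_ [+ _]]] _ _]. Qed.

Lemma support_out phi x : ~ support_of phi x -> phi x = 0.
Proof.
by move=> Kx; apply: contrapT => /eqP phix; apply: Kx; exact: subset_closure.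
Qed.

Lemma derive_support_out phi v x : ~ support_of phi x -> 'D_v phi x = 0.
Proof.
move=> Kx; rewrite (@near_eq_derive _ _ _ phi (cst 0)) ?derive_cst//.
have oK : open (~` support_of phi) by apply: closed_openC; exact: closed_closure.
have : nbhs x (~` support_of phi) by apply: open_nbhs_nbhs.
by apply: filterS => y; exact: support_out.
Qed.

Lemma compact_continuous_bounded K h : compact K -> continuous h ->
  exists2 M, 0 <= M & forall x, K x -> `|h x| <= M.
Proof.
move=> cK ch; have : compact (h @` K).
  by apply: continuous_compact cK; exact: continuous_subspaceT.
move=> /compact_bounded /ex_strict_bound_gt0[M M0 HM]; exists M; first exact: ltW.
by move=> x Kx; apply/ltW/HM; exists x.
Qed.

Lemma open_bigcup_rat_cbox A : open A ->
  A = \bigcup_(cr in [set cr | cbox (rat_lo R cr) (rat_hi R cr) `<=` A])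
    cbox (rat_lo R cr) (rat_hi R cr).
Proof.
move=> oA; apply/seteqP; split => [x Ax|x [cr /= crA /crA//]].
have [cr crx crA] := nbhs_rat_box (open_nbhs_nbhs (conj oA Ax)).
by exists cr => //; exact: box_sub_cbox.
Qed.

Lemma loc_integrable_measurable A h : open A -> loc_integrable A h ->
  measurable_fun A h.
Proof.
move=> oA ih _ B mB; rewrite (open_bigcup_rat_cbox oA) setI_bigcupl bigcup_mkcond.
apply: countable_bigcupT_measurable => // cr; case: ifPn => // crA.
rewrite inE in crA.
have /measurable_int/measurable_EFinP := ih _ (@compact_cbox R n _ _) crA.
by apply => //; exact: measurable_cbox.
Qed.

Lemma restrict_supported A K (g : 'rV[R]_n -> \bar R) : K `<=` A ->
  (forall x, ~ K x -> g x = 0%E) -> g \_ A = g \_ K.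
Proof.
move=> KA g0; apply/funext => x; rewrite !patchE.
case: ifPn => xA; case: ifPn => xK //.
  by rewrite g0//; rewrite notin_setE in xK.
by exfalso; rewrite inE in xK; rewrite notin_setE in xA; exact/xA/KA.
Qed.

(** A locally integrable function becomes integrable when it is multiplied by a
    continuous function with compact support. *)
Lemma integrable_loc_mul A K h psi : open A -> loc_integrable A h ->
  continuous psi -> compact K -> K `<=` A -> (forall x, ~ K x -> psi x = 0) ->
  mu.-integrable A (fun x => (h x * psi x)%:E).
Proof.
move=> oA ih cpsi cK KA psi0; have mA := measurable_open_mx oA.
have mK := compact_measurable_rV cK.
apply/(integrable_mkcond _ mA); rewrite (restrict_supported KA); last first.
  by move=> x /psi0 ->; rewrite mulr0.
apply/(integrable_mkcond _ mK).
have [M M0 HM] := compact_continuous_bounded cK cpsi.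
apply: (@le_integrable _ _ _ _ _ mK _ (fun x => (M%:E * (h x)%:E)%E)).
- apply/measurable_EFinP; apply: measurable_funM.
    by apply: measurable_funS (loc_integrable_measurable oA ih).
  exact: continuous_measurable_mx.
- move=> x Kx; rewrite -EFinM !abse_EFin lee_fin mulrC !normrM ler_wpM2r//.
  by rewrite (ger0_norm M0); exact: HM.
- by apply: integrableZl => //; exact: ih.
Qed.

Lemma integrable_test A h phi : open A -> loc_integrable A h -> test_fun A phi ->
  mu.-integrable A (fun x => (h x * phi x)%:E).
Proof.
move=> oA ih tphi; have [_ cK KA] := tphi.
apply: integrable_loc_mul cK KA _ => //; first exact: test_fun_continuous tphi.
exact: support_out.
Qed.

Lemma integrable_test_derive A h phi j : open A -> loc_integrable A h -> test_fun A phi ->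
  mu.-integrable A (fun x => (h x * 'D_(e_ j) phi x)%:E).
Proof.
move=> oA ih tphi; have [_ cK KA] := tphi.
apply: integrable_loc_mul cK KA _ => //; first exact: test_fun_continuous_derive tphi.
by move=> x; exact: derive_support_out.
Qed.

Lemma loc_integrable_lin A a b h1 h2 : loc_integrable A h1 -> loc_integrable A h2 ->
  loc_integrable A (fun x => a * h1 x + b * h2 x).
Proof.
move=> i1 i2 K cK KA; have mK := compact_measurable_rV cK.
rewrite (_ : _ \o _ = ((fun x => a%:E * (h1 x)%:E) \+ (fun x => b%:E * (h2 x)%:E))%E);
  last first.
  by apply/funext.
by apply: integrableD => //; apply: integrableZl => //; [exact: i1|exact: i2].
Qed.

Lemma integrable_const A (c : R) : measurable A -> (mu A < +oo)%E ->
  mu.-integrable A (fun=> c%:E).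
Proof.
move=> mA Aoo; apply/integrableP; split => //.
by rewrite integral_cst//= lte_mul_pinfty.
Qed.

Lemma continuous_loc_integrable A h : continuous h -> loc_integrable A h.
Proof.
move=> ch K cK _; have mK := compact_measurable_rV cK.
have [M M0 HM] := compact_continuous_bounded cK ch.
apply: (@le_integrable _ _ _ _ _ mK _ (fun=> M%:E)).
- by apply/measurable_EFinP; exact: continuous_measurable_mx.
- by move=> x Kx; rewrite !abse_EFin lee_fin (ger0_norm M0); exact: HM.
- by apply: integrable_const => //; exact: compact_lebesgue_lty.
Qed.

End test_functions.

Section weak_gradients.
Variables (R : realType) (n d : nat).
Local Notation Rn := 'rV[R]_n.
Local Notation Rd := 'rV[R]_d.
Local Notation Mat := 'M[R]_(d, n).
Local Notation mu := (lebesgue_rV R n).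
Local Notation e_ j := (delta_mx 0 j : Rn).
Implicit Types (A : set Rn) (u v : Rn -> Rd) (G H : Rn -> Mat).

(** The difference of two weak gradients integrates to [0] against every test
    function. *)
Lemma weak_gradient_unique A u G H : open A ->
  is_weak_gradient A u G -> is_weak_gradient A u H ->
  {ae mu, forall x, A x -> G x = H x}.
Proof.
move=> oA uG uH; have mA := measurable_open_mx oA.
suff E (ij : 'I_d * 'I_n) : {ae mu, forall x, A x -> G x ij.1 ij.2 - H x ij.1 ij.2 = 0}.
  have := ae_countable E; apply: filterS => x Ex Ax; apply/matrixP => i j.
  by apply/eqP; rewrite -subr_eq0; apply/eqP; exact: (Ex (i, j)).
case: ij => i j /=; have [_ iG GE] := uG i j; have [_ iH HE] := uH i j.
apply: fundamental_lemma => //.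
  have := loc_integrable_lin 1 (-1) iG iH.
  by congr loc_integrable; apply/funext => x; rewrite mul1r mulN1r.
move=> phi tphi; under eq_Rintegral do rewrite mulrBl.
rewrite RintegralB//; [|exact: integrable_test..].
by apply/eqP; rewrite subr_eq0 -eqr_opp -GE// -HE.
Qed.

Lemma weak_gradientP A u : weakly_differentiable A u ->
  is_weak_gradient A u (weak_gradient A u).
Proof. by move=> uG; exact: (xgetPex (fun=> 0 : Mat)). Qed.

Lemma weak_gradient_ae A u G : open A -> is_weak_gradient A u G ->
  {ae mu, forall x, A x -> weak_gradient A u x = G x}.
Proof.
move=> oA uG; apply: (weak_gradient_unique oA _ uG); apply: weak_gradientP.
by exists G.
Qed.

Lemma is_weak_gradient_measurable A u G : open A -> is_weak_gradient A u G ->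
  measurable_fun A G.
Proof.
move=> oA uG; apply: measurable_fun_mx => [|i j]; first exact: measurable_open_mx.
by have [_ iG _] := uG i j; exact: loc_integrable_measurable.
Qed.

Lemma is_weak_gradient_lin A a b u v G H : open A ->
  is_weak_gradient A u G -> is_weak_gradient A v H ->
  is_weak_gradient A (fun x => a *: u x + b *: v x) (fun x => a *: G x + b *: H x).
Proof.
move=> oA uG vH i j; have mA := measurable_open_mx oA.
have [iu iG uGE] := uG i j; have [iv iH vHE] := vH i j.
have Eu : (fun x => (a *: u x + b *: v x) 0 i) = (fun x => a * u x 0 i + b * v x 0 i).
  by apply/funext => x; rewrite !mxE.
have EG : (fun x => (a *: G x + b *: H x) i j) = (fun x => a * G x i j + b * H x i j).
  by apply/funext => x; rewrite !mxE.
split; [by rewrite Eu; exact: loc_integrable_lin|by rewrite EG; exact: loc_integrable_lin|].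
move=> phi tphi.
transitivity (\int[mu]_(x in A) (a * (u x 0 i * 'D_(e_ j) phi x) + b * (v x 0 i * 'D_(e_ j)
  phi x))).
  by apply: eq_Rintegral => x _; rewrite !mxE; ring.
have iaux c (h : Rn -> R) : mu.-integrable A (EFin \o h) ->
  mu.-integrable A (EFin \o (fun x => c * h x)).
  by move=> ?; rewrite (_ : _ \o _ = (fun x => c%:E * (h x)%:E)%E)//; exact: integrableZl.
rewrite RintegralD//; [|by apply: iaux; exact: integrable_test_derive..].
rewrite !RintegralZl//; [|by exact: integrable_test_derive..].
rewrite uGE// vHE//.
transitivity (- \int[mu]_(x in A) (a * (G x i j * phi x) + b * (H x i j * phi x))); last first.
  by congr (- _); apply: eq_Rintegral => x _; rewrite !mxE; ring.
rewrite RintegralD//; [|by apply: iaux; exact: integrable_test..].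
rewrite !RintegralZl//; [|by exact: integrable_test..].
ring.
Qed.

Lemma is_weak_gradient_sum (I : Type) (s : seq I) A (u : I -> Rn -> Rd)
    (G : I -> Rn -> Mat) : open A -> (forall k, is_weak_gradient A (u k) (G k)) ->
  is_weak_gradient A (fun x => \sum_(k <- s) u k x) (fun x => \sum_(k <- s) G k x).
Proof.
move=> oA uG; elim: s => [|k s IH].
  rewrite (_ : (fun x : Rn => \sum_(k <- [::]) u k x) = fun=> 0); last first.
    by apply/funext => x; rewrite big_nil.
  rewrite (_ : (fun x : Rn => \sum_(k <- [::]) G k x) = fun=> 0); last first.
    by apply/funext => x; rewrite big_nil.
  move=> i j; split => [||phi tphi].
  - by under eq_fun do rewrite mxE; apply: continuous_loc_integrable; exact: cst_continuous.
  - by under eq_fun do rewrite mxE; apply: continuous_loc_integrable; exact: cst_continuous.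
  - under eq_Rintegral do rewrite mxE mul0r.
    under [in RHS]eq_Rintegral do rewrite mxE mul0r.
    by rewrite /Rintegral integral0 fine0 oppr0.
have := is_weak_gradient_lin 1 1 oA (uG k) IH.
by congr is_weak_gradient; apply/funext => x; rewrite !scale1r big_cons.
Qed.

End weak_gradients.

Section translations.
Variables (R : realType) (n d : nat).
Local Notation Rn := 'rV[R]_n.
Local Notation Rd := 'rV[R]_d.
Local Notation Mat := 'M[R]_(d, n).
Local Notation mu := (lebesgue_rV R n).
Local Notation e_ j := (delta_mx 0 j : Rn).
Implicit Types (A : set Rn) (u v : Rn -> Rd) (G H : Rn -> Mat) (phi : Rn -> R).

(** A named map, so that composition and preimage with a translation are visible
    to unification. *)
Definition shiftv (e : Rn) (x : Rn) := x + e.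

Lemma shiftvK e : cancel (shiftv e) (shiftv (- e)).
Proof. by move=> x; rewrite /shiftv addrK. Qed.

Lemma shiftvNK e : cancel (shiftv (- e)) (shiftv e).
Proof. by move=> x; rewrite /shiftv addrNK. Qed.

Lemma shiftv_continuous e : continuous (shiftv e).
Proof. by move=> x; apply: continuousD; [exact: cvg_id|exact: cst_continuous]. Qed.

Lemma integral_shiftv e A (h : Rn -> \bar R) :
  (\int[mu]_(x in shiftv e @^-1` A) h (shiftv e x) = \int[mu]_(x in A) h x)%E.
Proof.
apply: (integral_preserving (psi := shiftv (- e))).
- exact: measurable_translate.
- exact: measurable_translate.
- exact: shiftvK.
- exact: shiftvNK.
- exact: lebesgue_rV_translate.
Qed.

Lemma ae_shiftv e (P : set Rn) : {ae mu, forall x, P x} -> {ae mu, forall x, P (shiftv e x)}.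
Proof.
by apply: ae_preserving; [exact: measurable_translate|exact: lebesgue_rV_translate].
Qed.

Lemma open_shiftv e A : open A -> open (shiftv e @^-1` A).
Proof. by move=> oA; apply: open_comp oA => x _; exact: shiftv_continuous. Qed.

Lemma preimage_shiftvN e A : shiftv e @^-1` A = shiftv (- e) @` A.
Proof.
apply/seteqP; split => [x Ax|_ [y Ay <-]]; last by rewrite /preimage /= shiftvNK.
by exists (shiftv e x) => //; rewrite shiftvK.
Qed.

Lemma compact_shiftv e A : compact A -> compact (shiftv e @^-1` A).
Proof.
move=> cA; rewrite preimage_shiftvN; apply: continuous_compact cA.
by apply: continuous_subspaceT; exact: shiftv_continuous.
Qed.

Lemma bounded_shiftv e A : bounded_set A -> bounded_set (shiftv e @^-1` A).
Proof.
move=> [M [Mr HM]]; exists (M + 1 + `|e|); split; first by rewrite !realD.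
move=> N MN x /HM /= Hx; have : `|x + e| <= M + 1 by apply: Hx; rewrite ltrDl.
move=> xe; apply: le_trans (ltW MN); rewrite -[x](addrK e).
by apply: le_trans (ler_normB _ _) _; rewrite lerD2r.
Qed.

Lemma derive_shiftv e phi (x v : Rn) : 'D_v (phi \o shiftv e) x = 'D_v phi (shiftv e x).
Proof.
rewrite /derive; set g1 := fun h => h^-1 *: _; set g2 := fun h => h^-1 *: _.
by suff -> : g1 = g2 by []; apply/funext => h; rewrite /g1 /g2 /= /shiftv addrA.
Qed.

Lemma derivable_shiftv e phi (x v : Rn) : derivable phi (shiftv e x) v ->
  derivable (phi \o shiftv e) x v.
Proof.
rewrite /derivable; set g1 := fun h => h^-1 *: _; set g2 := fun h => h^-1 *: _.
by suff -> : g1 = g2 by []; apply/funext => h; rewrite /g1 /g2 /= /shiftv addrA.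
Qed.

Lemma Ck_shiftv k e phi : Ck k phi -> Ck k (phi \o shiftv e).
Proof.
have cont f : continuous f -> continuous (f \o shiftv e : Rn -> R).
  by move=> cf x; apply: continuous_comp; [exact: shiftv_continuous|exact: cf].
elim: k phi => [|k IH] phi /= [cphi phiP]; split; [exact: cont|by []|exact: cont|].
move=> j; have [dphi Cphi] := phiP j; split.
  by move=> x; apply: derivable_shiftv; exact: dphi.
rewrite (_ : (fun x => _) = (fun x => 'D_(e_ j) phi x) \o shiftv e); first exact: IH.
by apply/funext => x; rewrite derive_shiftv.
Qed.

Lemma support_shiftv e phi : support_of (phi \o shiftv e) `<=` shiftv e @^-1` support_of phi.
Proof.
have cl : closed (shiftv e @^-1` support_of phi).
  apply: preimage_closed; first by move=> x _; exact: shiftv_continuous.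
  exact: closed_closure.
apply: (@subset_trans _ (closure (shiftv e @^-1` support_of phi))); last first.
  by rewrite -((closure_id _).1 cl).
by apply: closure_subset => x /= x0; exact: subset_closure.
Qed.

Lemma test_fun_shiftv e A phi : test_fun A phi ->
  test_fun (shiftv e @^-1` A) (phi \o shiftv e).
Proof.
move=> [Cphi cK KA]; split => [k||x /support_shiftv]; first by apply: Ck_shiftv.
- apply: subclosed_compact (compact_shiftv cK) (@support_shiftv e phi).
  exact: closed_closure.
- exact: KA.
Qed.

Lemma integrable_shiftv e A (h : Rn -> R) : measurable A ->
  mu.-integrable A (EFin \o h) ->
  mu.-integrable (shiftv e @^-1` A) (EFin \o (h \o shiftv e)).
Proof.
move=> mA /integrableP[mh hoo]; apply/integrableP; split.
  apply/measurable_EFinP; apply: (@measurable_comp _ _ _ _ _ _ A) => //.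
  - by move=> _ [x Kx <-].
  - exact/measurable_EFinP.
  - by apply: measurable_funTS; exact: measurable_translate.
by rewrite (integral_shiftv e _ (fun x => `|(h x)%:E|%E)).
Qed.

Lemma loc_integrable_shiftv e A (h : Rn -> R) : loc_integrable A h ->
  loc_integrable (shiftv e @^-1` A) (h \o shiftv e).
Proof.
move=> ih K cK KA.
have cK' : compact (shiftv (- e) @^-1` K) by exact: compact_shiftv.
have KA' : shiftv (- e) @^-1` K `<=` A.
  by move=> x /KA; rewrite /preimage /= shiftvNK.
rewrite (_ : K = shiftv e @^-1` (shiftv (- e) @^-1` K)).
  by apply: integrable_shiftv; [exact: compact_measurable_rV|exact: ih].
by apply/seteqP; split => x; rewrite /preimage /= shiftvK.
Qed.

(** A test function on the translated set is a translate of a test function on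
    [A]; the integrals are invariant under translation. *)
Lemma is_weak_gradient_shiftv e A u G : is_weak_gradient A u G ->
  is_weak_gradient (shiftv e @^-1` A) (u \o shiftv e) (G \o shiftv e).
Proof.
move=> uG i j; have [iu iG E] := uG i j; split.
- exact: (@loc_integrable_shiftv e A (fun x => u x 0 i)).
- exact: (@loc_integrable_shiftv e A (fun x => G x i j)).
move=> phi tphi.
have tphi' : test_fun A (phi \o shiftv (- e)).
  have := test_fun_shiftv (- e) tphi; congr test_fun.
  by apply/seteqP; split => x; rewrite /preimage /= shiftvNK.
have := E _ tphi'; rewrite /Rintegral.
rewrite -(integral_shiftv e _ (fun x => (u x 0 i * _)%:E)).
rewrite -(integral_shiftv e _ (fun x => (G x i j * _)%:E)) /=.
under eq_integral do rewrite derive_shiftv shiftvK.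
by under [in X in _ = X -> _]eq_integral do rewrite shiftvK.
Qed.

Lemma weak_gradient_shiftv e A u : open A -> weakly_differentiable A u ->
  {ae mu, forall x, (shiftv e @^-1` A) x ->
    weak_gradient (shiftv e @^-1` A) (u \o shiftv e) x = weak_gradient A u (shiftv e x)}.
Proof.
move=> oA /weak_gradientP uG; apply: weak_gradient_ae; first exact: open_shiftv.
exact: is_weak_gradient_shiftv.
Qed.

End translations.

Section affine.
Variables (R : realType) (n : nat).
Local Notation Rn := 'rV[R]_n.
Local Notation mu := (lebesgue_rV R n).
Local Notation e_ j := (delta_mx 0 j : Rn).

Lemma is_derive_line (psi : Rn -> R) (x v : Rn) (t : R) :
  derivable psi (t *: v + x) v ->
  is_derive t (1 : R) (fun s : R => psi (s *: v + x)) ('D_v psi (t *: v + x)).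
Proof.
move=> dpsi; suff E : (fun h : R => h^-1 *: (psi ((h *: (1 :
  R) + t) *: v + x) - psi (t *: v + x))) =
    (fun h : R => h^-1 *: (psi (h *: v + (t *: v + x)) - psi (t *: v + x))).
  by apply: DeriveDef; rewrite /derivable /derive /= E.
by apply/funext => h; rewrite [h *: 1]mulr1 scalerDl addrA.
Qed.

(** The difference quotients of [psi] have integral [0] by translation
    invariance.  By the mean value theorem they are bounded by [sup |D psi|] and
    supported in a fixed box, so that they converge to [D psi] under the
    integral. *)
Lemma integral_derive_compact_support (psi : Rn -> R) (K : set Rn) j :
  continuous psi -> (forall x, derivable psi x (e_ j)) ->
  continuous (fun x => 'D_(e_ j) psi x) -> compact K ->
  (forall x, ~ K x -> psi x = 0) -> (forall x, ~ K x -> 'D_(e_ j) psi x = 0) ->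
  mu.-integrable setT (fun x => ('D_(e_ j) psi x)%:E) /\
  (\int[mu]_x ('D_(e_ j) psi x)%:E = 0)%E.
Proof.
move=> cpsi dpsi cdpsi cK psi0 dpsi0.
have [M M0 HM] : exists2 M, 0 <= M & forall x, `|'D_(e_ j) psi x| <= M.
  have [M M0 HM] := compact_continuous_bounded cK cdpsi; exists M => // x.
  by have [/HM//|/dpsi0 ->] := pselect (K x); rewrite normr0.
have [k KB] := bounded_sub_box (compact_bounded cK).
pose B := box (const_mx (- k.+1%:R)) (const_mx k.+1%:R) : set Rn.
have mB : measurable B by exact: measurable_box.
have ipsi : mu.-integrable setT (EFin \o psi).
  apply: (@eq_integrable _ _ _ mu _ measurableT ((EFin \o psi) \_ K)).
    move=> x _; rewrite patchE; case: ifPn => // xK.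
    by rewrite notin_setE in xK; rewrite /= psi0.
  apply/(integrable_mkcond _ (compact_measurable_rV cK)).
  exact: (@continuous_loc_integrable R n setT).
pose h m : R := m.+1%:R^-1.
have h0 m : 0 < h m by rewrite invr_gt0.
have h1 m : h m <= 1 by rewrite invf_le1// ler1n.
pose q m x := (h m)^-1 * (psi (shiftv (h m *: e_ j) x) - psi x).
have qM m x : exists2 t, 0 <= t <= h m & q m x = 'D_(e_ j) psi (t *: e_ j + x).
  have [|||t] := @MVT_segment _ (fun s : R => psi (s *: e_ j + x)) (fun s :
    R => 'D_(e_ j) psi (s *: e_ j + x)) 0 (h m).
  - exact: ltW.
  - by move=> s _; exact: is_derive_line.
  - apply: derivable_within_continuous => s _.
    by have [] := @is_derive_line psi x (e_ j) s (dpsi _).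
  rewrite in_itv /= => tm; rewrite scale0r add0r subr0 => E; exists t => //.
  by rewrite /q /shiftv addrC [x + _]addrC addrC E mulrC mulfK// gt_eqF.
have qB m x : (`|(q m x)%:E| <= ((cst M%:E) \_ B) x)%E.
  have [t /andP[t0 tm] ->] := qM m x; rewrite patchE; case: ifPn => [_|xB].
    by rewrite lee_fin.
  rewrite [X in (`|X%:E| <= _)%E](_ : _ = 0) ?abse0 ?lexx//.
  apply: dpsi0 => /KB tB; rewrite notin_setE in xB; apply: xB => i.
  have := tB i; rewrite !mxE -!ltr_norml => tx.
  have tj : `|t * ((0 == 0 :> 'I_1) && (i == j))%:R| <= 1.
    rewrite normrM (ger0_norm t0) (le_trans _ (h1 m))//.
    by case: (_ && _); rewrite ?normr1 ?mulr1 ?normr0 ?mulr0// (le_trans t0).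
  rewrite -[x 0 i](addKr (t * ((0 == 0 :> 'I_1) && (i == j))%:R)).
  rewrite (le_lt_trans (ler_normD _ _))// normrN -natr1 addrC ltr_leD//.
have cq x : q m x @[m --> \oo] --> 'D_(e_ j) psi x.
  have := dpsi x; rewrite /derivable => /cvg_ex[l dl].
  have -> : 'D_(e_ j) psi x = l by exact: cvg_lim dl.
  (* The steps are positive, so that they tend to 0 in the punctured sense. *)
  have : h m @[m --> \oo] --> (0 : R)^'.
    move=> P P0; have /(@cvg_harmonic R) : nbhs (0 : R) [set y | y != 0 -> P y] := P0.
    apply: (@filterS _ \oo) => i Hi; apply: Hi.
    by apply/negP => /eqP h00; have := h0 i; rewrite [h i]h00 ltxx.
  move=> /(cvg_comp _ _)/(_ dl); apply: cvg_trans; apply: near_eq_cvg; near=> m.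
  by rewrite /q /= /shiftv [x + _]addrC.
have iq m : mu.-integrable setT (EFin \o q m) /\ (\int[mu]_x (q m x)%:E = 0)%E.
  have ipsi' := integrable_shiftv (h m *: e_ j) measurableT ipsi.
  rewrite preimage_setT in ipsi'.
  have iB := integrableB measurableT ipsi' ipsi.
  split.
    rewrite (_ : _ \o _ = (fun x => ((h m)^-1)%:E * ((EFin \o (psi \o shiftv (h m *: e_
      j))) \- (EFin \o psi)) x)%E)//.
    exact: integrableZl.
  rewrite (_ : (fun x => _) = (fun x => ((h m)^-1)%:E * ((EFin \o (psi \o shiftv (h m *: e_
    j))) \- (EFin \o psi)) x)%E)//.
  rewrite integralZl// integralB//.
  have /= := integral_shiftv (h m *: e_ j) setT (EFin \o psi).
  rewrite preimage_setT => ->; rewrite subee ?mule0//.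
  exact: integrable_fin_num.
have [|||||iD _ lim] := @dominated_convergence _ _ _ mu setT measurableT
   (fun m x => (q m x)%:E) (fun x => ('D_(e_ j) psi x)%:E) ((cst M%:E) \_ B).
- by move=> m; have [/measurable_int] := iq m.
- by apply/measurable_EFinP; exact: continuous_measurable_mx.
- by apply: aeW => x _; apply: cvg_EFin; [exact: nearW|exact: cq].
- apply/(integrable_mkcond _ mB); apply: integrable_const => //.
  exact: lebesgue_rV_box_lty.
- by apply: aeW => x m _; exact: qB.
split => //; move: lim; rewrite (_ : [sequence _]_m = cst 0%E); last first.
  by apply/funext => m /=; have [] := iq m.
by move=> H; rewrite -(cvg_lim _ H)// lim_cst.
Unshelve. all: by end_near. Qed.

Lemma is_derive_coord_mul (phi : Rn -> R) (x : Rn) (c : 'I_n -> R) j :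
  derivable phi x (e_ j) ->
  is_derive x (e_ j) (fun y => (\sum_k c k * y 0 k) * phi y)
    ((\sum_k c k * x 0 k) * 'D_(e_ j) phi x + phi x * c j).
Proof.
move=> dphi; pose l (y : Rn) := \sum_k c k * y 0 k.
have dl : is_derive x (e_ j) l (c j).
  apply: is_derive_lineP.
  have -> : (fun h : R => l (h *: e_ j + x)) = c j *: (id : R -> R) + cst (l x).
    apply/funext => h; rewrite /l /=.
    rewrite [RHS](_ : _ = c j * h + \sum_k c k * x 0 k)//.
    under eq_bigr do rewrite !mxE mulrDr.
    rewrite big_split /=; congr (_ + _).
    rewrite (bigD1 j)//= eqxx mulr1 big1 ?addr0// => i /negbTE ij.
    by rewrite ij !mulr0.
  by apply: is_derive_eq; rewrite addr0 [_ *: _]mulr1.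
exact: (is_deriveM dl (derivableP dphi)).
Qed.

Lemma Rintegral_setT_supported (A K : set Rn) (g : Rn -> R) : measurable A ->
  K `<=` A -> (forall x, ~ K x -> g x = 0) ->
  \int[mu]_(x in A) g x = \int[mu]_x g x.
Proof.
move=> mA KA g0; rewrite /Rintegral integral_mkcond [in RHS]integral_mkcond.
rewrite (@restrict_supported _ _ A K)//; last by move=> x /g0 ->.
by rewrite (@restrict_supported _ _ setT K)// => x /g0 ->.
Qed.

Variable d : nat.

Lemma mulmx_trE (Z : 'M[R]_(d, n)) (x : Rn) i : (x *m Z^T) 0 i = \sum_k Z i k * x 0 k.
Proof. by rewrite mxE; apply: eq_bigr => k _; rewrite mxE mulrC. Qed.

Lemma continuous_mulmx_tr (Z : 'M[R]_(d, n)) i : continuous (fun x : Rn => (x *m Z^T) 0 i).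
Proof.
rewrite (_ : (fun x : Rn => _) = (fun x => \sum_k Z i k * x 0 k)); last first.
  by apply/funext => x; rewrite mulmx_trE.
elim: (index_enum _) => [|k s IH].
  by under eq_fun do rewrite big_nil; exact: cst_continuous.
under eq_fun do rewrite big_cons.
move=> x; refine (continuousD _ (IH x)).
exact: (continuousM (@cst_continuous _ _ (Z i k) x) (@coord_continuous _ _ _ 0 k x)).
Qed.

(** The product of an affine function and a test function has compact support,
    so that its partial derivatives have integral [0]; the product rule splits
    this integral. *)
Lemma is_weak_gradient_affine (A : set Rn) (Z : 'M[R]_(d, n)) : open A ->
  is_weak_gradient A (fun x => x *m Z^T) (fun=> Z).
Proof.
move=> oA i j; have mA := measurable_open_mx oA.
have uEx (x : Rn) := mulmx_trE Z x i.
have cu : continuous (fun x : Rn => (x *m Z^T) 0 i) by exact: continuous_mulmx_tr.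
split.
- exact: continuous_loc_integrable.
- by apply: continuous_loc_integrable; exact: cst_continuous.
move=> phi tphi; have [_ cK KA] := tphi.
pose psi x := (x *m Z^T) 0 i * phi x.
have Dpsi x : is_derive x (e_ j) psi ((x *m Z^T) 0 i * 'D_(e_ j) phi x + phi x * Z i j).
  rewrite uEx (_ : psi = (fun y => (\sum_k Z i k * y 0 k) * phi y)); last first.
    by apply/funext => y; rewrite /psi uEx.
  by apply: is_derive_coord_mul; exact: test_fun_derivable tphi.
have DpsiE x : 'D_(e_ j) psi x = (x *m Z^T) 0 i * 'D_(e_ j) phi x + Z i j * phi x.
  by have [_ ->] := Dpsi x; rewrite [phi x * _]mulrC.
have cphi := test_fun_continuous tphi.
have [||||||iD D0] := @integral_derive_compact_support psi (support_of phi) j.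
- by move=> x; apply: continuousM; [exact: cu|exact: cphi].
- by move=> x; have [] := Dpsi x.
- under eq_fun do rewrite DpsiE.
  have cDphi : continuous (fun x => 'D_(e_ j) phi x) := test_fun_continuous_derive tphi.
  move=> x; have c1 := continuousM (cu x) (cDphi x).
  have c2 := continuousM (@cst_continuous _ _ (Z i j) x) (cphi x).
  exact: (continuousD c1 c2).
- by [].
- by move=> x /support_out; rewrite /psi => ->; rewrite mulr0.
- by move=> x Kx; rewrite DpsiE derive_support_out// support_out// !mulr0 addr0.
rewrite (Rintegral_setT_supported mA KA); last first.
  by move=> x Kx; rewrite derive_support_out ?mulr0.
rewrite (Rintegral_setT_supported mA KA); last first.
  by move=> x Kx; rewrite support_out ?mulr0.
have tphiT : test_fun setT phi by case: tphi.
have oT : open [set: Rn] by exact: openT.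
apply/eqP; rewrite -addr_eq0 -RintegralD//.
- rewrite /Rintegral; under eq_integral do rewrite -DpsiE.
  by rewrite D0.
- by apply: integrable_test_derive tphiT => //; exact: continuous_loc_integrable.
- apply: integrable_test tphiT => //; apply: continuous_loc_integrable.
  exact: cst_continuous.
Qed.

End affine.

(** * Sobolev functions on bounded open sets *)

Lemma ler_exprn_addr1 (R : realFieldType) (y : R) m : (0 < m)%N -> 0 <= y -> y <= y ^+ m + 1.
Proof.
move=> m0 y0; have [y1|/ltW y1] := leP y 1; first by rewrite (le_trans y1)// lerDr exprn_ge0.
by rewrite (le_trans (ler_eXnr m0 y1))// lerDl.
Qed.

(** A crude form of the convexity inequality, enough for integrability. *)
Lemma exprDn_le (R : realFieldType) (x y : R) k : 0 <= x -> 0 <= y ->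
  (x + y) ^+ k <= 2 ^+ k * (x ^+ k + y ^+ k).
Proof.
move=> x0 y0; wlog xy : x y x0 y0 / x <= y.
  by move=> W; have [/W|/ltW/W] := leP x y; [exact|rewrite addrC [x ^+ k + _]addrC; exact].
rewrite (@le_trans _ _ ((2 * y) ^+ k))//.
  by rewrite lerXn2r ?nnegrE ?addr_ge0 ?mulr_ge0// mulrDl mul1r lerD2r.
by rewrite exprMn ler_wpM2l ?exprn_ge0// lerDr exprn_ge0.
Qed.

Section sobolev_spaces.
Variables (R : realType) (n d : nat).
Local Notation Rn := 'rV[R]_n.
Local Notation Rd := 'rV[R]_d.
Local Notation Mat := 'M[R]_(d, n).
Local Notation mu := (lebesgue_rV R n).
Implicit Types (A : set Rn) (u v w : Rn -> Rd) (G H : Rn -> Mat) (k m : nat).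

(** Stated for matrices of any shape, because it is applied both to Sobolev
    functions and to their gradients. *)
Definition power_integral p q k A (w : Rn -> 'M[R]_(p, q)) : \bar R :=
  (\int[mu]_(x in A) (`|w x| ^+ k)%:E)%E.

Lemma power_integral_ge0 p q k A (w : Rn -> 'M[R]_(p, q)) : (0 <= power_integral k A w)%E.
Proof. by apply: integral_ge0 => x _; rewrite lee_fin exprn_ge0. Qed.

Lemma ae_eq_power_integral p q k A (w z : Rn -> 'M[R]_(p, q)) :
  {ae mu, forall x, A x -> w x = z x} -> power_integral k A w = power_integral k A z.
Proof.
move=> wz; apply: ae_eq_lower_integral; move: wz.
by apply: filterS => x wz Ax; rewrite wz.
Qed.

Lemma measurable_norm_mx p q D (w : Rn -> 'M[R]_(p, q)) : measurable D ->
  measurable_fun D w -> measurable_fun D (fun x => `|w x|).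
Proof.
move=> mD mw; apply: (@measurableT_comp _ _ _ _ _ _ (fun z : 'M[R]_(p, q) => `|z|)) => //.
by apply: continuous_measurable_mx => //; exact: norm_continuous.
Qed.

Lemma measurable_normX p q D k (w : Rn -> 'M[R]_(p, q)) : measurable D ->
  measurable_fun D w -> measurable_fun D (fun x => (`|w x| ^+ k)%:E).
Proof.
move=> mD mw; apply/measurable_EFinP; apply: measurable_funX.
exact: measurable_norm_mx.
Qed.

Lemma measurable_fun_mx_lin p q D a b (w z : Rn -> 'M[R]_(p, q)) : measurable D ->
  measurable_fun D w -> measurable_fun D z -> measurable_fun D (fun x => a *: w x + b *: z x).
Proof.
move=> mD mw mz; apply: measurable_fun_mx => // i j.
rewrite (_ : (fun x => _) = (fun x => a * w x i j + b * z x i j)); last first.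
  by apply/funext => x; rewrite !mxE.
apply: measurable_funD; apply: measurable_funM => //.
  exact: (measurableT_comp (measurable_coord i j measurableT) mw).
exact: (measurableT_comp (measurable_coord i j measurableT) mz).
Qed.

Lemma power_integral_lin_lty p q k A a b (w z : Rn -> 'M[R]_(p, q)) : measurable A ->
  measurable_fun A w -> measurable_fun A z ->
  (power_integral k A w < +oo)%E -> (power_integral k A z < +oo)%E ->
  (power_integral k A (fun x => a *: w x + b *: z x)%R < +oo)%E.
Proof.
move=> mA mw mz iw iz.
apply: (@le_lt_trans _ _ (\int[mu]_(x in A) ((2 ^+ k * `|a| ^+ k)%:E * (`|w x| ^+ k)%:E +
   (2 ^+ k * `|b| ^+ k)%:E * (`|z x| ^+ k)%:E))%E).
  apply: ae_ge0_le_lower_integral.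
  - by move=> x _; rewrite lee_fin exprn_ge0.
  - by move=> x _; rewrite adde_ge0// mule_ge0// lee_fin ?mulr_ge0 ?exprn_ge0.
  - apply: aeW => x _; rewrite -!EFinM -EFinD lee_fin -!mulrA -mulrDr -!exprMn.
    rewrite (le_trans _ (exprDn_le _ _ _))//.
    by rewrite lerXn2r ?nnegrE// -?normrZ ?ler_normD.
have aux (c : R) (y : Rn -> 'M[R]_(p, q)) : measurable_fun A y ->
  (power_integral k A y < +oo)%E ->
    (\int[mu]_(x in A) ((2 ^+ k * `|c| ^+ k)%:E * (`|y x| ^+ k)%:E) < +oo)%E.
  move=> my iy; rewrite ge0_integralZl_EFin//.
  - by rewrite lte_mul_pinfty// lee_fin mulr_ge0 ?exprn_ge0.
  - exact: measurable_normX.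
rewrite ge0_integralD//.
- by rewrite lte_add_pinfty// aux.
- by apply: measurable_funeM; exact: measurable_normX.
- by apply: measurable_funeM; exact: measurable_normX.
Qed.

Lemma sobolev_energyE k A u G : open A -> is_weak_gradient A u G ->
  sobolev_energy k A u = (power_integral k A u + power_integral k A G)%E.
Proof.
move=> oA uG; congr (_ + _)%E; apply: ae_eq_power_integral.
exact: weak_gradient_ae.
Qed.

Lemma sobolevI k A u G : open A -> measurable_fun A u -> is_weak_gradient A u G ->
  (power_integral k A u < +oo)%E -> (power_integral k A G < +oo)%E -> sobolev k A u.
Proof.
move=> oA mu' uG iu iG; have uw : weakly_differentiable A u by exists G.
split => //.
  exact: (is_weak_gradient_measurable oA (weak_gradientP uw)).
by rewrite (sobolev_energyE k oA uG) lte_add_pinfty.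
Qed.

Lemma sobolev_lty k A u : sobolev k A u ->
  (power_integral k A u < +oo)%E /\ (power_integral k A (weak_gradient A u) < +oo)%E.
Proof.
move=> [_ _ _]; rewrite /sobolev_energy => E; split; apply: le_lt_trans E.
  by rewrite leeDl//; exact: power_integral_ge0.
by rewrite leeDr//; exact: power_integral_ge0.
Qed.

Lemma sobolev_lin k A a b u v : open A -> sobolev k A u -> sobolev k A v ->
  sobolev k A (fun x => a *: u x + b *: v x).
Proof.
move=> oA su sv; have mA := measurable_open_mx oA.
have [iu iGu] := sobolev_lty su; have [iv iGv] := sobolev_lty sv.
have [mu_ mGu wu _] := su; have [mv mGv wv _] := sv.
apply: (@sobolevI _ _ _ (fun x => a *: weak_gradient A u x + b *: weak_gradient A v x)) => //.
- exact: measurable_fun_mx_lin.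
- by apply: is_weak_gradient_lin => //; exact: weak_gradientP.
- exact: power_integral_lin_lty.
- exact: power_integral_lin_lty.
Qed.

Lemma power_integral_bounded_lty p q k A (w : Rn -> 'M[R]_(p, q)) M : measurable A ->
  (mu A < +oo)%E -> (forall x, A x -> `|w x| <= M) -> (power_integral k A w < +oo)%E.
Proof.
move=> mA Aoo wM; have [[z Az]|A0] := pselect (A !=set0); last first.
  have -> : A = set0 by apply/seteqP; split => // x Ax; apply: A0; exists x.
  by rewrite /power_integral integral_set0.
have M0 : 0 <= M by apply: le_trans (wM z Az).
apply: (@le_lt_trans _ _ (\int[mu]_(x in A) (M ^+ k)%:E)%E).
  apply: ae_ge0_le_lower_integral.
  - by move=> x _; rewrite lee_fin exprn_ge0.
  - by move=> x _; rewrite lee_fin exprn_ge0.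
  - by apply: aeW => x Ax; rewrite lee_fin lerXn2r ?nnegrE// wM.
by rewrite integral_cst// lte_mul_pinfty// lee_fin exprn_ge0.
Qed.

Lemma sobolev_affine k A (Z : Mat) : open A -> bounded_set A ->
  sobolev k A (fun x => x *m Z^T).
Proof.
move=> oA bA; have mA := measurable_open_mx oA.
have Aoo := bounded_lebesgue_lty mA bA.
apply: (@sobolevI _ _ _ (fun=> Z)) => //.
- apply: measurable_fun_mx => // i j; rewrite ord1.
  by apply: continuous_measurable_mx => //; exact: continuous_mulmx_tr.
- exact: is_weak_gradient_affine.
- have [l Al] := bounded_sub_box bA.
  pose K := cbox (const_mx (- l%:R)) (const_mx l%:R) : set Rn.
  have /choice[M HM] (i : 'I_d) : exists M, forall x, A x -> `|(x *m Z^T) 0 i| <= M.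
    have [M _ HM] := compact_continuous_bounded (@compact_cbox R n _ _ :
      compact K) (@continuous_mulmx_tr R n d Z i).
    by exists M => x /Al/box_sub_cbox; exact: HM.
  apply: (@power_integral_bounded_lty _ _ _ _ _ (\sum_i `|M i|)) => // x Ax.
  rewrite [leLHS]mx_normrE; apply/bigmax_leP; split => [|[i j] _] /=.
    by apply: sumr_ge0.
  rewrite ord1 (le_trans (HM _ _ Ax))// (bigD1 j)//= (le_trans (ler_norm _))//.
  by rewrite lerDl sumr_ge0.
- by apply: (@power_integral_bounded_lty _ _ _ _ _ `|Z|).
Qed.

(** The inequality [y <= y ^ m + 1] at [y = (|w x| / lam) ^ k].  The free
    parameter [lam] plays the role of Hoelder's inequality: its best choice
    gives the homogeneous bound of [sobolev_norm_sub]. *)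
Lemma power_integral_scaling p q k m A (w : Rn -> 'M[R]_(p, q)) (lam : R) : (0 < m)%N ->
  measurable A ->
  measurable_fun A w -> 0 < lam ->
  (power_integral k A w <=
   (lam ^+ k / lam ^+ (k * m))%:E * power_integral (k * m) A w + (lam ^+ k)%:E * mu A)%E.
Proof.
move=> m0 mA mw l0.
have ck : 0 <= lam ^+ k / lam ^+ (k * m) by rewrite divr_ge0// exprn_ge0// ltW.
rewrite -integral_cst// -ge0_integralZl_EFin//; last exact: measurable_normX.
rewrite -ge0_integralD//; first last.
- by move=> x _; rewrite lee_fin exprn_ge0// ltW.
- by apply: measurable_funeM; exact: measurable_normX.
- by move=> x _; rewrite mule_ge0// lee_fin exprn_ge0.
apply: ae_ge0_le_lower_integral.
- by move=> x _; rewrite lee_fin exprn_ge0.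
- by move=> x _; rewrite adde_ge0 ?mule_ge0// lee_fin exprn_ge0// ltW.
apply: aeW => x _; rewrite -EFinM -EFinD lee_fin.
have y0 : 0 <= (`|w x| / lam) ^+ k by rewrite exprn_ge0// divr_ge0// ltW.
have := ler_exprn_addr1 m0 y0; set y := `|w x| / lam.
have -> : `|w x| = lam * y by rewrite mulrCA divff ?mulr1// gt_eqF.
have E : lam ^+ k / lam ^+ (k * m) * (lam * y) ^+ (k * m) = lam ^+ k * y ^+ (k * m).
  by rewrite exprMn mulrA divfK// gt_eqF// exprn_gt0.
rewrite E [(lam * y) ^+ k]exprMn -exprM => yk.
by rewrite -[X in _ + X]mulr1 -mulrDr ler_wpM2l// exprn_ge0// ltW.
Qed.

Lemma sobolev_scaling k m A u (lam : R) : (0 < m)%N -> open A ->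
  sobolev (k * m) A u -> 0 < lam ->
  (sobolev_energy k A u <=
   (lam ^+ k / lam ^+ (k * m))%:E * sobolev_energy (k * m) A u + (lam ^+ k)%:E * (mu A + mu
     A))%E.
Proof.
move=> m0 oA [mu_ mG _ _] l0; have mA := measurable_open_mx oA.
have := leeD (power_integral_scaling k m0 mA mu_ l0) (power_integral_scaling k m0 mA mG l0).
move=> /le_trans; apply; rewrite /sobolev_energy.
rewrite [X in (_ <= X + _)%E]ge0_muleDr ?[X in (_ <= _ + X)%E]ge0_muleDr//.
- by rewrite addeACA.
- exact: power_integral_ge0.
- exact: power_integral_ge0.
Qed.

Lemma sobolev_sub k m A u : (0 < m)%N -> open A -> bounded_set A ->
  sobolev (k * m) A u -> sobolev k A u.
Proof.
move=> m0 oA bA su; have [mu_ mG wu E] := su; split => //.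
have Aoo := bounded_lebesgue_lty (measurable_open_mx oA) bA.
apply: le_lt_trans (sobolev_scaling m0 oA su ltr01) _.
rewrite !expr1n divr1 !mul1e lte_add_pinfty// lte_add_pinfty//.
Qed.

(** With energy [e > 0] for the exponent [k m], the choice [lam = e ^ (1 / (k
    m))] makes both terms of the scaling inequality proportional to [lam ^ k].
    If [e = 0], every [lam > 0] is allowed and the energy for the exponent [k]
    vanishes. *)
Lemma sobolev_norm_sub k m A : (0 < k)%N -> (0 < m)%N -> open A -> bounded_set A ->
  exists2 C : R, 0 <= C & forall u, sobolev (k * m) A u ->
    (sobolev_norm k A u <= C%:E * sobolev_norm (k * m) A u)%E.
Proof.
move=> k0 m0 oA bA.
have Aoo := bounded_lebesgue_lty (measurable_open_mx oA) bA.
have Afin : mu A \is a fin_num by rewrite ge0_fin_numE.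
pose a := fine (mu A); have a0 : 0 <= a by rewrite fine_ge0.
have kV0 : 0 < k%:R^-1 :> R by rewrite invr_gt0 ltr0n.
exists ((1 + (a + a)) `^ k%:R^-1) => [|u su]; first exact: powR_ge0.
have E0 l : (0 <= sobolev_energy l A u)%E by rewrite adde_ge0//; exact: power_integral_ge0.
have Efin : sobolev_energy (k * m) A u \is a fin_num by have [_ _ _ ?] := su;
  rewrite ge0_fin_numE.
have Ekfin : sobolev_energy k A u \is a fin_num.
  by have [_ _ _ ?] := sobolev_sub m0 oA bA su; rewrite ge0_fin_numE.
rewrite /sobolev_norm -(fineK Efin) -(fineK Ekfin) !poweR_EFin lee_fin.
set e := fine (sobolev_energy (k * m) A u); set ek := fine (sobolev_energy k A u).
have e0 : 0 <= e by exact: fine_ge0.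
have ek0 : 0 <= ek by exact: fine_ge0.
have scal lam : 0 < lam -> ek <= lam ^+ k / lam ^+ (k * m) * e + lam ^+ k * (a + a).
  move=> l0; rewrite -lee_fin EFinD !EFinM EFinD !fineK//.
  exact: sobolev_scaling.
have km0 : (k * m)%:R != 0 :> R by rewrite pnatr_eq0 -lt0n muln_gt0 k0.
have [e_gt0|] := ltP 0 e.
  pose lam := e `^ (k * m)%:R^-1; have l0 : 0 < lam by exact: powR_gt0.
  have lamE : lam ^+ (k * m) = e.
    by rewrite -powR_mulrn ?ltW// -powRrM mulVf// powRr1.
  have lamk : (lam ^+ k) `^ k%:R^-1 = lam.
    by rewrite -powR_mulrn ?ltW// -powRrM mulfV ?powRr1 ?ltW// pnatr_eq0 -lt0n.
  have lam0 := ltW l0; have kV0' := ltW kV0.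
  rewrite -/lam -[X in _ * X]lamk -powRM ?exprn_ge0 ?addr_ge0//.
  apply: ge0_ler_powR; rewrite ?nnegrE ?mulr_ge0 ?addr_ge0 ?exprn_ge0//.
  have := scal _ l0; rewrite lamE divfK ?gt_eqF// => /le_trans; apply.
  by rewrite mulrDl mul1r [X in _ + X]mulrC.
move=> e_le0; have {e_le0} e_eq0 : e = 0 by apply/le_anti; rewrite e_le0.
rewrite e_eq0 powR0 ?invr_eq0// mulr0.
suff -> : ek = 0 by rewrite powR0// gt_eqF.
apply/le_anti; rewrite ek0 andbT leNgt; apply/negP => ek_gt0.
(* Small enough for the term proportional to lam to stay below ek. *)
pose lam := Num.min 1 (ek / (2 * (1 + (a + a)))).
have a1 : 0 < 1 + (a + a) by rewrite ltr_wpDr// addr_ge0.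
have l0 : 0 < lam by rewrite lt_min ltr01 divr_gt0// mulr_gt0.
have := scal _ l0; rewrite e_eq0 mulr0 add0r leNgt => /negP; apply.
have lam0 := ltW l0.
apply: (@le_lt_trans _ _ (lam * (1 + (a + a)))).
  rewrite ler_pM ?addr_ge0 ?exprn_ge0 ?lerDr//.
  by rewrite ler_iXnr// ge_min lexx.
apply: (@le_lt_trans _ _ (ek / (2 * (1 + (a + a))) * (1 + (a + a)))).
  by rewrite (ler_wpM2r (ltW a1))// ge_min lexx orbT.
by rewrite invfM mulrA mulfVK ?gt_eqF// ltr_pdivrMr// ltr_pMr// ltr1n.
Qed.

(** Continuity of the inclusion [W^{1,km} -> W^{1,k}], read on the dual spaces;
    it turns weak convergence for the exponent [k m] into weak convergence for
    [k]. *)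
Lemma sobolev_dual_sub k m A l : (0 < k)%N -> (0 < m)%N -> open A -> bounded_set A ->
  sobolev_dual (d := d) k A l -> sobolev_dual (k * m) A l.
Proof.
move=> k0 m0 oA bA [lD lZ [C lC]].
have sub u : sobolev (k * m) A u -> sobolev k A u := @sobolev_sub k m A u m0 oA bA.
have [C' C'0 HC] := sobolev_norm_sub k0 m0 oA bA.
split => [u v /sub su /sub sv|c u /sub su|]; [exact: lD|exact: lZ|].
exists (`|C| * C') => u su; apply: le_trans (lC _ (sub _ su)) _.
rewrite EFinM -muleA; apply: (@le_trans _ _ (`|C|%:E * sobolev_norm k A u)%E).
  by rewrite lee_wpmul2r ?poweR_ge0// lee_fin ler_norm.
by rewrite lee_wpmul2l ?lee_fin// HC.
Qed.

Lemma sobolev_weak_cvg_lin k m A a b (v : nat -> Rn -> Rd) u w : (0 < k)%N -> (0 < m)%N ->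
  open A -> bounded_set A -> (forall i, sobolev (k * m) A (v i)) -> sobolev (k * m) A u ->
  sobolev (k * m) A w -> sobolev_weak_cvg (k * m) A v u ->
  sobolev_weak_cvg k A (fun i x => a *: v i x + b *: w x) (fun x => a *: u x + b *: w x).
Proof.
move=> k0 m0 oA bA sv su sw vu l lk.
have sub z : sobolev (k * m) A z -> sobolev k A z := @sobolev_sub k m A z m0 oA bA.
have [lD lZ _] := lk.
have scale c (z : Rn -> Rd) : sobolev k A z -> sobolev k A (fun x => c *: z x).
  move=> sz; have := sobolev_lin c 0 oA sz sz.
  by congr sobolev; apply/funext => x; rewrite scale0r addr0.
have lE (z : Rn -> Rd) : sobolev (k * m) A z ->
    l (fun x => a *: z x + b *: w x) = a * l z + b * l w.
  move=> skz; have sz := sub _ skz; have sw' := sub _ sw.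
  by rewrite (lD _ _ (scale a z sz) (scale b w sw')) (lZ a z sz) (lZ b w sw').
rewrite (lE _ su); under eq_fun do rewrite (lE _ (sv _)).
apply: cvgD; last exact: cvg_cst.
by apply: cvgMl_tmp; apply: vu; exact: sobolev_dual_sub.
Qed.

Lemma power_integral_shiftv p q k A e (w : Rn -> 'M[R]_(p, q)) :
  power_integral k (shiftv e @^-1` A) (w \o shiftv e) = power_integral k A w.
Proof. exact: (integral_shiftv e A (fun x => (`|w x| ^+ k)%:E)). Qed.

Lemma measurable_fun_shiftv p q A e (w : Rn -> 'M[R]_(p, q)) : measurable A ->
  measurable_fun A w -> measurable_fun (shiftv e @^-1` A) (w \o shiftv e).
Proof.
move=> mA mw; apply: (@measurable_comp _ _ _ _ _ _ A) => //.
  by move=> _ [x Ax <-].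
by apply: measurable_funTS; exact: measurable_translate.
Qed.

Lemma sobolev_energy_shiftv k A e u : open A -> weakly_differentiable A u ->
  sobolev_energy k (shiftv e @^-1` A) (u \o shiftv e) = sobolev_energy k A u.
Proof.
move=> oA wu; have uG := weak_gradientP wu.
rewrite (sobolev_energyE k oA uG).
rewrite (sobolev_energyE k (open_shiftv oA) (is_weak_gradient_shiftv e uG)).
by rewrite !power_integral_shiftv.
Qed.

Lemma sobolev_shiftv k A e u : open A -> sobolev k A u ->
  sobolev k (shiftv e @^-1` A) (u \o shiftv e).
Proof.
move=> oA su; have [iu iG] := sobolev_lty su; have [mu_ mG wu _] := su.
apply: (@sobolevI _ _ _ (weak_gradient A u \o shiftv e)).
- exact: open_shiftv.
- by apply: measurable_fun_shiftv => //; exact: measurable_open_mx.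
- by apply: is_weak_gradient_shiftv; exact: weak_gradientP.
- by rewrite power_integral_shiftv.
- by rewrite power_integral_shiftv.
Qed.

(** A functional on the translated space is composed with the translation, which
    preserves the norm. *)
Lemma sobolev_weak_cvg_shiftv k A e (v : nat -> Rn -> Rd) u : open A ->
  sobolev_weak_cvg k A v u ->
  sobolev_weak_cvg k (shiftv e @^-1` A) (fun i => v i \o shiftv e) (u \o shiftv e).
Proof.
move=> oA vu l [lD lZ [C lC]]; apply: (vu (fun z => l (z \o shiftv e))).
have sh (z : Rn -> Rd) : sobolev k A z -> sobolev k (shiftv e @^-1` A) (z \o shiftv e).
  exact: sobolev_shiftv.
split.
- by move=> y z sy sz; exact: (lD (y \o shiftv e) (z \o shiftv e) (sh _ sy) (sh _ sz)).
- by move=> c z sz; exact: (lZ c (z \o shiftv e) (sh _ sz)).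
exists C => z sz; have [_ _ wz _] := sz.
by apply: le_trans (lC _ (sh _ sz)) _; rewrite /sobolev_norm sobolev_energy_shiftv.
Qed.

End sobolev_spaces.

(** * Envelopes and the relaxed densities *)

(** Bernoulli's inequality [1 + m (y - 1) <= y ^ m], solved for [y].  The factor
    [1 / m] is what makes the doubling of the power terms harmless in the limit. *)
Lemma bernoulli_le (R : realFieldType) (y : R) m : (0 < m)%N -> 0 <= y ->
  y <= m%:R^-1 * y ^+ m + 1.
Proof.
move=> m0 y0; have B l : 1 + l%:R * (y - 1) <= y ^+ l.
  elim: l => [|l IH]; first by rewrite mul0r addr0 expr0.
  rewrite exprS; apply: le_trans (ler_wpM2l y0 IH).
  rewrite -subr_ge0 -natr1.
  suff -> : y * (1 + l%:R * (y - 1)) - (1 + (l%:R + 1) * (y - 1)) = l%:R * (y - 1) ^+ 2.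
    by rewrite mulr_ge0 ?sqr_ge0.
  ring.
have m0' : 0 < m%:R :> R by rewrite ltr0n.
rewrite -lerBlDr mulrC ler_pdivlMr// mulrC.
by apply: le_trans (B m); rewrite lerDr.
Qed.

Section ereal_liminf.
Variable R : realType.
Local Open Scope ereal_scope.

Lemma limn_einf_pZl (b : R) (u : (\bar R)^nat) : (0 < b)%R ->
  limn_einf (fun i => b%:E * u i) = b%:E * limn_einf u.
Proof.
move=> b0; rewrite !limn_einf_lim -limeMl//; last exact: is_cvg_einfs.
suff -> : einfs (fun i => b%:E * u i) = (fun i => b%:E * einfs u i) by [].
apply/funext => i; rewrite /einfs -ereal_inf_pZl//.
congr ereal_inf; apply/seteqP; split => [_ [j ij <-]|_ [_ [j ij <-] <-]].
  by exists (u j) => //; exists j.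
by exists j.
Qed.

End ereal_liminf.

Section envelopes.
Variables (R : realType) (n d : nat).
Local Notation Rn := 'rV[R]_n.
Local Notation Rd := 'rV[R]_d.
Local Notation Mat := 'M[R]_(d, n).
Local Notation mu := (lebesgue_rV R n).
Implicit Types (A : set Rn) (u v w : Rn -> Rd) (H F : (Rn -> Rd) -> \bar R) (k m : nat).

Lemma envelope_le k A F u : sobolev k A u -> (seq_weak_lsc_envelope k A F u <= F u)%E.
Proof. by move=> su; apply: ge_ereal_sup => _ [H [_ HF] <-]; exact: HF. Qed.

Lemma le_envelope k A F H u : seq_weakly_lsc k A H ->
  (forall v, sobolev k A v -> (H v <= F v)%E) -> (H u <= seq_weak_lsc_envelope k A F u)%E.
Proof. by move=> lH HF; apply: ereal_sup_ubound; exists H. Qed.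

Lemma envelope_ge0 k A F u : (forall v, (0 <= F v)%E) ->
  (0 <= seq_weak_lsc_envelope k A F u)%E.
Proof.
move=> F0; apply: (@le_envelope _ _ _ (fun=> 0%E)) => // v w _ _ _.
rewrite (_ : limn_einf _ = 0)%E//; apply: (cvg_limn_einf_sup _).1.
exact: cvg_cst.
Qed.

(** Sequential continuity for the weak topologies, restricted to the Sobolev
    spaces since functionals are only constrained there. *)
Definition weakly_continuous_map k1 A1 k2 A2 (L : (Rn -> Rd) -> (Rn -> Rd)) :=
  (forall u, sobolev k2 A2 u -> sobolev k1 A1 (L u)) /\
  (forall (v : nat -> Rn -> Rd) u, (forall i, sobolev k2 A2 (v i)) -> sobolev k2 A2 u ->
     sobolev_weak_cvg k2 A2 v u -> sobolev_weak_cvg k1 A1 (fun i => L (v i)) (L u)).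

Lemma lee_pdivBlE (b C : R) (x y : \bar R) : 0 < b ->
  ((b^-1)%:E * ((- C)%:E + x) <= y)%E = (x <= b%:E * y + C%:E)%E.
Proof.
by move=> b0; rewrite lee_pdivrMl// addeC EFinN leeBlDr.
Qed.

Lemma seq_weakly_lsc_comp k1 A1 k2 A2 L H (b C : R) : 0 < b ->
  weakly_continuous_map k1 A1 k2 A2 L -> seq_weakly_lsc k1 A1 H ->
  seq_weakly_lsc k2 A2 (fun u => b%:E * (C%:E + H (L u)))%E.
Proof.
move=> b0 [Lsob Lcvg] lH v u sv su vu.
rewrite limn_einf_pZl// limn_einf_shift//.
apply: lee_wpmul2l; first by rewrite lee_fin ltW.
apply: leeD2l; apply: lH.
- by move=> i; apply: Lsob; exact: sv.
- exact: Lsob su.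
- exact: Lcvg sv su vu.
Qed.

(** The functional [u |-> (H (L u) - C) / b] is weakly lower semicontinuous and
    below [F], hence below the envelope of [F]. *)
Lemma envelope_transfer k1 A1 k2 A2 L H F (b C : R) : 0 < b ->
  weakly_continuous_map k1 A1 k2 A2 L -> seq_weakly_lsc k1 A1 H ->
  (forall u, sobolev k2 A2 u -> (H (L u) <= b%:E * F u + C%:E)%E) ->
  forall u, (H (L u) <= b%:E * seq_weak_lsc_envelope k2 A2 F u + C%:E)%E.
Proof.
move=> b0 cL lH HF u; rewrite -lee_pdivBlE//.
apply: (@le_envelope _ _ _ (fun u => (b^-1)%:E * ((- C)%:E + H (L u)))%E).
  by apply: seq_weakly_lsc_comp cL lH; rewrite invr_gt0.
by move=> w sw; rewrite lee_pdivBlE// HF.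
Qed.

Lemma weakly_continuous_lin k m A a b w : (0 < k)%N -> (0 < m)%N -> open A ->
  bounded_set A -> sobolev (k * m) A w ->
  weakly_continuous_map k A (k * m) A (fun u x => a *: u x + b *: w x).
Proof.
move=> k0 m0 oA bA sw; split => [u su|v u sv su vu].
  have H := sobolev_lin a b oA su sw.
  exact: (sobolev_sub m0 oA bA H).
exact (sobolev_weak_cvg_lin k0 m0 oA bA sv su sw vu).
Qed.

Lemma weakly_continuous_shiftv k A e : open A ->
  weakly_continuous_map k (shiftv e @^-1` A) k A (fun u => u \o shiftv e).
Proof.
move=> oA; split => [u su|v u sv su vu]; first exact: (sobolev_shiftv e oA su).
exact (sobolev_weak_cvg_shiftv oA vu).
Qed.

(** The envelope is taken in one variable at a time.  For a competitor [H] of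
    the envelope of [Fk] and a fixed second argument, the transfer principle
    replaces [Fkm] by its envelope in the first argument; the result is an
    inequality of the same form in the second argument, to which the principle
    applies again. *)
Lemma envelope_pair_le k m A (Fk Fkm : (Rn -> Rd) -> \bar R) (a b c e : R) :
  (0 < k)%N -> (0 < m)%N -> open A -> bounded_set A -> 0 < c ->
  (forall u, (0 <= Fkm u)%E) ->
  (forall u, sobolev (k * m) A u -> (Fkm u < +oo)%E) ->
  (forall u v, sobolev (k * m) A u -> sobolev (k * m) A v ->
    (Fk (fun x => a *: u x + b *: v x)%R <= c%:E * (Fkm u + Fkm v) + e%:E)%E) ->
  forall u v, sobolev (k * m) A u -> sobolev (k * m) A v ->
    (seq_weak_lsc_envelope k A Fk (fun x => a *: u x + b *: v x)%R <=
     c%:E * (seq_weak_lsc_envelope (k * m) A Fkm u +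
             seq_weak_lsc_envelope (k * m) A Fkm v) + e%:E)%E.
Proof.
move=> k0 m0 oA bA c0 F0 Foo HF u v su sv.
pose E w := seq_weak_lsc_envelope (k * m) A Fkm w.
have E0 w : (0 <= E w)%E by exact: envelope_ge0.
have Ffin w : sobolev (k * m) A w -> Fkm w \is a fin_num.
  by move=> sw; rewrite ge0_fin_numE ?Foo.
have Efin w : sobolev (k * m) A w -> E w \is a fin_num.
  by move=> sw; rewrite ge0_fin_numE// (le_lt_trans (envelope_le _ sw))// Foo.
apply: ge_ereal_sup => _ [H [lH HFk] <-].
(* The second argument is fixed; its contribution is part of the constant. *)
have step1 w : sobolev (k * m) A w ->
    (H (fun x => a *: u x + b *: w x)%R <= c%:E * E u + (c * fine (Fkm w) + e)%:E)%E.
  move=> sw; have cL := weakly_continuous_lin a b k0 m0 oA bA sw.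
  apply: (envelope_transfer c0 cL lH) => z sz.
  apply: le_trans (HFk _ (cL.1 _ sz)) _; apply: le_trans (HF _ _ sz sw) _.
  by rewrite EFinD EFinM fineK ?Ffin// muleDr ?addeA// fin_num_adde_defl ?Ffin.
have cL := weakly_continuous_lin b a k0 m0 oA bA su.
have swap w : (fun x => a *: u x + b *: w x) = (fun x => b *: w x + a *: u x).
  by apply/funext => x; rewrite addrC.
rewrite swap.
have -> : (c%:E * (E u + E v) + e%:E = c%:E * E v + (c * fine (E u) + e)%:E)%E.
  rewrite EFinD EFinM fineK ?Efin// muleDr ?fin_num_adde_defl ?Efin//.
  by rewrite [(c%:E * E u + _)%E]addeC addeA.
apply: (envelope_transfer c0 cL lH) => w sw.
rewrite -swap; apply: le_trans (step1 w sw) _.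
by rewrite !EFinD !EFinM !fineK ?Efin ?Ffin// addeCA.
Qed.

End envelopes.

Section relaxed_densities.
Variables (R : realType) (n d : nat).
Local Notation Rn := 'rV[R]_n.
Local Notation Rd := 'rV[R]_d.
Local Notation Mat := 'M[R]_(d, n).
Local Notation mu := (lebesgue_rV R n).
Implicit Types (A : set Rn) (u v w : Rn -> Rd) (k m : nat).

Lemma integral_functional_affine (h : Rn -> Mat -> R) A Z : open A ->
  integral_functional h A (fun x => x *m Z^T) = (\int[mu]_(x in A) (h x Z)%:E)%E.
Proof.
move=> oA; apply: ae_eq_lower_integral.
have := weak_gradient_ae oA (is_weak_gradient_affine Z oA).
by apply: filterS => x Hx Ax; rewrite Hx.
Qed.

Variables (f : Rn -> Mat -> R) (beta : R).
Hypothesis f_ge0 : forall x Z, 0 <= f x Z.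
Hypothesis f_borel : borel_fun (fun p : Rn * Mat => f p.1 p.2).
Hypothesis f_le : forall x Z, f x Z <= beta * (rows_norm Z + 1).
Hypothesis beta_gt0 : 0 < beta.

Local Notation Fk k := (integral_functional (fun x Z => f x Z ^+ k)).

Lemma measurable_integrand A (G : Rn -> Mat) k : measurable A -> measurable_fun A G ->
  measurable_fun A (fun x => (f x (G x) ^+ k)%:E).
Proof.
move=> mA mG; apply/measurable_EFinP; apply: measurable_funX.
exact: (borel_fun_graph f_borel mA mG).
Qed.

Lemma rows_norm_le (Z : Mat) : rows_norm Z <= d%:R * Num.sqrt n%:R * `|Z|.
Proof.
rewrite /rows_norm -mulrA mulr_natl -[X in _ *+ X]card_ord -sumr_const.
apply: ler_sum => i _; rewrite -[`|Z|]ger0_norm// -sqrtr_sqr -sqrtrM ?ler0n//.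
rewrite ler_wsqrtr// mulr_natl -[X in _ *+ X]card_ord -sumr_const.
apply: ler_sum => j _; rewrite -(real_normK (num_real (Z i j))) lerXn2r ?nnegrE//.
exact: ler_coord_norm.
Qed.

(** The linear growth of [f] makes the functional finite on the whole Sobolev
    space, so that the envelopes can be subtracted. *)
Lemma integral_functional_lty k A u : open A -> bounded_set A -> sobolev k A u ->
  (Fk k A u < +oo)%E.
Proof.
move=> oA bA su; have mA := measurable_open_mx oA.
have Aoo := bounded_lebesgue_lty mA bA.
have [_ iG] := sobolev_lty su; have [_ mG _ _] := su.
pose c : R := beta * (d%:R * Num.sqrt n%:R).
have c0 : 0 <= c by rewrite /c !mulr_ge0 ?(ltW beta_gt0) ?sqrtr_ge0 ?ler0n.
apply: (@le_lt_trans _ _ (\int[mu]_(x in A) ((2 ^+ k * c ^+ k)%:E *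
   (`|weak_gradient A u x| ^+ k)%:E + (2 ^+ k * beta ^+ k)%:E))%E).
  apply: ae_ge0_le_lower_integral.
  - by move=> x _; rewrite lee_fin exprn_ge0.
  - move=> x _; rewrite -EFinM -EFinD lee_fin addr_ge0// !mulr_ge0 ?exprn_ge0//.
    exact: ltW.
  apply: aeW => x _; rewrite -EFinM -EFinD lee_fin.
  rewrite -mulrA -exprMn -mulrDr; apply: le_trans (exprDn_le _ _ (ltW beta_gt0)); last first.
    by rewrite mulr_ge0.
  rewrite lerXn2r ?nnegrE ?addr_ge0 ?mulr_ge0 ?(ltW beta_gt0)//.
  apply: le_trans (f_le _ _) _; rewrite mulrDr mulr1 lerD2r /c -mulrA.
  by rewrite (ler_wpM2l (ltW beta_gt0))// rows_norm_le.
have b0 : 0 <= 2 ^+ k * beta ^+ k by rewrite mulr_ge0 ?exprn_ge0// ltW.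
have cc0 : 0 <= 2 ^+ k * c ^+ k by rewrite mulr_ge0 ?exprn_ge0.
rewrite ge0_integralD//.
- rewrite integral_cst// ge0_integralZl_EFin//; last exact: measurable_normX.
  by rewrite lte_add_pinfty// lte_mul_pinfty.
- by move=> x _; rewrite mule_ge0 ?lee_fin ?exprn_ge0.
- by apply: measurable_funeM; exact: measurable_normX.
Qed.

Hypothesis f_lc : forall x, level_convex (f x).

(** Bernoulli's inequality at [(y / M) ^ k], where [y] is the larger of the two
    values of [f]; its power is bounded by the sum of the powers, which is
    additive. *)
Lemma level_convex_power_le k m x Z1 Z2 (t M : R) : (0 < m)%N -> 0 < t < 1 -> 0 < M ->
  f x (t *: Z1 + (1 - t) *: Z2) ^+ k <=
  M ^+ k / M ^+ (k * m) / m%:R * (f x Z1 ^+ (k * m) + f x Z2 ^+ (k * m)) + M ^+ k.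
Proof.
move=> m0 t01 M0.
pose y := Num.max (f x Z1) (f x Z2).
have y0 : 0 <= y by rewrite le_max f_ge0.
have fy : f x (t *: Z1 + (1 - t) *: Z2) <= y by exact: f_lc.
apply: (@le_trans _ _ (y ^+ k)); first by rewrite lerXn2r ?nnegrE.
have ykm : y ^+ (k * m) <= f x Z1 ^+ (k * m) + f x Z2 ^+ (k * m).
  rewrite /y; case: (leP (f x Z1) (f x Z2)) => _.
    by rewrite lerDr exprn_ge0.
  by rewrite lerDl exprn_ge0.
have Mk : 0 < M ^+ k by rewrite exprn_gt0.
have Mkm : 0 < M ^+ (k * m) by rewrite exprn_gt0.
have m0' : 0 < m%:R :> R by rewrite ltr0n.
apply: (@le_trans _ _ (M ^+ k / M ^+ (k * m) / m%:R * y ^+ (k * m) + M ^+ k)); last first.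
  by rewrite lerD2r ler_wpM2l// !divr_ge0// ltW.
have yM0 : 0 <= (y / M) ^+ k by rewrite exprn_ge0// divr_ge0// ltW.
have := bernoulli_le m0 yM0; rewrite -exprM !expr_div_n => /(ler_wpM2l (ltW Mk)).
rewrite mulrDr mulr1 [X in X <= _]mulrCA divff ?mulr1 ?gt_eqF//.
by rewrite [y ^+ _ / _]mulrC !mulrA [M ^+ k / m%:R / _]mulrAC.
Qed.

Lemma integral_functional_level_convex k m A u v (t M : R) : (0 < m)%N ->
  open A -> bounded_set A -> 0 < t < 1 -> 0 < M ->
  sobolev (k * m) A u -> sobolev (k * m) A v ->
  (Fk k A (fun x => t *: u x + (1 - t) *: v x)%R <=
   (M ^+ k / M ^+ (k * m) / m%:R)%:E * (Fk (k * m) A u + Fk (k * m) A v) +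
   (M ^+ k * fine (mu A))%:E)%E.
Proof.
move=> m0 oA bA t01 M0 [_ mGu wu _] [_ mGv wv _].
have mA := measurable_open_mx oA; have Aoo := bounded_lebesgue_lty mA bA.
set b := _ / _ / _.
have b0 : 0 <= b by rewrite /b !divr_ge0// ?exprn_ge0 ?ltW.
have Mk0 : 0 <= M ^+ k by rewrite exprn_ge0 ?ltW.
have -> : (M ^+ k * fine (mu A))%:E = (\int[mu]_(x in A) (M ^+ k)%:E)%E.
  by rewrite integral_cst// EFinM fineK// ge0_fin_numE.
have pos G x : (0 <= (f x (G x) ^+ (k * m))%:E)%E by rewrite lee_fin exprn_ge0.
have mI G : measurable_fun A G -> measurable_fun A (fun x => (f x (G x) ^+ (k * m))%:E).
  exact: measurable_integrand.
rewrite /integral_functional -ge0_integralD//; first last.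
- exact: mI.
- exact: mI.
rewrite -ge0_integralZl_EFin//; last 2 first.
- by move=> x _; rewrite adde_ge0// pos.
- by apply: emeasurable_funD; exact: mI.
rewrite -ge0_integralD//; last 2 first.
- by move=> x _; rewrite mule_ge0// adde_ge0// pos.
- by apply: measurable_funeM; apply: emeasurable_funD; exact: mI.
apply: ae_ge0_le_lower_integral.
- by move=> x _; rewrite lee_fin exprn_ge0.
- by move=> x _; apply: adde_ge0; [apply: mule_ge0; [|apply: adde_ge0; exact: pos]|].
have := weak_gradient_ae oA (is_weak_gradient_lin t (1 - t) oA (weak_gradientP wu)
  (weak_gradientP wv)).
apply: filterS => x Hx Ax; rewrite (Hx Ax).
have := level_convex_power_le k x (weak_gradient A u x) (weak_gradient A v x) m0 t01 M0.
by rewrite -lee_fin EFinD EFinM EFinD.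
Qed.

(** An affine function has constant gradient, so that its relaxed energy is the
    integral of the density at a fixed matrix. *)
Lemma relaxed_density_affine k (h g : Rn -> Mat -> R) A Z : relaxed_density k h g ->
  open A -> bounded_set A ->
  (\int[mu]_(x in A) (g x Z)%:E)%E =
  seq_weak_lsc_envelope k A (integral_functional h A) (fun x => x *m Z^T).
Proof.
move=> [_ _ _ gE] oA bA; rewrite -(integral_functional_affine g Z oA).
exact: gE (sobolev_affine k Z oA bA).
Qed.

Variable g : nat -> Rn -> Mat -> R.
Hypothesis gP : forall k, (0 < k)%N -> relaxed_density k (fun x Z => f x Z ^+ k) (g k).

Lemma relaxed_density_lty k A Z : (0 < k)%N -> open A -> bounded_set A ->
  (\int[mu]_(x in A) (g k x Z)%:E < +oo)%E.
Proof.
move=> k0 oA bA; rewrite (relaxed_density_affine Z (gP k0) oA bA).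
have sZ := sobolev_affine k Z oA bA.
by apply: le_lt_trans (envelope_le _ sZ) _; exact: integral_functional_lty.
Qed.

Lemma relaxed_density_integral_level_convex k m A Z1 Z2 (t M : R) :
  (0 < k)%N -> (0 < m)%N -> open A -> bounded_set A -> 0 < t < 1 -> 0 < M ->
  (\int[mu]_(x in A) (g k x (t *: Z1 + (1 - t) *: Z2))%:E <=
   (M ^+ k / M ^+ (k * m) / m%:R)%:E *
     (\int[mu]_(x in A) (g (k * m) x Z1)%:E + \int[mu]_(x in A) (g (k * m) x Z2)%:E) +
   (M ^+ k * fine (mu A))%:E)%E.
Proof.
move=> k0 m0 oA bA t01 M0; have km0 : (0 < k * m)%N by rewrite muln_gt0 k0.
rewrite (relaxed_density_affine _ (gP k0) oA bA).
rewrite !(relaxed_density_affine _ (gP km0) oA bA).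
have -> : (fun x : Rn => x *m (t *: Z1 + (1 - t) *: Z2)^T) =
          (fun x => t *: (x *m Z1^T) + (1 - t) *: (x *m Z2^T)).
  by apply/funext => x; rewrite linearD/= !linearZ/= mulmxDr !scalemxAr.
apply: envelope_pair_le => //.
- by rewrite !divr_gt0 ?exprn_gt0 ?ltr0n.
- by move=> u; apply: integral_ge0 => x _; rewrite lee_fin exprn_ge0.
- by move=> u su; exact: integral_functional_lty.
- by move=> u v su sv; exact: integral_functional_level_convex.
- exact: sobolev_affine.
- exact: sobolev_affine.
Qed.

(** The absolute value makes the Borel version nonnegative everywhere. *)
Lemma relaxed_density_version k Z : (0 < k)%N ->
  exists c : Rn -> R, [/\ measurable_fun setT c, forall x, 0 <= c x &
    {ae mu, forall x, g k x Z = c x}].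
Proof.
move=> k0; have [g0 [gm _] _ _] := gP k0; have [h mh gh] := gm Z.
exists (fun x => `|h x|); split => //; first exact: measurableT_comp.
by apply: filterS gh => x <-; rewrite ger0_norm.
Qed.

Lemma ae_eq_relaxed_integral A k Z (c : Rn -> R) :
  {ae mu, forall x, g k x Z = c x} ->
  (\int[mu]_(x in A) (g k x Z)%:E = \int[mu]_(x in A) (c x)%:E)%E.
Proof. by move=> E; apply: ae_eq_lower_integral; apply: filterS E => x ->. Qed.

(** The inequality between the integrals over all bounded open sets, localized. *)
Lemma ae_relaxed_density_level_convex k m Z1 Z2 (t M : R) :
  (0 < k)%N -> (0 < m)%N -> 0 < t < 1 -> 0 < M ->
  {ae mu, forall x, g k x (t *: Z1 + (1 - t) *: Z2) <=
    M ^+ k / M ^+ (k * m) / m%:R * (g (k * m) x Z1 + g (k * m) x Z2) + M ^+ k}.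
Proof.
move=> k0 m0 t01 M0; have km0 : (0 < k * m)%N by rewrite muln_gt0 k0.
have [c [mc c0 cE]] := relaxed_density_version (t *: Z1 + (1 - t) *: Z2) k0.
have [c1 [mc1 c10 c1E]] := relaxed_density_version Z1 km0.
have [c2 [mc2 c20 c2E]] := relaxed_density_version Z2 km0.
set b := _ / _ / _.
have b0 : 0 <= b by rewrite /b !divr_ge0// ?exprn_ge0 ?ltW.
have Mk0 : 0 <= M ^+ k by rewrite exprn_ge0 ?ltW.
suff H : {ae mu, forall x, c x <= b * (c1 x + c2 x) + M ^+ k}.
  apply: filter_app c2E; apply: filter_app c1E; apply: filter_app cE.
  by apply: filterS H => x Hx -> -> ->.
have m12 : measurable_fun setT (fun x => b * (c1 x + c2 x)).
  by apply: measurable_funM => //; exact: measurable_funD.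
have E (A : set Rn) : measurable A ->
    (\int[mu]_(x in A) (b * (c1 x + c2 x) + M ^+ k)%:E =
     b%:E * (\int[mu]_(x in A) (c1 x)%:E + \int[mu]_(x in A) (c2 x)%:E) +
     (M ^+ k)%:E * mu A)%E.
  move=> mA; rewrite -integral_cst//.
  have m1 : measurable_fun A (EFin \o c1) by apply: measurable_funTS; exact/measurable_EFinP.
  have m2 : measurable_fun A (EFin \o c2) by apply: measurable_funTS; exact/measurable_EFinP.
  have p1 x : A x -> (0 <= (c1 x)%:E)%E by rewrite lee_fin.
  have p2 x : A x -> (0 <= (c2 x)%:E)%E by rewrite lee_fin.
  rewrite -(ge0_integralD mu mA p1 m1 p2 m2).
  have p12 x : A x -> (0 <= (c1 x)%:E + (c2 x)%:E)%E by rewrite -EFinD lee_fin addr_ge0.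
  have me12 := emeasurable_funD m1 m2.
  rewrite -(ge0_integralZl_EFin mu mA p12 me12 b0).
  have q12 x : A x -> (0 <= b%:E * ((c1 x)%:E + (c2 x)%:E))%E.
    by move=> Ax; rewrite mule_ge0// p12.
  have q x : A x -> (0 <= (M ^+ k)%:E)%E by rewrite lee_fin.
  by rewrite -(ge0_integralD mu mA q12 (measurable_funeM _ me12) q).
apply: ae_le_integral_open => //.
- exact: measurable_funD.
- by move=> x; rewrite addr_ge0// mulr_ge0// addr_ge0.
- move=> A oA bA; have mA := measurable_open_mx oA.
  have Aoo := bounded_lebesgue_lty mA bA.
  rewrite E// -(ae_eq_relaxed_integral A c1E) -(ae_eq_relaxed_integral A c2E).
  rewrite -(ae_eq_relaxed_integral A cE) -[mu A]fineK ?ge0_fin_numE// -EFinM.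
  exact: relaxed_density_integral_level_convex.
- move=> A oA bA; have mA := measurable_open_mx oA.
  have Aoo := bounded_lebesgue_lty mA bA.
  rewrite E// -(ae_eq_relaxed_integral A c1E) -(ae_eq_relaxed_integral A c2E).
  have lty Z := relaxed_density_lty Z km0 oA bA.
  rewrite lte_add_pinfty//; last by rewrite lte_mul_pinfty.
  by rewrite lte_mul_pinfty// lte_add_pinfty.
Qed.

(** Composition with the translation maps competitors for the first envelope to
    competitors for the second, because the integrand is invariant. *)
Lemma envelope_shiftv_le k A (e : Rn) u : (0 < k)%N -> open A ->
  (forall x Z, f (x + e) Z = f x Z) -> sobolev k A u ->
  (seq_weak_lsc_envelope k (shiftv e @^-1` A) (Fk k (shiftv e @^-1` A)) (u \o shiftv e) <=
   seq_weak_lsc_envelope k A (Fk k A) u)%E.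
Proof.
move=> k0 oA fe su; apply: ge_ereal_sup => _ [H [lH HF] <-].
have cL := @weakly_continuous_shiftv R n d k A e oA.
rewrite -[leRHS]mul1e -[leRHS]adde0.
apply: (envelope_transfer ltr01 cL lH) => w sw; rewrite mul1e adde0.
apply: le_trans (HF _ (cL.1 _ sw)) _; have [_ _ ww _] := sw.
rewrite /integral_functional.
rewrite -(integral_shiftv e A (fun x => (f x (weak_gradient A w x) ^+ k)%:E)).
rewrite le_eqVlt; apply/orP; left; apply/eqP; apply: ae_eq_lower_integral.
have := weak_gradient_shiftv e oA ww.
by apply: filterS => x Hx Ax; rewrite (Hx Ax) fe.
Qed.

(** A translate of an affine function has the same gradient, so the same matrix
    [Z] appears on both sides.  One inequality is enough for the comparison of
    essential suprema. *)
Lemma ae_relaxed_density_shiftv k (e : Rn) Z : (0 < k)%N ->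
  (forall x Z, f (x + e) Z = f x Z) ->
  {ae mu, forall x, g k x Z <= g k (x + e) Z}.
Proof.
move=> k0 fe; have [c [mc c0 cE]] := relaxed_density_version Z k0.
have cEe := ae_shiftv e cE.
suff : {ae mu, forall x, c x <= (c \o shiftv e) x}.
  move=> H; apply: filter_app cEe; apply: filter_app cE.
  by apply: filterS H => x; rewrite /shiftv /= => Hx -> ->.
have mce : measurable_fun setT (c \o shiftv e).
  by apply: measurableT_comp => //; exact: measurable_translate.
have cint (A : set Rn) : (\int[mu]_(x in shiftv e @^-1` A) ((c \o shiftv e) x)%:E =
    \int[mu]_(x in A) (c x)%:E)%E.
  exact: (integral_shiftv e A (fun x => (c x)%:E)).
have AE (A : set Rn) : shiftv e @^-1` (shiftv (- e) @^-1` A) = A.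
  by apply/seteqP; split => x /=; rewrite shiftvK.
apply: ae_le_integral_open => //.
- by move=> x; exact: c0.
- move=> A' oA' bA'; pose A := shiftv (- e) @^-1` A'.
  have oA : open A by exact: open_shiftv.
  have bA : bounded_set A by exact: bounded_shiftv.
  rewrite -[in leRHS](AE A') cint -/A.
  rewrite -(ae_eq_relaxed_integral A cE) -(ae_eq_relaxed_integral A' cE).
  have sA := sobolev_affine k Z oA bA.
  rewrite (relaxed_density_affine Z (gP k0) oA bA).
  apply: le_trans (envelope_shiftv_le k0 oA fe sA); rewrite AE.
  have [_ _ _ gE] := gP k0; have sA' := sobolev_shiftv e oA sA.
  rewrite AE in sA'; rewrite -gE// /integral_functional.
  rewrite le_eqVlt; apply/orP; left; apply/eqP; apply: ae_eq_lower_integral.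
  have := weak_gradient_ae oA' (_ : is_weak_gradient A' ((fun x => x *m Z^T) \o shiftv e)
    (fun=> Z)).
  have := is_weak_gradient_shiftv e (is_weak_gradient_affine Z oA).
  rewrite AE => wG /(_ wG).
  by apply: filterS => x Hx Ax; rewrite (Hx Ax).
- move=> A' oA' bA'; pose A := shiftv (- e) @^-1` A'.
  have oA : open A by exact: open_shiftv.
  have bA : bounded_set A by exact: bounded_shiftv.
  rewrite -(AE A') cint -/A -(ae_eq_relaxed_integral A cE).
  exact: relaxed_density_lty.
Qed.

End relaxed_densities.

(** * Level convexity of the supremum of the roots *)

(** Rational matrices are dense. *)
Lemma ge0_rat_mx (R : realType) p q (h : 'M[R]_(p, q) -> R) : continuous h ->
  (forall Z : 'M[rat]_(p, q), 0 <= h (map_mx ratr Z)) -> forall Z, 0 <= h Z.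
Proof.
move=> ch h0 Z; rewrite leNgt; apply/negP => hZ.
have /nbhs_rat_ball[[c r] Zc cU] : nbhs Z [set z | h z < 0].
  have : nbhs (h Z) [set y | y < 0] by apply: lt_nbhsl.
  exact: ch.
have := h0 c; rewrite leNgt => /negP; apply; apply: (cU (map_mx ratr c)).
have [r0 _] := Zc; exact: ballxx.
Qed.

Lemma le_rat_mx (R : realType) p q (h1 h2 : 'M[R]_(p, q) -> R) :
  continuous h1 -> continuous h2 ->
  (forall Z : 'M[rat]_(p, q), h1 (map_mx ratr Z) <= h2 (map_mx ratr Z)) ->
  forall Z, h1 Z <= h2 Z.
Proof.
move=> c1 c2 h12 Z; rewrite -subr_ge0.
apply: (@ge0_rat_mx R p q (fun Z => h2 Z - h1 Z)) => [z|{}Z].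
  have := continuousB (c2 z) (c1 z); exact.
by rewrite subr_ge0.
Qed.

Section sup_roots.
Variables (R : realType) (n d : nat).
Local Notation Rn := 'rV[R]_n.
Local Notation Rd := 'rV[R]_d.
Local Notation Mat := 'M[R]_(d, n).
Local Notation mu := (lebesgue_rV R n).

Variable g : nat -> Rn -> Mat -> R.
Hypothesis g_ge0 : forall k x Z, (0 < k)%N -> 0 <= g k x Z.

(** Turns a bound on the supremum into polynomial bounds, which avoid real
    exponents. *)
Lemma sup_root_leP x Z (y : R) : 0 <= y ->
  (sup_root g x Z <= y%:E)%E <-> (forall k, (0 < k)%N -> g k x Z <= y ^+ k).
Proof.
move=> y0; have root k : (0 < k)%N -> (g k x Z `^ k%:R^-1 <= y) = (g k x Z <= y ^+ k).
  move=> k0; have k0' : k%:R != 0 :> R by rewrite pnatr_eq0 -lt0n.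
  have kV0 : 0 < k%:R^-1 :> R by rewrite invr_gt0 ltr0n.
  have yE : y = (y ^+ k) `^ k%:R^-1 by rewrite -powR_mulrn// -powRrM mulfV// powRr1.
  have gE : g k x Z = (g k x Z `^ k%:R^-1) ^+ k.
    by rewrite -powR_mulrn ?powR_ge0// -powRrM mulVf// powRr1// g_ge0.
  apply/idP/idP => H.
    by rewrite gE lerXn2r ?nnegrE ?powR_ge0.
  by rewrite yE ge0_ler_powR ?nnegrE ?exprn_ge0 ?g_ge0// ltW.
split => [H k k0|H].
  rewrite -root// -lee_fin; apply: le_trans H.
  by apply: ereal_sup_ubound; exists k.
by apply: ge_ereal_sup => _ [k /= k0 <-]; rewrite lee_fin root// H.
Qed.

Lemma sup_root_ge0 x Z : (0 <= sup_root g x Z)%E.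
Proof.
apply: (@le_trans _ _ ((g 1 x Z `^ 1%:R^-1)%:E)); first by rewrite lee_fin powR_ge0.
by apply: ereal_sup_ubound; exists 1%N.
Qed.

Lemma le_sup_root x1 x2 Z : (forall k, (0 < k)%N -> g k x1 Z <= g k x2 Z) ->
  (sup_root g x1 Z <= sup_root g x2 Z)%E.
Proof.
move=> g12; apply: ge_ereal_sup => _ [k /= k0 <-].
apply: (@le_trans _ _ ((g k x2 Z `^ k%:R^-1)%:E)).
  by rewrite lee_fin ge0_ler_powR ?nnegrE ?g_ge0 ?invr_ge0 ?ler0n// g12.
by apply: ereal_sup_ubound; exists k.
Qed.

(** Rational weights suffice for arithmetic means, and keep the exceptional null
    sets countable in number. *)
Definition rat_level_convex (h : Mat -> \bar R) := forall (q : rat) Z1 Z2 (y : \bar R),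
  0 < q < 1 -> (h Z1 <= y)%E -> (h Z2 <= y)%E ->
  (h (ratr q *: Z1 + (1 - ratr q) *: Z2)%R <= y)%E.

(** The mean of [N + 1] points is the combination of the first one, with weight
    [1 / (N + 1)], and the mean of the others. *)
Lemma rat_level_convex_mean h Z0 (s : seq Mat) (y : \bar R) : rat_level_convex h ->
  (forall Z, Z \in Z0 :: s -> (h Z <= y)%E) ->
  (h ((size s).+1%:R^-1 *: \sum_(Z <- Z0 :: s) Z)%R <= y)%E.
Proof.
move=> hc; elim: s Z0 => [|Z1 s IH] Z0 hy.
  by rewrite invr1 scale1r big_seq1 hy// mem_head.
pose N := (size s).+1; pose q : rat := N.+1%:R^-1.
have q01 : 0 < q < 1 by rewrite invr_gt0 ltr0n invf_lt1 ?ltr0n// ltr1n.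
have qE : ratr q = N.+1%:R^-1 :> R by rewrite fmorphV/= ratr_nat.
have hs : (h (N%:R^-1 *: \sum_(Z <- Z1 :: s) Z)%R <= y)%E.
  by apply: IH => Z Zs; rewrite hy// inE Zs orbT.
have := hc q _ _ y q01 (hy _ (mem_head _ _)) hs.
rewrite /= -/N [in X in _ -> X]big_cons scalerDr qE scalerA (_ :
  (1 - N.+1%:R^-1) * N%:R^-1 = N.+1%:R^-1 :> R)//.
rewrite -natr1; field.
by rewrite natr1 !pnatr_eq0.
Qed.

(** For a rational [M] above both values, the hypothesis bounds the density by
    [(2 / m + 1) M ^ k]; then [m] tends to infinity and [M] decreases to the
    larger value. *)
Lemma sup_root_level_convex x :
  (forall k m (q M : rat) Z1 Z2, (0 < k)%N -> (0 < m)%N -> 0 < q < 1 -> 0 < M ->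
     g k x (ratr q *: Z1 + (1 - ratr q) *: Z2) <=
     ratr M ^+ k / ratr M ^+ (k * m) / m%:R * (g (k * m) x Z1 + g (k * m) x Z2) + ratr M ^+
       k) ->
  rat_level_convex (sup_root g x).
Proof.
move=> H q Z1 Z2 [y| |] q01; last 2 first.
- by move=> _ _; rewrite leey.
- by rewrite leeNy_eq => /eqP E; have := sup_root_ge0 x Z1; rewrite E.
move=> h1 h2; have y0 : 0 <= y by rewrite -lee_fin (le_trans (sup_root_ge0 x Z1)).
have {h1 h2} [h1 h2] := ((sup_root_leP x Z1 y0).1 h1, (sup_root_leP x Z2 y0).1 h2).
suff HM (M : rat) : y < ratr M -> 
    (sup_root g x (ratr q *: Z1 + (1 - ratr q) *: Z2)%R <= (ratr M)%:E)%E.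
  apply/lee_addgt0Pr => e e0.
  have ye : y < y + e by rewrite ltrDl.
  have [M] := rat_in_itvoo ye.
  rewrite in_itv/= => /andP[yM Mye]; apply: le_trans (HM _ yM) _.
  by rewrite -EFinD lee_fin ltW.
move=> yM; have M0 : 0 < ratr M :> R by apply: le_lt_trans yM.
have M0q : 0 < M by rewrite -(ltr0q R).
apply/sup_root_leP; first exact: ltW.
move=> k k0; have Mk : 0 < ratr M ^+ k :> R by rewrite exprn_gt0.
apply/ler_addgt0Pr => e e0.
have /archi_boundP : 0 <= 2 * ratr M ^+ k / e by rewrite !mulr_ge0 ?invr_ge0 ?ltW.
(* Large enough for the excess 2 M ^ k / m to be at most e. *)
set m := Num.Def.archi_bound _ => me.
have m0 : (0 < m)%N by rewrite -(ltr0n R); apply: le_lt_trans me;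
  rewrite !mulr_ge0 ?invr_ge0 ?ltW.
have m0' : 0 < m%:R :> R by rewrite ltr0n.
have km0 : (0 < k * m)%N by rewrite muln_gt0 k0.
apply: le_trans (H k m q M Z1 Z2 k0 m0 q01 M0q) _.
rewrite addrC lerD2l.
have Mkm : 0 < ratr M ^+ (k * m) :> R by rewrite exprn_gt0.
have le2 : g (k * m) x Z1 + g (k * m) x Z2 <= 2 * ratr M ^+ (k * m).
  rewrite mulrDl mul1r; apply: lerD.
    by apply: le_trans (h1 _ km0) _; rewrite lerXn2r ?nnegrE// ltW.
  by apply: le_trans (h2 _ km0) _; rewrite lerXn2r ?nnegrE// ltW.
have b0 : 0 <= ratr M ^+ k / ratr M ^+ (k * m) / m%:R :> R by rewrite !divr_ge0// ltW.
apply: le_trans (ler_wpM2l b0 le2) _.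
rewrite [X in X <= _](_ : _ = 2 * ratr M ^+ k / m%:R); last first.
  have aux (a c l : R) : c != 0 -> a / c / l * (2 * c) = 2 * a / l.
    by move=> c0; rewrite mulrCA mulrAC divfK// mulrA.
  by rewrite aux// gt_eqF.
by rewrite ler_pdivrMr// [X in _ <= X]mulrC -ler_pdivrMr// ltW.
Qed.

End sup_roots.

Section relaxed_sup_root.
Variables (R : realType) (n d : nat).
Local Notation Rn := 'rV[R]_n.
Local Notation Mat := 'M[R]_(d, n).
Local Notation mu := (lebesgue_rV R n).

Variables (f : Rn -> Mat -> R) (beta : R).
Hypothesis f_ge0 : forall x Z, 0 <= f x Z.
Hypothesis f_borel : borel_fun (fun p : Rn * Mat => f p.1 p.2).
Hypothesis f_le : forall x Z, f x Z <= beta * (rows_norm Z + 1).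
Hypothesis beta_gt0 : 0 < beta.
Variable g : nat -> Rn -> Mat -> R.
Hypothesis gP : forall k, (0 < k)%N -> relaxed_density k (fun x Z => f x Z ^+ k) (g k).

Lemma relaxed_ge0 k x Z : (0 < k)%N -> 0 <= g k x Z.
Proof. by move=> /gP[]. Qed.

Lemma ae_relaxed_continuous : {ae mu, forall x, forall k, (0 < k)%N -> continuous (g k x)}.
Proof.
apply: (@ae_countable _ _ nat (fun k x => (0 < k)%N -> continuous (g k x))) => -[|k].
  exact: aeW.
have [_ [_ cg] _ _] := gP (ltn0Sn k).
by apply: filterS cg => x.
Qed.

Lemma ae_sup_root_shiftv e : (forall x Z, f (x + e) Z = f x Z) ->
  {ae mu, forall x, forall Z, (sup_root g x Z <= sup_root g (x + e) Z)%E}.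
Proof.
move=> fe.
have H : {ae mu, forall x, forall kZ : nat * 'M[rat]_(d, n), (0 < kZ.1)%N ->
    g kZ.1 x (map_mx ratr kZ.2) <= g kZ.1 (x + e) (map_mx ratr kZ.2)}.
  apply: ae_countable => -[[|k] Z] /=; first exact: aeW.
  have := ae_relaxed_density_shiftv f_ge0 f_le beta_gt0 gP (map_mx ratr Z) (ltn0Sn k) fe.
  by apply: filterS => x Hx _.
have c0 := ae_relaxed_continuous; have ce := ae_shiftv e c0.
apply: filter_app ce; apply: filter_app c0; apply: filterS H => x Hx c0 ce Z.
apply: le_sup_root => [k y Y|k k0]; first exact: relaxed_ge0.
apply: (le_rat_mx (c0 k k0) (ce k k0)) => {}Z.
exact: (Hx (k, Z) k0).
Qed.

(** The null sets are indexed by two exponents, two rational numbers and two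
    rational matrices; continuity then frees the matrices, one after the other. *)
Lemma ae_sup_root_level_convex : (forall x, level_convex (f x)) ->
  {ae mu, forall x, rat_level_convex (sup_root g x)}.
Proof.
move=> f_lc.
pose I := ((nat * nat) * (rat * rat) * ('M[rat]_(d, n) * 'M[rat]_(d, n)))%type.
pose ineq k m (q M : rat) x (Z1 Z2 : Mat) :=
  g k x (ratr q *: Z1 + (1 - ratr q) *: Z2) <=
  ratr M ^+ k / ratr M ^+ (k * m) / m%:R * (g (k * m) x Z1 + g (k * m) x Z2) + ratr M ^+ k.
have H : {ae mu, forall x, forall i : I, (0 < i.1.1.1)%N -> (0 < i.1.1.2)%N ->
    0 < i.1.2.1 < 1 -> 0 < i.1.2.2 ->
    ineq i.1.1.1 i.1.1.2 i.1.2.1 i.1.2.2 x (map_mx ratr i.2.1) (map_mx ratr i.2.2)}.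
  apply: ae_countable => -[[[k m] [q M]] [Z1 Z2]] /=.
  have [k0|_] := ltnP 0 k; last exact: aeW.
  have [m0|_] := ltnP 0 m; last exact: aeW.
  have [q01|_] := boolP (0 < q < 1); last exact: aeW.
  have [M0|_] := boolP (0 < M); last exact: aeW.
  have q01' : 0 < (ratr q : R) < 1 by move: q01; rewrite ltr0q -(ltr_rat R q 1) rmorph1.
  have M0' : 0 < ratr M :> R by rewrite ltr0q.
  apply: filterS (ae_relaxed_density_level_convex f_ge0 f_borel f_le beta_gt0 f_lc gP
    (map_mx ratr Z1) (map_mx ratr Z2) k0 m0 q01' M0').
  by move=> x Hx _ _ _ _; exact: Hx.
apply: filter_app ae_relaxed_continuous; apply: filterS H => x Hx cx.
apply: sup_root_level_convex => [k y Y|k m q M Z1 Z2 k0 m0 q01 M0]; first exact: relaxed_ge0.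
have km0 : (0 < k * m)%N by rewrite muln_gt0 k0.
have cg1 := cx _ k0; have cg2 := cx _ km0.
have step1 (Z1' : 'M[rat]_(d, n)) : ineq k m q M x (map_mx ratr Z1') Z2.
  apply: (le_rat_mx (h1 := fun Z : Mat => g k x (ratr q *: map_mx ratr Z1' + (1 - ratr q)
    *: Z)%R)
    (h2 := fun Z : Mat => ratr M ^+ k / ratr M ^+ (k * m) / m%:R * (g (k * m) x (map_mx
      ratr Z1') + g (k * m) x Z) + ratr M ^+ k)).
  - move=> Z; have c1 := @scaler_continuous _ _ (1 - ratr q : R) Z.
    have c2 := continuousD (@cst_continuous Mat Mat (ratr q *: map_mx ratr Z1') Z) c1.
    exact: (continuous_comp c2 (cg1 _)).
  - move=> Z; have c1 := continuousD (@cst_continuous _ _ (g (k * m) x (map_mx ratr Z1'))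
    Z) (cg2 Z).
    have c2 := continuousM (@cst_continuous _ _ (ratr M ^+ k / ratr M ^+ (k * m) / m%:R :
      R) Z) c1.
    exact: (continuousD c2 (@cst_continuous _ _ (ratr M ^+ k : R) Z)).
  - by move=> Z; exact: (Hx ((k, m), (q, M), (Z1', Z))).
apply: (le_rat_mx (h1 := fun Z : Mat => g k x (ratr q *: Z + (1 - ratr q) *: Z2)%R)
  (h2 := fun Z : Mat => ratr M ^+ k / ratr M ^+ (k * m) / m%:R * (g (k * m) x Z + g (k * m)
    x Z2) + ratr M ^+ k)).
- move=> Z; have c1 := @scaler_continuous _ _ (ratr q : R) Z.
  have c2 := continuousD c1 (@cst_continuous Mat Mat ((1 - ratr q) *: Z2) Z).
  exact: (continuous_comp c2 (cg1 _)).
- move=> Z; have c1 := continuousD (cg2 Z) (@cst_continuous _ _ (g (k * m) x Z2) Z).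
  have c2 := continuousM (@cst_continuous _ _ (ratr M ^+ k / ratr M ^+ (k * m) / m%:R :
    R) Z) c1.
  exact: (continuousD c2 (@cst_continuous _ _ (ratr M ^+ k : R) Z)).
- exact: step1.
Qed.

End relaxed_sup_root.

(** * Averaging a competitor over its translates *)

Section averaging.
Variables (R : realType) (n d : nat).
Local Notation Rn := 'rV[R]_n.
Local Notation Rd := 'rV[R]_d.
Local Notation Mat := 'M[R]_(d, n).
Local Notation mu := (lebesgue_rV R n).
Local Notation e_ j := (delta_mx 0 j : Rn).

Lemma loc_ess_bounded_ae (V : normedModType R) (h1 h2 : Rn -> V) :
  {ae mu, forall x, h1 x = h2 x} -> loc_ess_bounded h1 -> loc_ess_bounded h2.
Proof.
move=> h12 b1 K cK; have [M HM] := b1 K cK; exists M.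
by apply: filter_app HM; apply: filterS h12 => x ->.
Qed.

Lemma loc_ess_bounded_shiftv (V : normedModType R) e (h : Rn -> V) :
  loc_ess_bounded h -> loc_ess_bounded (h \o shiftv e).
Proof.
move=> b K cK; have [M HM] := b _ (compact_shiftv (e := - e) cK); exists M.
by apply: filterS (ae_shiftv e HM) => x Hx Kx; apply: Hx; rewrite /= shiftvK.
Qed.

Lemma loc_ess_bounded_lincomb (V : normedModType R) (I : finType) (c : R) (h : I -> Rn -> V) :
  (forall i, loc_ess_bounded (h i)) -> loc_ess_bounded (fun x => c *: \sum_i h i x).
Proof.
move=> b K cK.
have /choice[M HM] i : exists M : R, {ae mu, forall x, K x -> `|h i x| <= M} := b i K cK.
exists (`|c| * \sum_i M i); have := ae_countable HM.
apply: filterS => x Hx Kx; rewrite normrZ ler_wpM2l//.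
by apply: le_trans (ler_norm_sum _ _ _) _; apply: ler_sum => i _; exact: Hx.
Qed.

Section average.
Variables (j : nat) (j_gt0 : (0 < j)%N) (u : Rn -> Rd).
Hypothesis u_per : sobolev_per (d := d) j u.

Local Notation idx := {ffun 'I_n -> 'I_j}.

(** The vectors with coordinates in [{0, .., j - 1}] are indexed by finite
    functions, so that a unit step can be undone by a permutation of the index
    type. *)
Definition lattice_vec (k : idx) : Rn := \row_i (k i)%:R.

Definition lattice_mean (V : lmodType R) (w : Rn -> V) (x : Rn) : V :=
  #|{: idx}|%:R^-1 *: \sum_(k : idx) w (shiftv (lattice_vec k) x).

Lemma lattice_mean_weak_gradient :
  is_weak_gradient setT (lattice_mean u) (lattice_mean (weak_gradient setT u)).
Proof.
have [wu _ _ _] := u_per; have uG := weak_gradientP wu.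
have uGk (k : idx) := is_weak_gradient_shiftv (lattice_vec k) uG.
have S := is_weak_gradient_sum (index_enum idx) (@openT _) uGk.
(* Scaling is the case of a linear combination with a zero coefficient. *)
have := is_weak_gradient_lin #|{: idx}|%:R^-1 0 (@openT _) S S.
by congr is_weak_gradient; apply/funext => x; rewrite scale0r addr0.
Qed.

(** A unit step is a cyclic step of one coordinate of the index, up to a period
    of length [j]. *)
Lemma lattice_vec_ordS (i : 'I_n) (k : idx) :
  let k' : idx := [ffun l => if l == i then ordS (k l) else k l] in
  lattice_vec k + e_ i = lattice_vec k' \/ lattice_vec k + e_ i =
    lattice_vec k' + j%:R *: e_ i.
Proof.
move=> k'; have [kj|] := ltnP (k i).+1 j.
  left; apply/rowP => l; rewrite !mxE ffunE eqxx /=; case: eqP => [->|_] /=.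
    by rewrite modn_small// natr1.
  by rewrite addr0.
rewrite leq_eqVlt ltnNge ltn_ord orbF => /eqP kj; right.
apply/rowP => l; rewrite !mxE ffunE eqxx /=; case: eqP => [->|_] /=.
  by rewrite natr1 -kj modnn mulr1 add0r.
by rewrite mulr0.
Qed.

(** A unit step permutes the terms of the mean, up to the periods of [u]. *)
Lemma lattice_mean_periodic i : {ae mu, forall x, lattice_mean u (x + 1%:R *: e_ i) =
  lattice_mean u x}.
Proof.
have [_ _ _ /(_ i) pu] := u_per.
have H : {ae mu, forall x, forall k : idx,
    u (shiftv (lattice_vec k) x + j%:R *: e_ i) = u (shiftv (lattice_vec k) x)}.
  apply: ae_countable => k.
  exact: (ae_shiftv (lattice_vec k) (P := fun x => u (x + j%:R *: e_ i) = u x)).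
apply: filterS H => x Hx; rewrite /lattice_mean; congr (_ *: _).
(* The permutation of the indices that compensates the unit step. *)
pose s (k : idx) : idx := [ffun l => if l == i then ordS (k l) else k l].
have s_inj : injective s.
  move=> k1 k2 /ffunP sE; apply/ffunP => l; have := sE l; rewrite !ffunE.
  by case: eqP => // _ /ordS_inj.
rewrite [RHS](reindex_inj s_inj)/=; apply: eq_bigr => k _.
rewrite scale1r {1}/shiftv -addrA [e_ i + _]addrC.
by case: (lattice_vec_ordS i k) => -> //; rewrite addrA Hx.
Qed.

Lemma lattice_mean_sobolev_per : sobolev_per 1 (lattice_mean u).
Proof.
have [wu bu bG _] := u_per; split.
- by exists (lattice_mean (weak_gradient setT u)); exact: lattice_mean_weak_gradient.
- apply: loc_ess_bounded_lincomb => k; exact: loc_ess_bounded_shiftv.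
- apply: (@loc_ess_bounded_ae _ (lattice_mean (weak_gradient setT u))).
    have := weak_gradient_ae (@openT _) lattice_mean_weak_gradient.
    by apply: filterS => x ->.
  apply: loc_ess_bounded_lincomb => k; exact: loc_ess_bounded_shiftv.
- exact: lattice_mean_periodic.
Qed.

Lemma cube_shiftv (k : idx) x : cube 1 x -> cube j%:R (shiftv (lattice_vec k) x).
Proof.
move=> x01 i; have /andP[x0 x1] := x01 i; rewrite !mxE ltr_wpDr//=.
rewrite (@lt_le_trans _ _ (1 + (k i)%:R))// ?ltrD2r//.
by rewrite nat1r ler_nat.
Qed.

(** At almost every [x] of the unit cube, the points [x + k] lie in the cube of
    side [j], and [h x (Z + Du (x + k)) <= h (x + k) (Z + Du (x + k)) <= y]
    whenever [y] bounds the second function.  The gradient of the mean stays in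
    the sublevel set. *)
Lemma ess_sup_lattice_mean (h : Rn -> Mat -> \bar R) Z :
  {ae mu, forall x, rat_level_convex (h x)} ->
  (forall k : idx, {ae mu, forall x, forall Z, (h x Z <= h (x + lattice_vec k)%R Z)%E}) ->
  (ess_sup_on (cube 1) (fun x => h x (Z + weak_gradient setT (lattice_mean u) x)%R) <=
   ess_sup_on (cube j%:R) (fun x => h x (Z + weak_gradient setT u x)%R))%E.
Proof.
move=> hlc hsh; apply: le_ereal_inf_tmp => y /= Hy.
have {}Hy : {ae mu, forall x, forall k : idx, cube j%:R (shiftv (lattice_vec k) x) ->
    (h (shiftv (lattice_vec k) x) (Z + weak_gradient setT u (shiftv (lattice_vec k) x))%R
      <= y)%E}.
  by apply: ae_countable => k; exact: (ae_shiftv (lattice_vec k) Hy).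
have {}hsh := ae_countable hsh.
have wG := weak_gradient_ae (@openT _) lattice_mean_weak_gradient.
apply: ereal_inf_lbound => /=.
apply: filter_app wG; apply: filter_app hlc; apply: filter_app hsh.
apply: filterS Hy => x Hy hsh hlc wG cx; rewrite wG//.
pose F (k : idx) := Z + weak_gradient setT u (shiftv (lattice_vec k) x).
have Fy k : (h x (F k) <= y)%E.
  by apply: le_trans (hsh k _) _; apply: Hy; exact: cube_shiftv.
have N0 : #|{: idx}|%:R != 0 :> R.
  by rewrite pnatr_eq0 card_ffun !card_ord -lt0n expn_gt0 j_gt0.
have -> : Z + lattice_mean (weak_gradient setT u) x = #|{: idx}|%:R^-1 *: \sum_(k : idx) F k.
  rewrite big_split/= scalerDr sumr_const -(scaler_nat (R := R) (V := Mat)).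
  by rewrite (scalerA (R := R) (s := Mat)) mulVf// scale1r.
rewrite -(big_map F xpredT id) cardE -[in X in X%:R](size_map F).
have : [seq F k | k <- enum idx] != [::].
  by rewrite -size_eq0 size_map -cardE -(pnatr_eq0 R).
rewrite -[index_enum _]enumT.
case E : [seq F k | k <- enum idx] => [//|Z0 s] _.
apply: rat_level_convex_mean hlc _ => Z'; rewrite -E => /mapP[k _ ->].
exact: Fy.
Qed.

End average.

Lemma periodic_lattice_vec (T : Type) (h : Rn -> T) j (k : {ffun 'I_n -> 'I_j}) :
  (forall i x, h (x + e_ i) = h x) -> forall x, h (x + lattice_vec k) = h x.
Proof.
move=> hp; rewrite [lattice_vec k]row_sum_delta.
elim: (index_enum _) => [|i s IH] x; first by rewrite big_nil addr0.
rewrite big_cons mxE addrA IH; elim: (nat_of_ord _) => [|m IHm];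
  first by rewrite scale0r addr0.
by rewrite -natr1 scalerDl scale1r addrA hp.
Qed.

End averaging.

Theorem proposition4p4 (R : realType) (n d : nat)
    (n_gt0 : (0 < n)%N) (d_gt0 : (0 < d)%N)
    (f : 'rV[R]_n -> 'M[R]_(d, n) -> R) (alpha beta : R)
    (f_ge0 : forall x Z, 0 <= f x Z)
    (f_borel : borel_fun (fun p : 'rV[R]_n * 'M[R]_(d, n) => f p.1 p.2))
    (f_per : forall (i : 'I_n) x Z, f (x + delta_mx 0 i) Z = f x Z)
    (alpha_gt0 : 0 < alpha) (beta_gt0 : 0 < beta)
    (f_growth : forall x Z,
      alpha * rows_norm Z <= f x Z <= beta * (rows_norm Z + 1))
    (f_lc : forall x, level_convex (f x))
    (ftilde : nat -> 'rV[R]_n -> 'M[R]_(d, n) -> R)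
    (ftildeP : forall k, (0 < k)%N ->
      relaxed_density k (fun x Z => f x Z ^+ k) (ftilde k))
    (Z : 'M[R]_(d, n)) :
  hom_density (sup_root ftilde) Z = cell_inf (sup_root ftilde) 1 Z.
Proof.
have f_le x Y : f x Y <= beta * (rows_norm Y + 1) by have /andP[] := f_growth x Y.
apply/le_anti/andP; split; first by apply: ereal_inf_lbound; exists 1%N.
apply: le_ereal_inf_tmp => _ [j /= j_gt0 <-]; apply: le_ereal_inf_tmp => _ [u su <-].
have lc := ae_sup_root_level_convex f_ge0 f_borel f_le beta_gt0 ftildeP f_lc.
have sh (k : {ffun 'I_n -> 'I_j}) := ae_sup_root_shiftv f_ge0 f_le beta_gt0 ftildeP
  (fun x Y => periodic_lattice_vec k (fun i x => f_per i x Y) x).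
apply: le_trans (ess_sup_lattice_mean j_gt0 su Z lc sh).
by apply: ereal_inf_lbound; exists (lattice_mean j u) => //; exact: lattice_mean_sobolev_per.
Qed.
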